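(* Let $X$ be an Asplund space, $\varphi:X\to\,]-\infty,+\infty]$ be proper and lower semicontinuous, and $\alpha>0$. Then $\varphi$ is $\alpha$-robustly quasiconvex if and only if for all $(x,x^* ),(y,y^* )$ with $x^*\in\widehat\partial\varphi(x)$ and $y^*\in\widehat\partial\varphi(y)$, $$\min\{\langle x^*,y-x\rangle,\ \langle y^*,x-y\rangle\}>-\alpha\|y-x\|\ \Longrightarrow\ \langle x^*-y^*,x-y\rangle\ge 0.$$
   Context: A function $f$ is quasiconvex if $f(\lambda x+(1-\lambda)y)\le\max\{f(x),f(y)\}$ for all $x,y\in X$, $\lambda\in\,]0,1[$. For $v^*\in X^*$, $\varphi_{v^*}(x):=\varphi(x)+\langle v^*,x\rangle$. $\varphi$ is $\alpha$-robustly quasiconvex if $\varphi_{v^*}$ is quasiconvex for every $v^*\in X^*$ with $\|v^*\|\le\alpha$. For $x\in\operatorname{dom}\varphi=\{x:\varphi(x)<\infty\}$, the Fréchet subdifferential is $\widehat\partial\varphi(x)=\{x^*\in X^*:\ \liminf_{y\to x}\frac{\varphi(y)-\varphi(x)-\langle x^*,y-x\rangle}{\|y-x\|}\ge 0\}$, and $\widehat\partial\varphi(x)=\emptyset$ otherwise. An Asplund space is a Banach space every separable subspace of which has separable dual. *)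

(* Defs.v *)
From Stdlib Require Import Reals.
Open Scope R_scope.

Record NormedSpace := {
  carrier :> Type;
  vzero : carrier;
  vadd : carrier -> carrier -> carrier;
  vopp : carrier -> carrier;
  vscal : R -> carrier -> carrier;
  vnorm : carrier -> R;
  vadd_assoc : forall x y z, vadd x (vadd y z) = vadd (vadd x y) z;
  vadd_comm : forall x y, vadd x y = vadd y x;
  vadd_0 : forall x, vadd x vzero = x;
  vadd_opp : forall x, vadd x (vopp x) = vzero;
  vscal_1 : forall x, vscal 1 x = x;
  vscal_assoc : forall a b x, vscal a (vscal b x) = vscal (a * b) x;
  vscal_distr_v : forall a x y, vscal a (vadd x y) = vadd (vscal a x) (vscal a y);
  vscal_distr_s : forall a b x, vscal (a + b) x = vadd (vscal a x) (vscal b x);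
  vnorm_nonneg : forall x, 0 <= vnorm x;
  vnorm_eq0 : forall x, vnorm x = 0 -> x = vzero;
  vnorm_triangle : forall x y, vnorm (vadd x y) <= vnorm x + vnorm y;
  vnorm_scal : forall a x, vnorm (vscal a x) = Rabs a * vnorm x
}.

Arguments vzero {X} : rename.
Arguments vadd {X} : rename.
Arguments vopp {X} : rename.
Arguments vscal {X} : rename.
Arguments vnorm {X} : rename.

Definition vsub {X : NormedSpace} (x y : X) : X := vadd x (vopp y).

Definition complete (X : NormedSpace) : Prop :=
  forall u : nat -> X,
    (forall eps, eps > 0 -> exists N, forall n m, (n >= N)%nat -> (m >= N)%nat ->
        vnorm (vsub (u n) (u m)) < eps) ->
    exists l : X, forall eps, eps > 0 -> exists N, forall n, (n >= N)%nat ->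
        vnorm (vsub (u n) l) < eps.

Definition linear_subspace {X : NormedSpace} (Y : X -> Prop) : Prop :=
  Y vzero /\ (forall x y, Y x -> Y y -> Y (vadd x y)) /\
  (forall a x, Y x -> Y (vscal a x)).

Definition separable_subspace {X : NormedSpace} (Y : X -> Prop) : Prop :=
  exists d : nat -> X, (forall n, Y (d n)) /\
    forall y, Y y -> forall eps, eps > 0 -> exists n, vnorm (vsub y (d n)) < eps.

(* Bounded (= continuous) linear functionals on a subspace Y; the values of
   f outside Y are irrelevant. *)
Definition bounded_linear_on {X : NormedSpace} (Y : X -> Prop) (f : X -> R) : Prop :=
  (forall x y, Y x -> Y y -> f (vadd x y) = f x + f y) /\
  (forall a x, Y x -> f (vscal a x) = a * f x) /\
  (exists c, forall x, Y x -> Rabs (f x) <= c * vnorm x).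

Definition separable_dual_of {X : NormedSpace} (Y : X -> Prop) : Prop :=
  exists g : nat -> (X -> R), (forall n, bounded_linear_on Y (g n)) /\
    forall h, bounded_linear_on Y h -> forall eps, eps > 0 ->
      exists n, forall y, Y y -> Rabs (h y - g n y) <= eps * vnorm y.

Definition Asplund (X : NormedSpace) : Prop :=
  complete X /\
  forall Y : X -> Prop, linear_subspace Y -> separable_subspace Y -> separable_dual_of Y.

Definition dual_elt {X : NormedSpace} (f : X -> R) : Prop :=
  bounded_linear_on (fun _ => True) f.

Definition dual_norm_le {X : NormedSpace} (f : X -> R) (a : R) : Prop :=
  forall x, Rabs (f x) <= a * vnorm x.

Inductive ereal := Fin (r : R) | PInf.

Definition ele (a b : ereal) : Prop :=
  match a, b with
  | _, PInf => True
  | PInf, Fin _ => False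
  | Fin r, Fin s => r <= s
  end.

Definition elt (a b : ereal) : Prop :=
  match a, b with
  | Fin _, PInf => True
  | PInf, _ => False
  | Fin r, Fin s => r < s
  end.

Definition emax (a b : ereal) : ereal :=
  match a, b with
  | Fin r, Fin s => Fin (Rmax r s)
  | _, _ => PInf
  end.

Definition eadd_r (a : ereal) (r : R) : ereal :=
  match a with Fin s => Fin (s + r) | PInf => PInf end.

Definition dom {X : NormedSpace} (phi : X -> ereal) (x : X) : Prop :=
  phi x <> PInf.

Definition proper {X : NormedSpace} (phi : X -> ereal) : Prop :=
  exists x, dom phi x.

Definition lsc {X : NormedSpace} (phi : X -> ereal) : Prop :=
  forall x t, elt (Fin t) (phi x) ->
    exists delta, delta > 0 /\
      forall y, vnorm (vsub y x) < delta -> elt (Fin t) (phi y).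

Definition quasiconvex {X : NormedSpace} (f : X -> ereal) : Prop :=
  forall x y lam, 0 < lam < 1 ->
    ele (f (vadd (vscal lam x) (vscal (1 - lam) y))) (emax (f x) (f y)).

Definition tilt {X : NormedSpace} (phi : X -> ereal) (v : X -> R) : X -> ereal :=
  fun x => eadd_r (phi x) (v x).

Definition robustly_quasiconvex {X : NormedSpace} (alpha : R) (phi : X -> ereal) : Prop :=
  forall v, dual_elt v -> dual_norm_le v alpha -> quasiconvex (tilt phi v).

(* Frechet subdifferential: xs in hat-partial phi(x) iff x in dom phi, xs in X^*
   and liminf_{y->x} (phi y - phi x - <xs, y-x>)/||y-x|| >= 0, written out as
   an epsilon-delta condition. *)
Definition frechet_subdiff {X : NormedSpace} (phi : X -> ereal) (x : X) (xs : X -> R) : Prop :=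
  dual_elt xs /\
  exists px, phi x = Fin px /\
    forall eps, eps > 0 -> exists delta, delta > 0 /\
      forall y, 0 < vnorm (vsub y x) < delta ->
        ele (Fin (px + xs (vsub y x) - eps * vnorm (vsub y x))) (phi y).

(* Main.v *)
(** Only quasiconvexity of a single lower semicontinuous [f] matters: by tilting, the
    implication of the theorem reads "no two Frechet subgradients [p] at [a] and [q] at
    [b] satisfy [p (b - a) > 0] and [q (a - b) > 0]" (quasimonotonicity) for every
    [f = tilt phi v].

    A quasiconvex function cannot increase from both ends of a segment towards its
    interior; when the implication fails, a Hahn-Banach functional of norm at most
    [alpha] tilts [phi] so that it does.

    Conversely, if [f] is quasimonotone but not quasiconvex, an approximate mean value
    theorem applied twice yields two forbidden subgradients (Aussel, Corvellec and
    Lassonde). The mean value theorem is reduced to a closed separable subspace [Y]: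
    whether a subgradient of the restriction of [f] to [Y] extends to a subgradient of
    [f] is decided, through Hahn-Banach, by inequalities with countably many parameters,
    and [Y] is closed under choosing witnesses for their failure. On [Y], whose dual is
    separable, the norm is uniformly approximated by Frechet differentiable convex
    functions, so that the Borwein-Preiss perturbation argument produces exact
    minimisers with differentiable perturbations, hence Frechet subgradients. *)
From Stdlib Require Import Reals Lra Lia List.
From Stdlib Require Import ClassicalEpsilon FunctionalExtensionality PropExtensionality ProofIrrelevance.
From Coquelicot Require Import Coquelicot.
From mathcomp Require Import choice.
From mathcomp.classical Require boolp classical_sets.
Require Import Defs.
Import List ListNotations.
Open Scope R_scope.

(** * Linear identities in normed spaces *)

(** Two obstacles shape the proof. A subgradient of the restriction of [f] to a subspace [Y] need
    not extend to one of [f], and [Y] has to be fixed before the subgradient is known. Extending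
    asks for a bounded functional below a convex cone, so by Hahn-Banach a failure is witnessed by a
    finite list of weighted points; rounding weights, centres and levels to countable data lets all
    possible witnesses be put into [Y] in advance. On [Y] the given norm need not be differentiable
    away from zero. Its approximants are convex conjugates: where the supremum defining a conjugate
    has a maximiser to which all near maximisers are close in norm, that maximiser is the Frechet
    derivative. In the mean value theorem the subgradient is positive towards a target that may lie
    beyond the segment; this lets the first application aim at the far endpoint, and the second one
    back at the point produced by the first. *)

Inductive vexpr :=
| VVar (i : nat)
| VZero
| VAdd (a b : vexpr)
| VOpp (a : vexpr)
| VScal (r : R) (a : vexpr).

Fixpoint veval {X : NormedSpace} (env : list X) (e : vexpr) : X :=
  match e with
  | VVar i => nth i env vzero
  | VZero => vzero
  | VAdd a b => vadd (veval env a) (veval env b)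
  | VOpp a => vopp (veval env a)
  | VScal r a => vscal r (veval env a)
  end.

Fixpoint vcoef (i : nat) (e : vexpr) : R :=
  match e with
  | VVar j => if Nat.eqb i j then 1 else 0
  | VZero => 0
  | VAdd a b => vcoef i a + vcoef i b
  | VOpp a => - vcoef i a
  | VScal r a => r * vcoef i a
  end.

Fixpoint lincomb {X : NormedSpace} (c : nat -> R) (env : list X) : X :=
  match env with
  | nil => vzero
  | x :: l => vadd (vscal (c O) x) (lincomb (fun i => c (S i)) l)
  end.

Lemma vscal_0_l {X : NormedSpace} (x : X) : vscal 0 x = vzero.
Proof.
  assert (H : vadd (vscal 0 x) (vscal 0 x) = vscal 0 x)
    by (rewrite <- vscal_distr_s; f_equal; ring).
  rewrite <- (vadd_0 _ (vscal 0 x)), <- (vadd_opp _ (vscal 0 x)) at 1.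
  rewrite vadd_assoc, H. apply vadd_opp.
Qed.

Lemma vscal_0_r {X : NormedSpace} (a : R) : vscal a (vzero : X) = vzero.
Proof.
  rewrite <- (vscal_0_l (vzero : X)) at 1. rewrite vscal_assoc.
  replace (a * 0) with 0 by ring. apply vscal_0_l.
Qed.

Lemma vopp_scal {X : NormedSpace} (x : X) : vopp x = vscal (-1) x.
Proof.
  assert (H : vadd x (vscal (-1) x) = vzero).
  { rewrite <- (vscal_1 _ x) at 1. rewrite <- vscal_distr_s.
    replace (1 + -1) with 0 by ring. apply vscal_0_l. }
  rewrite <- (vadd_0 _ (vopp x)), <- H, vadd_assoc, (vadd_comm _ (vopp x)), vadd_opp.
  now rewrite vadd_comm, vadd_0.
Qed.

Lemma vadd_swap {X : NormedSpace} (a b c d : X) :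
  vadd (vadd a b) (vadd c d) = vadd (vadd a c) (vadd b d).
Proof.
  rewrite <- !vadd_assoc. f_equal. rewrite !vadd_assoc. f_equal. apply vadd_comm.
Qed.

Lemma lincomb_ext {X : NormedSpace} (c d : nat -> R) (env : list X) :
  (forall i, (i < length env)%nat -> c i = d i) -> lincomb c env = lincomb d env.
Proof.
  revert c d; induction env as [|x l IH]; intros c d H; simpl; auto.
  rewrite (H O) by (simpl; lia). f_equal. apply IH.
  intros i Hi. apply H. simpl. lia.
Qed.

Lemma lincomb_0 {X : NormedSpace} (env : list X) : lincomb (fun _ => 0) env = vzero.
Proof.
  induction env as [|x l IH]; simpl; auto. now rewrite IH, vscal_0_l, vadd_0.
Qed.

Lemma lincomb_add {X : NormedSpace} (c d : nat -> R) (env : list X) :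
  vadd (lincomb c env) (lincomb d env) = lincomb (fun i => c i + d i) env.
Proof.
  revert c d; induction env as [|x l IH]; intros c d; simpl.
  - apply vadd_0.
  - now rewrite vadd_swap, vscal_distr_s, IH.
Qed.

Lemma lincomb_scal {X : NormedSpace} (a : R) (c : nat -> R) (env : list X) :
  vscal a (lincomb c env) = lincomb (fun i => a * c i) env.
Proof.
  revert c; induction env as [|x l IH]; intros c; simpl.
  - apply vscal_0_r.
  - now rewrite vscal_distr_v, vscal_assoc, IH.
Qed.

Lemma lincomb_var {X : NormedSpace} (j : nat) (env : list X) :
  nth j env vzero = lincomb (fun i => if Nat.eqb i j then 1 else 0) env.
Proof.
  revert j; induction env as [|x l IH]; intros [|j]; simpl; auto.
  - now rewrite vscal_1, lincomb_0, vadd_0.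
  - now rewrite IH, vscal_0_l, vadd_comm, vadd_0.
Qed.

Lemma veval_lincomb {X : NormedSpace} (env : list X) (e : vexpr) :
  veval env e = lincomb (fun i => vcoef i e) env.
Proof.
  induction e; simpl.
  - apply lincomb_var.
  - symmetry; apply lincomb_0.
  - rewrite IHe1, IHe2. apply lincomb_add.
  - rewrite IHe, vopp_scal, lincomb_scal. apply lincomb_ext; intros; ring.
  - rewrite IHe. apply lincomb_scal.
Qed.

(** Recursion on [n] instead of a bounded quantifier, so that [cbn] turns it into a conjunction of
    coefficient identities for [vlin]. *)
Fixpoint vcoef_eq (n : nat) (a b : vexpr) : Prop :=
  match n with
  | O => True
  | S m => vcoef m a = vcoef m b /\ vcoef_eq m a b
  end.

Lemma veval_eq {X : NormedSpace} (env : list X) (a b : vexpr) :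
  vcoef_eq (length env) a b -> veval env a = veval env b.
Proof.
  intros H. rewrite !veval_lincomb. apply lincomb_ext.
  induction (length env) as [|n IH]; intros i Hi; [lia|].
  destruct H as [H1 H2]. destruct (Nat.eq_dec i n) as [->|]; [exact H1|].
  apply IH; [exact H2|lia].
Qed.

Ltac vmem x l :=
  match l with
  | nil => constr:(false)
  | x :: _ => constr:(true)
  | _ :: ?l' => vmem x l'
  end.

Ltac vadd_atom x l :=
  match vmem x l with
  | true => l
  | false => constr:(x :: l)
  end.

Ltac vatoms e l :=
  match e with
  | vzero => l
  | vadd ?a ?b => let l' := vatoms a l in vatoms b l'
  | vsub ?a ?b => let l' := vatoms a l in vatoms b l'
  | vopp ?a => vatoms a l
  | vscal _ ?a => vatoms a l
  | ?x => vadd_atom x l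
  end.

Ltac vindex x l :=
  match l with
  | x :: _ => constr:(O)
  | _ :: ?l' => let n := vindex x l' in constr:(S n)
  end.

Ltac vreify e l :=
  match e with
  | vzero => constr:(VZero)
  | vadd ?a ?b => let a' := vreify a l in let b' := vreify b l in constr:(VAdd a' b')
  | vsub ?a ?b => let a' := vreify a l in let b' := vreify b l in constr:(VAdd a' (VOpp b'))
  | vopp ?a => let a' := vreify a l in constr:(VOpp a')
  | vscal ?r ?a => let a' := vreify a l in constr:(VScal r a')
  | ?x => let i := vindex x l in constr:(VVar i)
  end.

(* Decides equalities between linear combinations of vectors, leaving the
   coefficient identities that [ring] and [field] do not settle. *)
Ltac vlin :=
  match goal with
  | |- @eq (carrier ?X) ?a ?b =>
    let l0 := vatoms a (@nil (carrier X)) in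
    let l := vatoms b l0 in
    let ea := vreify a l in
    let eb := vreify b l in
    change (veval l ea = veval l eb);
    apply veval_eq; cbn [length vcoef_eq vcoef Nat.eqb];
    repeat apply conj; try exact I; try ring; try (field; try lra)
  end.

(** * Norms and bounded linear functionals *)

Lemma vnorm_0 {X : NormedSpace} : vnorm (vzero : X) = 0.
Proof.
  rewrite <- (vscal_0_l vzero), vnorm_scal, Rabs_R0. ring.
Qed.

Lemma vnorm_le_add {X : NormedSpace} (u a b : X) :
  u = vadd a b -> vnorm u <= vnorm a + vnorm b.
Proof. intros ->. apply vnorm_triangle. Qed.

Lemma vnorm_eq_scal {X : NormedSpace} (u : X) (t : R) (a : X) :
  u = vscal t a -> vnorm u = Rabs t * vnorm a.
Proof. intros ->. apply vnorm_scal. Qed.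

Lemma vnorm_opp {X : NormedSpace} (u : X) : vnorm (vopp u) = vnorm u.
Proof. rewrite vopp_scal, vnorm_scal, Rabs_left by lra. ring. Qed.

Lemma vnorm_sub_sym {X : NormedSpace} (u v : X) : vnorm (vsub u v) = vnorm (vsub v u).
Proof. rewrite <- vnorm_opp. f_equal. vlin. Qed.

Lemma vnorm_sub_triangle {X : NormedSpace} (a b c : X) :
  vnorm (vsub a c) <= vnorm (vsub a b) + vnorm (vsub b c).
Proof. apply vnorm_le_add. vlin. Qed.

Lemma vnorm_lipschitz {X : NormedSpace} (a b : X) :
  vnorm a <= vnorm b + vnorm (vsub a b).
Proof. apply vnorm_le_add. vlin. Qed.

Lemma vsub_self {X : NormedSpace} (x : X) : vsub x x = vzero.
Proof. apply vadd_opp. Qed.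

Lemma vsub_eq0 {X : NormedSpace} (x y : X) : vnorm (vsub x y) = 0 -> x = y.
Proof.
  intros H. apply vnorm_eq0 in H.
  transitivity (vadd (vsub x y) y); [vlin|]. rewrite H. vlin.
Qed.

Definition vlinear {X : NormedSpace} (p : X -> R) : Prop :=
  (forall x y, p (vadd x y) = p x + p y) /\ (forall a x, p (vscal a x) = a * p x).

Lemma vlinear_add {X : NormedSpace} (p : X -> R) (x y : X) :
  vlinear p -> p (vadd x y) = p x + p y.
Proof. intros [H _]. apply H. Qed.

Lemma vlinear_scal {X : NormedSpace} (p : X -> R) (a : R) (x : X) :
  vlinear p -> p (vscal a x) = a * p x.
Proof. intros [_ H]. apply H. Qed.

Lemma vlinear_0 {X : NormedSpace} (p : X -> R) : vlinear p -> p vzero = 0.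
Proof. intros H. rewrite <- (vscal_0_l vzero), (vlinear_scal p) by auto. ring. Qed.

Lemma vlinear_opp {X : NormedSpace} (p : X -> R) (x : X) :
  vlinear p -> p (vopp x) = - p x.
Proof. intros H. rewrite vopp_scal, (vlinear_scal p) by auto. ring. Qed.

Lemma vlinear_sub {X : NormedSpace} (p : X -> R) (x y : X) :
  vlinear p -> p (vsub x y) = p x - p y.
Proof. intros H. unfold vsub. rewrite (vlinear_add p), (vlinear_opp p) by auto. ring. Qed.

Ltac plin p Hp :=
  repeat first
    [ rewrite (vlinear_sub p _ _ Hp) | rewrite (vlinear_add p _ _ Hp)
    | rewrite (vlinear_scal p _ _ Hp) | rewrite (vlinear_opp p _ Hp)
    | rewrite (vlinear_0 p Hp) ].

Lemma dual_elt_linear {X : NormedSpace} (p : X -> R) : dual_elt p -> vlinear p.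
Proof. intros (H1 & H2 & _). split; intros; [apply H1|apply H2]; exact I. Qed.

Lemma dual_elt_bound {X : NormedSpace} (p : X -> R) :
  dual_elt p -> exists c, 0 <= c /\ dual_norm_le p c.
Proof.
  intros (_ & _ & c & H). exists (Rmax c 0). split; [apply Rmax_r|].
  intros x. eapply Rle_trans; [apply H; exact I|].
  apply Rmult_le_compat_r; [apply vnorm_nonneg|apply Rmax_l].
Qed.

Lemma dual_elt_intro {X : NormedSpace} (p : X -> R) (c : R) :
  vlinear p -> dual_norm_le p c -> dual_elt p.
Proof.
  intros [H1 H2] H. repeat split; intros; auto. exists c. intros; apply H.
Qed.

Lemma vlinear_comb {X : NormedSpace} (p q : X -> R) (a b : R) :
  vlinear p -> vlinear q -> vlinear (fun x => a * p x + b * q x).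
Proof.
  intros Hp Hq. split; intros; plin p Hp; plin q Hq; ring.
Qed.

Lemma dual_elt_comb {X : NormedSpace} (p q : X -> R) (a b : R) :
  dual_elt p -> dual_elt q -> dual_elt (fun x => a * p x + b * q x).
Proof.
  intros Hp Hq.
  destruct (dual_elt_bound p Hp) as (c & Hc & Hc').
  destruct (dual_elt_bound q Hq) as (d & Hd & Hd').
  apply (dual_elt_intro _ (Rabs a * c + Rabs b * d)).
  - apply vlinear_comb; apply dual_elt_linear; auto.
  - intros x. eapply Rle_trans; [apply Rabs_triang|]. rewrite !Rabs_mult.
    specialize (Hc' x). specialize (Hd' x).
    pose proof (Rabs_pos a). pose proof (Rabs_pos b). nra.
Qed.

Lemma dual_norm_le_dom {X : NormedSpace} (p : X -> R) (c : R) :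
  vlinear p -> (forall x, p x <= c * vnorm x) -> dual_norm_le p c.
Proof.
  intros Hp H x. apply Rabs_le. split; [|apply H].
  specialize (H (vopp x)). rewrite vnorm_opp in H. rewrite (vlinear_opp p) in H by auto. lra.
Qed.

(** * The Hahn-Banach theorem *)

Lemma functional_choice {A B : Type} (Q : A -> B -> Prop) :
  (forall x, exists y, Q x y) -> exists f, forall x, Q x (f x).
Proof.
  intros H. exists (fun x => proj1_sig (constructive_indefinite_description _ (H x))).
  intros x. apply (proj2_sig (constructive_indefinite_description _ (H x))).
Qed.

(** Total because [Rbar.real] returns 0 on infinite values; meaningful only for nonempty sets
    bounded above. *)
Definition rsup (E : R -> Prop) : R := Rbar.real (Lub.Lub_Rbar E).

Lemma rsup_lub (E : R -> Prop) :
  (exists x, E x) -> (exists m, forall x, E x -> x <= m) -> is_lub E (rsup E).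
Proof.
  intros [x Hx] [m Hm]. unfold rsup.
  destruct (Lub.Lub_Rbar_correct E) as [H1 H2].
  pose proof (H1 x Hx) as H3.
  assert (H4 : Rbar.Rbar_le (Lub.Lub_Rbar E) (Rbar.Finite m))
    by (apply H2; intros y Hy; apply Hm; exact Hy).
  destruct (Lub.Lub_Rbar E) as [l| |]; simpl in *; try contradiction.
  split.
  - intros y Hy. exact (H1 y Hy).
  - intros b Hb. apply (H2 (Rbar.Finite b)). intros y Hy. apply Hb. exact Hy.
Qed.

Lemma rsup_ub (E : R -> Prop) (m x : R) :
  (forall y, E y -> y <= m) -> E x -> x <= rsup E.
Proof.
  intros Hm Hx. apply (rsup_lub E); eauto.
Qed.

Lemma rsup_le (E : R -> Prop) (m : R) :
  (exists x, E x) -> (forall y, E y -> y <= m) -> rsup E <= m.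
Proof.
  intros Hx Hm. apply (rsup_lub E); eauto.
Qed.

Lemma rsup_approx (E : R -> Prop) (m eps : R) :
  (exists x, E x) -> (forall y, E y -> y <= m) -> eps > 0 ->
  exists x, E x /\ rsup E - eps < x.
Proof.
  intros Hx Hm He. apply NNPP. intros H.
  assert (rsup E <= rsup E - eps); [|lra].
  apply rsup_le; auto. intros y Hy. destruct (Rle_lt_dec y (rsup E - eps)); auto.
  exfalso; apply H; eauto.
Qed.

Definition rinf (E : R -> Prop) : R := - rsup (fun r => E (- r)).

Lemma rinf_lb (E : R -> Prop) (m x : R) :
  (forall y, E y -> m <= y) -> E x -> rinf E <= x.
Proof.
  intros Hm Hx. unfold rinf.
  assert (- x <= rsup (fun r => E (- r))); [|lra].
  apply (rsup_ub _ (- m)).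
  - intros y Hy. specialize (Hm _ Hy). lra.
  - now rewrite Ropp_involutive.
Qed.

Lemma rinf_approx (E : R -> Prop) (m eps : R) :
  (exists x, E x) -> (forall y, E y -> m <= y) -> eps > 0 ->
  exists x, E x /\ x < rinf E + eps.
Proof.
  intros [x Hx] Hm He. unfold rinf.
  destruct (rsup_approx (fun r => E (- r)) (- m) eps) as (y & Hy & Hy').
  - exists (- x). now rewrite Ropp_involutive.
  - intros y Hy. specialize (Hm _ Hy). lra.
  - exact He.
  - exists (- y). split; [exact Hy|lra].
Qed.

Definition sublinear {X : NormedSpace} (P : X -> R) : Prop :=
  (forall x y, P (vadd x y) <= P x + P y) /\
  (forall t x, 0 < t -> P (vscal t x) = t * P x).

(** The graph of a linear functional on a subspace, kept as a relation so that unions of chains stay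
    simple. Single-valuedness follows from domination by a sublinear [P], see
    [dominated_graph_fun]. *)
Definition dominated_graph {X : NormedSpace} (P : X -> R) (g : X -> R -> Prop) : Prop :=
  g vzero 0 /\
  (forall x y a b, g x a -> g y b -> g (vadd x y) (a + b)) /\
  (forall x a t, g x a -> g (vscal t x) (t * a)) /\
  (forall x a, g x a -> a <= P x).

(** The value [c] at [x0] must lie above every [b - P (y - x0)] and below every [P (z + x0) - d].
    Subadditivity makes these compatible, and the supremum of the former is taken. If [x0] is
    already in the domain, domination forces the right value, so no case distinction arises. *)
Lemma dominated_graph_extend {X : NormedSpace} (P : X -> R) (g : X -> R -> Prop) (x0 : X) :
  sublinear P -> dominated_graph P g ->
  exists g', dominated_graph P g' /\ (forall x a, g x a -> g' x a) /\ exists c, g' x0 c.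
Proof.
  intros [Hs Hh] (G0 & Ga & Gs & Gd).
  assert (HP0 : P vzero = 0).
  { pose proof (Hh 2 vzero ltac:(lra)) as H. rewrite vscal_0_r in H. lra. }
  assert (Hgap : forall y b z d, g y b -> g z d -> b - P (vsub y x0) <= P (vadd z x0) - d).
  { intros y b z d Hy Hz. pose proof (Gd _ _ (Ga _ _ _ _ Hy Hz)) as H.
    pose proof (Hs (vsub y x0) (vadd z x0)) as H'.
    replace (vadd (vsub y x0) (vadd z x0)) with (vadd y z) in H' by vlin. lra. }
  set (E := fun r => exists y b, g y b /\ r = b - P (vsub y x0)).
  set (c := rsup E).
  assert (HE : forall r, E r -> r <= P (vadd vzero x0) - 0).
  { intros r (y & b & Hy & ->). now apply Hgap. }
  assert (Hc1 : forall y b, g y b -> b - P (vsub y x0) <= c).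
  { intros y b Hy. apply (rsup_ub E _ _ HE). now exists y, b. }
  assert (Hc2 : forall z d, g z d -> c <= P (vadd z x0) - d).
  { intros z d Hz. apply rsup_le.
    - exists (0 - P (vsub vzero x0)), vzero, 0. auto.
    - intros r (y & b & Hy & ->). now apply Hgap. }
  exists (fun x a => exists y b t, g y b /\ x = vadd y (vscal t x0) /\ a = b + t * c).
  repeat split.
  - exists vzero, 0, 0. split; [exact G0|]. split; [vlin|ring].
  - intros x y a b (y1 & b1 & t1 & H1 & -> & ->) (y2 & b2 & t2 & H2 & -> & ->).
    exists (vadd y1 y2), (b1 + b2), (t1 + t2). split; [now apply Ga|]. split; [vlin|ring].
  - intros x a t (y1 & b1 & t1 & H1 & -> & ->).
    exists (vscal t y1), (t * b1), (t * t1). split; [now apply Gs|]. split; [vlin|ring].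
  - intros x a (y & b & t & H & -> & ->).
    (* Positive homogeneity reduces [t <> 0] to coefficient 1 or -1, where one of the two bounds on
       [c] applies. *)
    destruct (Rtotal_order t 0) as [Ht|[->|Ht]].
    + pose proof (Hc1 _ _ (Gs _ _ (/ - t) H)) as H1.
      replace (vadd y (vscal t x0)) with (vscal (- t) (vsub (vscal (/ - t) y) x0)) by vlin.
      rewrite Hh by lra.
      apply (Rmult_le_compat_l (- t)) in H1; [|lra].
      replace (- t * (/ - t * b - P (vsub (vscal (/ - t) y) x0)))
        with (b - - t * P (vsub (vscal (/ - t) y) x0)) in H1 by (field; lra).
      lra.
    + rewrite vscal_0_l, vadd_0. pose proof (Gd _ _ H). lra.
    + pose proof (Hc2 _ _ (Gs _ _ (/ t) H)) as H1.
      replace (vadd y (vscal t x0)) with (vscal t (vadd (vscal (/ t) y) x0)) by vlin.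
      rewrite Hh by lra.
      apply (Rmult_le_compat_l t) in H1; [|lra].
      replace (t * (P (vadd (vscal (/ t) y) x0) - / t * b))
        with (t * P (vadd (vscal (/ t) y) x0) - b) in H1 by (field; lra).
      lra.
  - intros x a H. exists x, a, 0. split; [exact H|]. split; [vlin|ring].
  - exists c, vzero, 0, 1. split; [exact G0|]. split; [vlin|ring].
Qed.

(** Both [a - b] and [b - a] are values of the graph at zero, where [P] vanishes. *)
Lemma dominated_graph_fun {X : NormedSpace} (P : X -> R) (g : X -> R -> Prop) x a b :
  sublinear P -> dominated_graph P g -> g x a -> g x b -> a = b.
Proof.
  intros [Hs Hh] (G0 & Ga & Gs & Gd) Ha Hb.
  assert (HP0 : P vzero = 0).
  { pose proof (Hh 2 vzero ltac:(lra)) as H. rewrite vscal_0_r in H. lra. }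
  pose proof (Gd _ _ (Ga _ _ _ _ Ha (Gs _ _ (-1) Hb))) as H1.
  pose proof (Gd _ _ (Ga _ _ _ _ Hb (Gs _ _ (-1) Ha))) as H2.
  replace (vadd x (vscal (-1) x)) with (vzero : X) in H1, H2 by vlin. lra.
Qed.

Lemma hahn_banach {X : NormedSpace} (P : X -> R) :
  sublinear P -> exists p, vlinear p /\ forall x, p x <= P x.
Proof.
  intros HP.
  assert (HP0 : P vzero = 0).
  { pose proof (proj2 HP 2 vzero ltac:(lra)) as H. rewrite vscal_0_r in H. lra. }
  set (T := {g : X -> R -> Prop | dominated_graph P g}).
  (* Zorn's lemma is stated for boolean relations, hence [asbool]. *)
  set (le := fun u v : T => boolp.asbool (forall x a, proj1_sig u x a -> proj1_sig v x a)).
  assert (le_iff : forall u v, is_true (le u v) <->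
            forall x a, proj1_sig u x a -> proj1_sig v x a).
  { intros u v. unfold le. split; intros H; [now apply boolp.asboolW|now apply boolp.asboolT]. }
  (* This graph bounds the empty chain. *)
  assert (Hbase : dominated_graph P (fun x a => x = vzero /\ a = 0)).
  { repeat split; intros; repeat match goal with H : _ /\ _ |- _ => destruct H end; subst;
      try vlin; try ring; try lra. }
  destruct (@classical_sets.Zorn T le) as [[g Hg] Hmax].
  - intros t. apply le_iff; auto.
  - intros r s t H1 H2. rewrite le_iff in *. auto.
  - intros [s Hs] [t Ht] H1 H2. rewrite le_iff in *. simpl in *.
    assert (s = t); [|subst; f_equal; apply proof_irrelevance].
    extensionality x. extensionality a. apply propositional_extensionality. split; auto.
  - intros A HA.
    destruct (classic (exists u, A u)) as [[u0 Hu0]|Hempty].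
    + set (g := fun x a => exists u : T, A u /\ proj1_sig u x a).
      assert (Hg : dominated_graph P g).
      { repeat split.
        - exists u0. split; auto. apply (proj2_sig u0).
        - intros x y a b (u & Hu & Hu') (v & Hv & Hv').
          destruct (HA u v Hu Hv) as [H|H];
            pose proof (proj1 (le_iff _ _) H) as H'; [exists v|exists u]; split; auto.
          + apply (proj2_sig v); auto.
          + apply (proj2_sig u); auto.
        - intros x a t (u & Hu & Hu'). exists u. split; auto. apply (proj2_sig u); auto.
        - intros x a (u & Hu & Hu'). apply (proj2_sig u); auto. }
      exists (exist _ g Hg). intros s Hs. apply le_iff. intros x a Hx. now exists s.
    + exists (exist _ _ Hbase). intros s Hs. exfalso; eauto.
  - assert (Htot : forall x, exists a, g x a).
    { intros x. destruct (dominated_graph_extend P g x HP Hg) as (g' & Hg' & Hsub & c & Hc).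
      assert (He : exist _ g' Hg' = exist _ g Hg :> T).
      { apply Hmax. apply le_iff. exact Hsub. }
      apply (f_equal (@proj1_sig _ _)) in He. simpl in He. subst. eauto. }
    set (p := fun x => proj1_sig (constructive_indefinite_description _ (Htot x))).
    assert (Hp : forall x, g x (p x))
      by (intros x; apply (proj2_sig (constructive_indefinite_description _ (Htot x)))).
    destruct Hg as (G0 & Ga & Gs & Gd).
    exists p. split; [split|].
    + intros x y. apply (dominated_graph_fun P g (vadd x y)); auto; repeat split; auto.
    + intros a x. apply (dominated_graph_fun P g (vscal a x)); auto; repeat split; auto.
    + intros x. apply Gd, Hp.
Qed.

Definition convex_cone {X : NormedSpace} (C : X -> R -> Prop) : Prop :=
  C vzero 0 /\
  (forall x y a b, C x a -> C y b -> C (vadd x y) (a + b)) /\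
  (forall x a t, 0 < t -> C x a -> C (vscal t x) (t * a)).

(** Hahn-Banach for [P h], the infimum of [a + K |h - x|] over [(x, a)] in the cone: an infimal
    convolution with [K] times the norm. The lower bound on the cone makes [P] finite, the cone
    point [(0, 0)] yields the norm bound, and [h = x] yields [p x <= a]. Norming functionals,
    extensions from subspaces and the lifting of subgradients are all instances. *)
Lemma bounded_functional_below_cone {X : NormedSpace} (C : X -> R -> Prop) (K : R) :
  0 <= K -> convex_cone C -> (forall x a, C x a -> 0 <= a + K * vnorm x) ->
  exists p, dual_elt p /\ dual_norm_le p K /\ forall x a, C x a -> p x <= a.
Proof.
  intros HK (C0 & Ca & Cs) HC.
  set (E := fun h r => exists x a, C x a /\ r = a + K * vnorm (vsub h x)).
  assert (Hlow : forall h r, E h r -> - K * vnorm h <= r).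
  { intros h r (x & a & Hx & ->). specialize (HC _ _ Hx).
    pose proof (vnorm_lipschitz x h) as H. rewrite vnorm_sub_sym in H. nra. }
  assert (Hne : forall h, E h (0 + K * vnorm (vsub h vzero))) by (intros h; now exists vzero, 0).
  set (P := fun h => rinf (E h)).
  assert (HPle : forall h x a, C x a -> P h <= a + K * vnorm (vsub h x)).
  { intros h x a H. apply (rinf_lb _ _ _ (Hlow h)). now exists x, a. }
  destruct (hahn_banach P) as (p & Hp & HpP).
  - split.
    + intros x y. apply Rnot_lt_le. intros Hlt.
      set (eps := (P (vadd x y) - (P x + P y)) / 2).
      destruct (rinf_approx (E x) _ eps (ex_intro _ _ (Hne x)) (Hlow x)) as (r & (x' & a & Hx & ->) & Hr);
        [unfold eps; lra|].
      destruct (rinf_approx (E y) _ eps (ex_intro _ _ (Hne y)) (Hlow y)) as (s & (y' & b & Hy & ->) & Hs);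
        [unfold eps; lra|].
      fold (P x) in Hr. fold (P y) in Hs.
      pose proof (HPle (vadd x y) _ _ (Ca _ _ _ _ Hx Hy)) as H.
      assert (Ht : vnorm (vsub (vadd x y) (vadd x' y')) <= vnorm (vsub x x') + vnorm (vsub y y'))
        by (apply vnorm_le_add; vlin).
      unfold eps in *. nra.
    + assert (Hle : forall t x, 0 < t -> P (vscal t x) <= t * P x).
      { intros t x Ht. apply Rnot_lt_le. intros Hlt.
        destruct (rinf_approx (E x) _ ((P (vscal t x) - t * P x) / t) (ex_intro _ _ (Hne x)) (Hlow x))
          as (r & (x' & a & Hx & ->) & Hr).
        { apply Rlt_gt, Rdiv_lt_0_compat; lra. }
        fold (P x) in Hr.
        pose proof (HPle (vscal t x) _ _ (Cs _ _ _ Ht Hx)) as H.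
        assert (He : vnorm (vsub (vscal t x) (vscal t x')) = t * vnorm (vsub x x')).
        { rewrite (vnorm_eq_scal _ t (vsub x x')) by vlin. rewrite Rabs_pos_eq; lra. }
        rewrite He in H.
        apply (Rmult_lt_compat_l t) in Hr; [|lra].
        replace (t * (P x + (P (vscal t x) - t * P x) / t)) with (P (vscal t x)) in Hr by (field; lra).
        nra. }
      intros t x Ht. apply Rle_antisym; [now apply Hle|].
      pose proof (Hle (/ t) (vscal t x) (Rinv_0_lt_compat _ Ht)) as H.
      replace (vscal (/ t) (vscal t x)) with x in H by vlin.
      apply (Rmult_le_compat_l t) in H; [|lra].
      replace (t * (/ t * P (vscal t x))) with (P (vscal t x)) in H by (field; lra). exact H.
  - assert (Hn : dual_norm_le p K).
    { apply dual_norm_le_dom; auto. intros x. specialize (HpP x).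
      pose proof (HPle x _ _ C0) as H. replace (vsub x vzero) with x in H by vlin. lra. }
    exists p. split; [now apply (dual_elt_intro p K)|]. split; [exact Hn|].
    intros x a Hx. specialize (HpP x). pose proof (HPle x _ _ Hx) as H.
    rewrite vsub_self, vnorm_0 in H. lra.
Qed.

(** The cone is the ray through [(- z, - |z|)]; lying below it forces [p z >= |z|]. *)
Lemma norming_functional {X : NormedSpace} (z : X) :
  exists p, dual_elt p /\ dual_norm_le p 1 /\ p z = vnorm z.
Proof.
  destruct (bounded_functional_below_cone
    (fun x a => exists t, 0 <= t /\ x = vscal (- t) z /\ a = - t * vnorm z) 1)
    as (p & Hp & Hn & Hc).
  - lra.
  - repeat split.
    + exists 0. split; [lra|]. split; [vlin|ring].
    + intros x y a b (t & Ht & -> & ->) (s & Hs & -> & ->).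
      exists (t + s). split; [lra|]. split; [vlin|ring].
    + intros x a t Ht (s & Hs & -> & ->).
      exists (t * s). split; [nra|]. split; [vlin|ring].
  - intros x a (t & Ht & -> & ->). rewrite vnorm_scal, Rabs_Ropp, Rabs_pos_eq by lra. lra.
  - exists p. split; [exact Hp|]. split; [exact Hn|].
    pose proof (Rle_trans _ _ _ (Rle_abs (p z)) (Hn z)) as H.
    assert (H1 : p (vscal (- (1)) z) <= - (1) * vnorm z) by (apply Hc; exists 1; repeat split; lra).
    rewrite (vlinear_scal p) in H1 by now apply dual_elt_linear. lra.
Qed.

(** * Smooth approximations of the norm *)

Lemma Series_ge0 (a : nat -> R) : (forall k, 0 <= a k) -> ex_series a -> 0 <= Series a.
Proof.
  intros Ha He. rewrite <- (Rmult_0_l (Series a)), <- Series_scal_l.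
  apply Series_le; [|exact He]. intros n. specialize (Ha n). lra.
Qed.

Lemma sum_le_Series (a : nat -> R) (n : nat) :
  (forall k, 0 <= a k) -> ex_series a -> sum_f_R0 a n <= Series a.
Proof.
  intros Ha He. rewrite (Series_incr_n a (S n)); [|lia|exact He]. simpl pred.
  assert (0 <= Series (fun k => a (S n + k)%nat)); [|lra].
  apply Series_ge0; [intros; apply Ha|]. now apply (ex_series_incr_n a).
Qed.

Lemma term_le_Series (a : nat -> R) (n : nat) :
  (forall k, 0 <= a k) -> ex_series a -> a n <= Series a.
Proof.
  intros Ha He. eapply Rle_trans; [|apply (sum_le_Series a n Ha He)].
  destruct n; simpl; [lra|].
  assert (0 <= sum_f_R0 a n); [|lra]. apply cond_pos_sum, Ha.
Qed.

Lemma Series_le_of_sums (a : nat -> R) (c : R) :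
  ex_series a -> (forall n, sum_f_R0 a n <= c) -> Series a <= c.
Proof.
  intros He Hc. apply Series_correct in He.
  change (is_lim_seq (Hierarchy.sum_n a) (Series a)) in He.
  apply (is_lim_seq_le (Hierarchy.sum_n a) (fun _ => c) (Series a) c).
  - intros n. rewrite sum_n_Reals. apply Hc.
  - exact He.
  - apply is_lim_seq_const.
Qed.

Lemma is_series_half_pow : is_series (fun k => (/ 2) ^ S k) 1.
Proof.
  pose proof (is_series_geom (/ 2) ltac:(rewrite Rabs_pos_eq; lra)) as H.
  apply (is_series_scal (/ 2)) in H. unfold Hierarchy.scal in H. simpl in H.
  unfold Hierarchy.mult in H. simpl in H.
  replace (/ 2 * / (1 - / 2)) with 1 in H by field. exact H.
Qed.

Lemma ex_series_half_pow : ex_series (fun k => (/ 2) ^ S k).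
Proof. exists 1. apply is_series_half_pow. Qed.

Lemma ex_series_dom (a b : nat -> R) :
  (forall k, Rabs (a k) <= b k) -> ex_series b -> ex_series a.
Proof. intros H Hb. apply (ex_series_le a b); auto. Qed.

Lemma half_pow_pos (k : nat) : 0 < (/ 2) ^ k.
Proof. apply pow_lt; lra. Qed.

Lemma sum_half_pow_le (n : nat) : sum_f_R0 (fun k => (/ 2) ^ S k) n <= 1.
Proof.
  rewrite <- (is_series_unique _ _ is_series_half_pow).
  apply sum_le_Series; [|exact ex_series_half_pow].
  intros k. left. apply half_pow_pos.
Qed.

(** * A strictly convex gauge on the dual ball *)

Definition dnorm {X : NormedSpace} (p : X -> R) : R :=
  rsup (fun r => exists z, vnorm z <= 1 /\ r = Rabs (p z)).

Lemma dnorm_values_bounded {X : NormedSpace} (p : X -> R) (c : R) :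
  0 <= c -> dual_norm_le p c ->
  forall r, (exists z, vnorm z <= 1 /\ r = Rabs (p z)) -> r <= c.
Proof.
  intros Hc Hp r (z & Hz & ->). eapply Rle_trans; [apply Hp|].
  pose proof (vnorm_nonneg _ z). nra.
Qed.

Lemma dnorm_values_nonempty {X : NormedSpace} (p : X -> R) :
  exists r, exists z : X, vnorm z <= 1 /\ r = Rabs (p z).
Proof. exists (Rabs (p vzero)), vzero. split; [rewrite vnorm_0; lra|reflexivity]. Qed.

Lemma dnorm_le {X : NormedSpace} (p : X -> R) (c : R) :
  0 <= c -> dual_norm_le p c -> dnorm p <= c.
Proof.
  intros Hc Hp. apply rsup_le; [apply dnorm_values_nonempty|].
  now apply dnorm_values_bounded.
Qed.

Lemma dnorm_ge {X : NormedSpace} (p : X -> R) (z : X) :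
  dual_elt p -> vnorm z <= 1 -> Rabs (p z) <= dnorm p.
Proof.
  intros Hp Hz. destruct (dual_elt_bound p Hp) as (c & Hc & Hpc).
  apply (rsup_ub _ c); [now apply dnorm_values_bounded|eauto].
Qed.

Lemma dnorm_nonneg {X : NormedSpace} (p : X -> R) : dual_elt p -> 0 <= dnorm p.
Proof.
  intros Hp. eapply Rle_trans; [apply Rabs_pos|].
  apply (dnorm_ge p vzero Hp). rewrite vnorm_0; lra.
Qed.

Lemma dnorm_bound {X : NormedSpace} (p : X -> R) :
  dual_elt p -> dual_norm_le p (dnorm p).
Proof.
  intros Hp z. pose proof (dual_elt_linear p Hp) as Hl.
  destruct (Req_dec (vnorm z) 0) as [Hz|Hz].
  - apply vnorm_eq0 in Hz. subst. rewrite (vlinear_0 p Hl), Rabs_R0, vnorm_0. lra.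
  - pose proof (vnorm_nonneg _ z) as H0.
    pose proof (dnorm_ge p (vscal (/ vnorm z) z) Hp) as H.
    rewrite vnorm_scal, (vlinear_scal p _ _ Hl), Rabs_mult, Rabs_inv, (Rabs_pos_eq (vnorm z)) in H
      by exact H0.
    assert (H1 : / vnorm z * vnorm z = 1) by (field; exact Hz).
    specialize (H ltac:(lra)).
    apply (Rmult_le_compat_r (vnorm z)) in H; [|exact H0].
    replace (/ vnorm z * Rabs (p z) * vnorm z) with (Rabs (p z)) in H by (field; exact Hz).
    exact H.
Qed.

Lemma dnorm_comb_le {X : NormedSpace} (r p q : X -> R) (a b : R) :
  dual_elt p -> dual_elt q -> (forall x, r x = a * p x + b * q x) ->
  dnorm r <= Rabs a * dnorm p + Rabs b * dnorm q.
Proof.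
  intros Hp Hq Hr.
  pose proof (dnorm_nonneg p Hp). pose proof (dnorm_nonneg q Hq).
  pose proof (Rabs_pos a). pose proof (Rabs_pos b).
  apply dnorm_le; [nra|].
  intros x. rewrite Hr. eapply Rle_trans; [apply Rabs_triang|]. rewrite !Rabs_mult.
  pose proof (dnorm_bound p Hp x). pose proof (dnorm_bound q Hq x). nra.
Qed.

Definition fsub {X : NormedSpace} (p q : X -> R) : X -> R := fun x => 1 * p x + -1 * q x.

Lemma dual_elt_fsub {X : NormedSpace} (p q : X -> R) :
  dual_elt p -> dual_elt q -> dual_elt (fsub p q).
Proof. apply dual_elt_comb. Qed.

Definition dball {X : NormedSpace} (p : X -> R) : Prop := dual_elt p /\ dual_norm_le p 1.

Definition fmid {X : NormedSpace} (p q : X -> R) : X -> R := fun x => / 2 * p x + / 2 * q x.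

Lemma dball_fmid {X : NormedSpace} (p q : X -> R) : dball p -> dball q -> dball (fmid p q).
Proof.
  intros [Hp Hp1] [Hq Hq1]. split; [now apply dual_elt_comb|].
  intros x. unfold fmid. eapply Rle_trans; [apply Rabs_triang|].
  rewrite !Rabs_mult, (Rabs_pos_eq (/ 2)) by lra.
  specialize (Hp1 x). specialize (Hq1 x). lra.
Qed.

Lemma dnorm_fsub_le {X : NormedSpace} (p q : X -> R) :
  dball p -> dual_elt q -> dnorm (fsub p q) <= 1 + dnorm q.
Proof.
  intros [Hp Hp1] Hq.
  pose proof (dnorm_comb_le (fsub p q) p q 1 (-1) Hp Hq (fun x => eq_refl)) as H.
  pose proof (dnorm_le p 1 ltac:(lra) Hp1).
  rewrite Rabs_R1, (Rabs_left (-1)) in H by lra. lra.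
Qed.

Definition dual_gauge_term {X : NormedSpace} (g : nat -> X -> R) (y : nat -> X) (k : nat) (p : X -> R) : R :=
  dnorm (fsub p (g k)) ^ 2 + p (y k) ^ 2.

(** The denominator bounds [dual_gauge_term] on the dual ball, so the weighted term is at most
    [(/ 2) ^ S k] and the gauge takes values in [0, 1]. *)
Definition dual_gauge_weight {X : NormedSpace} (g : nat -> X -> R) (y : nat -> X) (k : nat) : R :=
  (/ 2) ^ S k / ((1 + dnorm (g k)) ^ 2 + vnorm (y k) ^ 2).

(* A strictly convex function on the dual ball along which maximising sequences
   converge: the terms [p (y k)] control weak-star limits, and the distances to the
   norm-dense sequence [g] upgrade weak-star convergence to norm convergence. *)
Definition dual_gauge {X : NormedSpace} (g : nat -> X -> R) (y : nat -> X) (p : X -> R) : R :=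
  Series (fun k => dual_gauge_weight g y k * dual_gauge_term g y k p).

Lemma dual_gauge_weight_bounds {X : NormedSpace} (g : nat -> X -> R) (y : nat -> X) (k : nat) :
  dual_elt (g k) -> 0 < dual_gauge_weight g y k <= (/ 2) ^ S k.
Proof.
  intros Hg. unfold dual_gauge_weight.
  pose proof (dnorm_nonneg _ Hg). pose proof (half_pow_pos (S k)) as Hh.
  assert (Hd : 1 <= (1 + dnorm (g k)) ^ 2 + vnorm (y k) ^ 2) by nra.
  split; [apply Rdiv_lt_0_compat; lra|].
  apply Rle_div_l; [lra|]. nra.
Qed.

Lemma dual_gauge_term_bounds {X : NormedSpace} (g : nat -> X -> R) (y : nat -> X) (k : nat) (p : X -> R) :
  dual_elt (g k) -> dball p ->
  0 <= dual_gauge_weight g y k * dual_gauge_term g y k p <= (/ 2) ^ S k.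
Proof.
  intros Hg Hp. pose proof (dual_gauge_weight_bounds g y k Hg) as [Hw _].
  pose proof (dnorm_fsub_le _ _ Hp Hg) as H1.
  pose proof (dnorm_nonneg _ (dual_elt_fsub _ _ (proj1 Hp) Hg)) as H2.
  pose proof (dnorm_nonneg _ Hg) as H3. pose proof (half_pow_pos (S k)) as Hh.
  pose proof (proj2 Hp (y k)) as H4.
  assert (H5 : dual_gauge_term g y k p <= (1 + dnorm (g k)) ^ 2 + vnorm (y k) ^ 2).
  { unfold dual_gauge_term. apply Rplus_le_compat; [apply pow_incr; lra|].
    rewrite <- (pow2_abs (p (y k))). apply pow_incr. split; [apply Rabs_pos|lra]. }
  assert (H6 : 0 <= dual_gauge_term g y k p) by (unfold dual_gauge_term; nra).
  split; [nra|].
  apply (Rmult_le_compat_l (dual_gauge_weight g y k)) in H5; [|lra].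
  eapply Rle_trans; [exact H5|]. unfold dual_gauge_weight. right. field. nra.
Qed.

Lemma ex_series_dual_gauge {X : NormedSpace} (g : nat -> X -> R) (y : nat -> X) (p : X -> R) :
  (forall k, dual_elt (g k)) -> dball p ->
  ex_series (fun k => dual_gauge_weight g y k * dual_gauge_term g y k p).
Proof.
  intros Hg Hp. apply (ex_series_dom _ _) with (2 := ex_series_half_pow).
  intros k. pose proof (dual_gauge_term_bounds g y k p (Hg k) Hp).
  rewrite Rabs_pos_eq; lra.
Qed.

Lemma dual_gauge_bounds {X : NormedSpace} (g : nat -> X -> R) (y : nat -> X) (p : X -> R) :
  (forall k, dual_elt (g k)) -> dball p -> 0 <= dual_gauge g y p <= 1.
Proof.
  intros Hg Hp. split.
  - apply Series_ge0; [|now apply ex_series_dual_gauge].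
    intros k. apply dual_gauge_term_bounds; auto.
  - rewrite <- (is_series_unique _ _ is_series_half_pow).
    apply Series_le; [|exact ex_series_half_pow].
    intros k. apply dual_gauge_term_bounds; auto.
Qed.

(** The parallelogram identity together with [4 * m ^ 2 <= (a + b) ^ 2]. *)
Lemma midpoint_square_defect (a b m : R) :
  0 <= m <= (a + b) / 2 -> (a - b) ^ 2 <= 2 * (a ^ 2 + b ^ 2 - 2 * m ^ 2).
Proof.
  intros H. assert (m ^ 2 <= ((a + b) / 2) ^ 2) by (apply pow_incr; lra). nra.
Qed.

(** Every summand has a nonnegative midpoint defect by [midpoint_square_defect], so the defect of
    the series dominates that of its [k]-th summand. *)
Lemma dual_gauge_defect {X : NormedSpace} (g : nat -> X -> R) (y : nat -> X) (p q : X -> R) (k : nat) :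
  (forall k, dual_elt (g k)) -> dball p -> dball q ->
  dual_gauge_weight g y k *
    ((dnorm (fsub p (g k)) - dnorm (fsub q (g k))) ^ 2 + (p (y k) - q (y k)) ^ 2)
  <= 2 * (dual_gauge g y p + dual_gauge g y q - 2 * dual_gauge g y (fmid p q)).
Proof.
  intros Hg Hp Hq. set (m := fmid p q).
  assert (Hm : dball m) by now apply dball_fmid.
  pose proof (ex_series_dual_gauge g y p Hg Hp) as Ep.
  pose proof (ex_series_dual_gauge g y q Hg Hq) as Eq.
  pose proof (ex_series_dual_gauge g y m Hg Hm) as Em.
  set (T := dual_gauge_term g y). set (w := dual_gauge_weight g y).
  fold T w in Ep, Eq, Em.
  assert (Hk : forall j, (dnorm (fsub p (g j)) - dnorm (fsub q (g j))) ^ 2 + (p (y j) - q (y j)) ^ 2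
             <= 2 * (T j p + T j q - 2 * T j m)).
  { intros j. unfold T, dual_gauge_term.
    pose proof (dual_elt_fsub _ _ (proj1 Hp) (Hg j)) as Dp.
    pose proof (dual_elt_fsub _ _ (proj1 Hq) (Hg j)) as Dq.
    pose proof (dual_elt_fsub _ _ (proj1 Hm) (Hg j)) as Dm.
    assert (H1 : dnorm (fsub m (g j)) <= (dnorm (fsub p (g j)) + dnorm (fsub q (g j))) / 2).
    { pose proof (dnorm_comb_le (fsub m (g j)) _ _ (/ 2) (/ 2) Dp Dq) as H.
      rewrite Rabs_pos_eq in H by lra.
      enough (dnorm (fsub m (g j)) <= / 2 * dnorm (fsub p (g j)) + / 2 * dnorm (fsub q (g j))) by lra.
      apply H. intros x. unfold fsub, m, fmid. field. }
    pose proof (midpoint_square_defect _ _ _ (conj (dnorm_nonneg _ Dm) H1)) as H2.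
    unfold m, fmid in *. nra. }
  set (b := fun j => w j * T j p + w j * T j q - 2 * (w j * T j m)).
  assert (E2m : ex_series (fun j => 2 * (w j * T j m))) by exact (ex_series_scal_l 2 _ Em).
  assert (Eb1 : ex_series (fun j => w j * T j p + w j * T j q)) by exact (ex_series_plus _ _ Ep Eq).
  assert (Eb : ex_series b) by exact (ex_series_minus _ _ Eb1 E2m).
  assert (Hb : dual_gauge g y p + dual_gauge g y q - 2 * dual_gauge g y m = Series b).
  { unfold b. rewrite Series_minus, Series_plus, Series_scal_l by assumption. reflexivity. }
  assert (Hw : forall j, 0 < w j) by (intros j; apply dual_gauge_weight_bounds, Hg).
  assert (Hbj : forall j, w j * ((dnorm (fsub p (g j)) - dnorm (fsub q (g j))) ^ 2
                    + (p (y j) - q (y j)) ^ 2) <= 2 * b j).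
  { intros j. unfold b. pose proof (Rmult_le_compat_l (w j) _ _ (Rlt_le _ _ (Hw j)) (Hk j)). lra. }
  rewrite Hb. eapply Rle_trans; [apply Hbj|].
  apply Rmult_le_compat_l; [lra|]. apply term_le_Series; [|exact Eb].
  intros j. specialize (Hbj j). specialize (Hw j).
  assert (0 <= w j * ((dnorm (fsub p (g j)) - dnorm (fsub q (g j))) ^ 2 + (p (y j) - q (y j)) ^ 2));
    [apply Rmult_le_pos; [lra|apply Rplus_le_le_0_compat; apply pow2_ge_0]|lra].
Qed.

Definition gauge_obj {X : NormedSpace} (kappa : R) (g : nat -> X -> R) (y : nat -> X) (z : X) (p : X -> R) : R :=
  p z - kappa * dual_gauge g y p.

Definition gauge_conj {X : NormedSpace} (kappa : R) (g : nat -> X -> R) (y : nat -> X) (z : X) : R :=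
  rsup (fun r => exists p, dball p /\ r = gauge_obj kappa g y z p).

Lemma dball_zero {X : NormedSpace} : dball (fun _ : X => 0).
Proof.
  assert (H : dual_norm_le (fun _ : X => 0) 1).
  { intros x. rewrite Rabs_R0. pose proof (vnorm_nonneg _ x). lra. }
  split; [|exact H]. apply (dual_elt_intro _ 1); [|exact H]. split; intros; ring.
Qed.

Lemma gauge_obj_le_norm {X : NormedSpace} (kappa : R) (g : nat -> X -> R) (y : nat -> X) (z : X) (p : X -> R) :
  0 < kappa -> (forall k, dual_elt (g k)) -> dball p -> gauge_obj kappa g y z p <= vnorm z.
Proof.
  intros Hk Hg Hp. unfold gauge_obj.
  pose proof (dual_gauge_bounds g y p Hg Hp). pose proof (proj2 Hp z).
  pose proof (Rle_abs (p z)). nra.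
Qed.

Lemma gauge_obj_le_conj {X : NormedSpace} (kappa : R) (g : nat -> X -> R) (y : nat -> X) (z : X) (p : X -> R) :
  0 < kappa -> (forall k, dual_elt (g k)) -> dball p ->
  gauge_obj kappa g y z p <= gauge_conj kappa g y z.
Proof.
  intros Hk Hg Hp. apply (rsup_ub _ (vnorm z)); [|eauto].
  intros r (q & Hq & ->). now apply gauge_obj_le_norm.
Qed.

Lemma gauge_conj_approx {X : NormedSpace} (kappa : R) (g : nat -> X -> R) (y : nat -> X) (z : X) (eps : R) :
  0 < kappa -> (forall k, dual_elt (g k)) -> 0 < eps ->
  exists p, dball p /\ gauge_conj kappa g y z - eps < gauge_obj kappa g y z p.
Proof.
  intros Hk Hg He.
  destruct (rsup_approx (fun r => exists p, dball p /\ r = gauge_obj kappa g y z p) (vnorm z) eps)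
    as (r & (p & Hp & ->) & Hr); [| |exact He|eauto].
  - exists (gauge_obj kappa g y z (fun _ => 0)), (fun _ => 0). split; [apply dball_zero|reflexivity].
  - intros r (q & Hq & ->). now apply gauge_obj_le_norm.
Qed.

Lemma gauge_conj_bounds {X : NormedSpace} (kappa : R) (g : nat -> X -> R) (y : nat -> X) (z : X) :
  0 < kappa -> (forall k, dual_elt (g k)) ->
  vnorm z - kappa <= gauge_conj kappa g y z <= vnorm z.
Proof.
  intros Hk Hg. split.
  - destruct (norming_functional z) as (p & Hp & Hp1 & Hpz).
    assert (Hb : dball p) by (split; assumption).
    eapply Rle_trans; [|apply (gauge_obj_le_conj _ g y z p Hk Hg Hb)].
    unfold gauge_obj. pose proof (dual_gauge_bounds g y p Hg Hb). nra.
  - apply rsup_le.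
    + exists (gauge_obj kappa g y z (fun _ => 0)), (fun _ => 0). split; [apply dball_zero|reflexivity].
    + intros r (q & Hq & ->). now apply gauge_obj_le_norm.
Qed.

(** The midpoint of [p] and [q] cannot beat the supremum, so what it gains, [kappa] times half the
    convexity defect of the gauge, is at most [eta]. *)
Lemma near_maximisers_close {X : NormedSpace} (kappa eta : R) (g : nat -> X -> R) (y : nat -> X) (z : X)
    (p q : X -> R) (k : nat) :
  0 < kappa -> (forall k, dual_elt (g k)) -> dball p -> dball q ->
  gauge_conj kappa g y z - eta <= gauge_obj kappa g y z p ->
  gauge_conj kappa g y z - eta <= gauge_obj kappa g y z q ->
  kappa * dual_gauge_weight g y k *
    ((dnorm (fsub p (g k)) - dnorm (fsub q (g k))) ^ 2 + (p (y k) - q (y k)) ^ 2) <= 4 * eta.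
Proof.
  intros Hk Hg Hp Hq H1 H2.
  pose proof (gauge_obj_le_conj kappa g y z _ Hk Hg (dball_fmid p q Hp Hq)) as H3.
  pose proof (dual_gauge_defect g y p q k Hg Hp Hq) as H4.
  apply (Rmult_le_compat_l kappa) in H4; [|lra].
  unfold gauge_obj in *. unfold fmid at 1 in H3. lra.
Qed.

Lemma square_small (w a b eta d : R) :
  0 < w -> 0 < d -> w * (a ^ 2 + b ^ 2) <= 4 * eta -> 4 * eta <= w * d ^ 2 ->
  Rabs a <= d /\ Rabs b <= d.
Proof.
  intros Hw Hd H1 H2.
  assert (H : a ^ 2 + b ^ 2 <= d ^ 2) by (apply (Rmult_le_reg_l w); lra).
  pose proof (pow2_ge_0 a). pose proof (pow2_ge_0 b).
  split; apply Rabs_le; split; nra.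
Qed.

Lemma dense_seq_pointwise_cauchy {X : NormedSpace} (y : nat -> X) (p : nat -> X -> R) :
  (forall x eps, eps > 0 -> exists n, vnorm (vsub x (y n)) < eps) ->
  (forall n, dball (p n)) ->
  (forall k, Cauchy_crit (fun n => p n (y k))) ->
  forall x, Cauchy_crit (fun n => p n x).
Proof.
  intros Hy Hp Hc x eps He.
  destruct (Hy x (eps / 4) ltac:(lra)) as [k Hk].
  destruct (Hc k (eps / 4) ltac:(lra)) as [N HN].
  exists N. intros n m Hn Hm. specialize (HN n m Hn Hm). unfold Rdist in *.
  pose proof (proj2 (Hp n) (vsub x (y k))) as H1. pose proof (proj2 (Hp m) (vsub x (y k))) as H2.
  rewrite vlinear_sub in H1, H2 by apply dual_elt_linear, Hp.
  apply Rabs_def2 in HN. apply Rabs_def1.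
  - pose proof (Rle_abs (p n x - p n (y k))). pose proof (Rle_abs (- (p m x - p m (y k)))) as H3.
    rewrite Rabs_Ropp in H3. lra.
  - pose proof (Rle_abs (- (p n x - p n (y k)))) as H3. rewrite Rabs_Ropp in H3.
    pose proof (Rle_abs (p m x - p m (y k))). lra.
Qed.

Lemma Un_cv_le_const (u : nat -> R) (l c : R) : Un_cv u l -> (forall n, u n <= c) -> l <= c.
Proof.
  intros Hu Hc. apply Rnot_lt_le. intros H.
  destruct (Hu (l - c) ltac:(lra)) as [N HN]. specialize (HN N (le_n N)).
  unfold Rdist in HN. apply Rabs_def2 in HN. specialize (Hc N). lra.
Qed.

Lemma dball_pointwise_limit {X : NormedSpace} (p : nat -> X -> R) (l : X -> R) :
  (forall n, dball (p n)) -> (forall x, Un_cv (fun n => p n x) (l x)) -> dball l.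
Proof.
  intros Hp Hl.
  assert (Hlin : vlinear l).
  { split.
    - intros x y. apply (UL_sequence (fun n => p n (vadd x y))); [apply Hl|].
      apply (Un_cv_ext (fun n => p n x + p n y)).
      + intros n. symmetry. apply vlinear_add, dual_elt_linear, Hp.
      + now apply CV_plus.
    - intros a x. apply (UL_sequence (fun n => p n (vscal a x))); [apply Hl|].
      apply (Un_cv_ext (fun n => a * p n x)).
      + intros n. symmetry. apply vlinear_scal, dual_elt_linear, Hp.
      + apply (CV_mult (fun _ => a) (fun n => p n x)); [|apply Hl].
        intros e He. exists O. intros. now rewrite Rdist_eq. }
  assert (Hb : dual_norm_le l 1).
  { apply dual_norm_le_dom; [exact Hlin|]. intros x.
    apply (Un_cv_le_const _ _ _ (Hl x)). intros n.
    eapply Rle_trans; [apply Rle_abs|apply Hp]. }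
  split; [|exact Hb]. now apply (dual_elt_intro l 1).
Qed.

(** The dual norm is weak-star lower semicontinuous: a unit vector [u] that nearly attains the norm
    of [l - g k] bounds from below the norms of [p n - g k], since [p n u] converges. *)
Lemma dual_gauge_term_lsc {X : NormedSpace} (g : nat -> X -> R) (y : nat -> X) (k : nat)
    (p : nat -> X -> R) (l : X -> R) (eps : R) :
  dual_elt (g k) -> (forall n, dball (p n)) -> (forall x, Un_cv (fun n => p n x) (l x)) -> 0 < eps ->
  exists N, forall n, (N <= n)%nat -> dual_gauge_term g y k l <= dual_gauge_term g y k (p n) + eps.
Proof.
  intros Hg Hp Hl He.
  pose proof (dball_pointwise_limit p l Hp Hl) as Hlb.
  pose proof (dual_elt_fsub _ _ (proj1 Hlb) Hg) as Dl.
  pose proof (dnorm_nonneg _ Dl) as D0.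
  set (d := dnorm (fsub l (g k))) in *.
  (* [M] dominates the coefficients of [e] in the final error [4 * e * d + 2 * e * |l (y k)|]. *)
  set (M := d + 1 + Rabs (l (y k))). assert (HM : 1 <= M) by (unfold M; pose proof (Rabs_pos (l (y k))); lra).
  set (e := eps / (8 * M)).
  assert (Hep : 0 < e) by (apply Rdiv_lt_0_compat; lra).
  assert (HeM : e * M = eps / 8) by (unfold e; field; lra).
  destruct (rsup_approx (fun r => exists z : X, vnorm z <= 1 /\ r = Rabs (fsub l (g k) z)) d e)
    as (r & (u & Hu & ->) & Hr).
  { apply dnorm_values_nonempty. }
  { apply dnorm_values_bounded; [exact D0|]. now apply dnorm_bound. }
  { lra. }
  change (d - e < Rabs (fsub l (g k) u)) in Hr.
  destruct (Hl u e ltac:(lra)) as [N1 HN1]. destruct (Hl (y k) e ltac:(lra)) as [N2 HN2].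
  exists (Nat.max N1 N2). intros n Hn.
  specialize (HN1 n ltac:(lia)). specialize (HN2 n ltac:(lia)). unfold Rdist in *.
  pose proof (dual_elt_fsub _ _ (proj1 (Hp n)) Hg) as Dn.
  pose proof (dnorm_ge _ u Dn Hu) as H1. pose proof (dnorm_nonneg _ Dn) as H0.
  unfold dual_gauge_term. fold d.
  assert (H2 : d <= dnorm (fsub (p n) (g k)) + 2 * e).
  { pose proof (Rabs_triang (fsub (p n) (g k) u) (l u - p n u)) as H.
    replace (fsub (p n) (g k) u + (l u - p n u)) with (fsub l (g k) u) in H by (unfold fsub; ring).
    rewrite Rabs_minus_sym in HN1. lra. }
  assert (H3 : d ^ 2 <= dnorm (fsub (p n) (g k)) ^ 2 + 4 * e * d).
  { destruct (Rle_lt_dec d (2 * e)) as [H|H].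
    - pose proof (pow2_ge_0 (dnorm (fsub (p n) (g k)))).
      pose proof (Rmult_le_compat_l d _ _ D0 H). nra.
    - assert ((d - 2 * e) ^ 2 <= dnorm (fsub (p n) (g k)) ^ 2) by (apply pow_incr; lra). nra. }
  assert (H4 : l (y k) ^ 2 <= p n (y k) ^ 2 + 2 * e * Rabs (l (y k))).
  { pose proof (Rle_abs (l (y k) * (l (y k) - p n (y k)))) as H.
    rewrite Rabs_mult, (Rabs_minus_sym (l (y k))) in H.
    pose proof (Rmult_le_compat_l _ _ _ (Rabs_pos (l (y k))) (Rlt_le _ _ HN2)).
    pose proof (pow2_ge_0 (l (y k) - p n (y k))). lra. }
  assert (H5 : 4 * e * d + 2 * e * Rabs (l (y k)) <= eps / 2).
  { pose proof (Rabs_pos (l (y k))). unfold M in HeM. nra. }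
  lra.
Qed.

Lemma eventually_forall_le (P : nat -> nat -> Prop) (J : nat) :
  (forall k, exists N, forall n, (N <= n)%nat -> P k n) ->
  exists N, forall n, (N <= n)%nat -> forall k, (k <= J)%nat -> P k n.
Proof.
  intros H. induction J as [|J [N1 H1]].
  - destruct (H O) as [N HN]. exists N. intros n Hn k Hk.
    replace k with O by lia. auto.
  - destruct (H (S J)) as [N2 H2]. exists (Nat.max N1 N2). intros n Hn k Hk.
    destruct (Nat.eq_dec k (S J)) as [->|]; [apply H2; lia|apply H1; lia].
Qed.

Lemma archimed_inv (eps : R) : 0 < eps -> exists N, forall n, (N <= n)%nat -> / (INR n + 1) < eps.
Proof.
  intros He. destruct (archimed_cor1 eps He) as (N & HN & HN0).
  exists N. intros n Hn. eapply Rle_lt_trans; [|exact HN].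
  apply Rinv_le_contravar; [apply lt_0_INR; lia|]. apply le_INR in Hn. lra.
Qed.

(** This replaces weak-star compactness: by [near_maximisers_close] a maximising sequence is Cauchy
    at each [y k], hence at every point, and lower semicontinuity of the gauge makes its pointwise
    limit a maximiser. *)
Lemma gauge_maximiser_exists {X : NormedSpace} (kappa : R) (g : nat -> X -> R) (y : nat -> X) (z : X) :
  0 < kappa -> (forall k, dual_elt (g k)) ->
  (forall x eps, eps > 0 -> exists n, vnorm (vsub x (y n)) < eps) ->
  exists p, dball p /\ gauge_obj kappa g y z p = gauge_conj kappa g y z.
Proof.
  intros Hk Hg Hy. set (th := gauge_conj kappa g y z).
  assert (Hpos : forall n, 0 < / (INR n + 1)).
  { intros n. apply Rinv_0_lt_compat. pose proof (pos_INR n). lra. }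
  destruct (functional_choice (fun n p => dball p /\ th - / (INR n + 1) < gauge_obj kappa g y z p)
    (fun n => gauge_conj_approx kappa g y z _ Hk Hg (Hpos n))) as [p Hp].
  assert (Hpb : forall n, dball (p n)) by (intros n; apply Hp).
  assert (Hc : forall k, Cauchy_crit (fun n => p n (y k))).
  { intros k eps He.
    pose proof (dual_gauge_weight_bounds g y k (Hg k)) as [Hw _].
    set (w := kappa * dual_gauge_weight g y k). assert (0 < w) by (unfold w; nra).
    set (eta := w * (eps / 2) ^ 2 / 4).
    assert (0 < (eps / 2) ^ 2) by (apply pow_lt; lra).
    assert (Heta : 0 < eta) by (unfold eta; nra).
    destruct (archimed_inv eta Heta) as [N HN]. exists N. intros n m Hn Hm.
    pose proof (HN n Hn). pose proof (HN m Hm).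
    destruct (Hp n) as [_ Hn']. destruct (Hp m) as [_ Hm']. fold th in Hn', Hm'.
    pose proof (near_maximisers_close kappa eta g y z (p n) (p m) k Hk Hg (Hpb n) (Hpb m)) as H3.
    fold th w in H3. specialize (H3 ltac:(lra) ltac:(lra)).
    destruct (square_small w _ _ eta (eps / 2) ltac:(lra) ltac:(lra) H3) as [_ H4]; [unfold eta; lra|].
    unfold Rdist. lra. }
  pose proof (dense_seq_pointwise_cauchy y p Hy Hpb Hc) as Hcx.
  set (l := fun x => proj1_sig (Rcomplete.R_complete _ (Hcx x))).
  assert (Hl : forall x, Un_cv (fun n => p n x) (l x))
    by (intros x; exact (proj2_sig (Rcomplete.R_complete _ (Hcx x)))).
  pose proof (dball_pointwise_limit p l Hpb Hl) as Hlb.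
  exists l. split; [exact Hlb|]. apply Rle_antisym; [now apply gauge_obj_le_conj|].
  unfold gauge_obj. fold th.
  assert (H : dual_gauge g y l <= (l z - th) / kappa).
  { apply Series_le_of_sums; [now apply ex_series_dual_gauge|]. intros J.
    apply Rle_div_r; [lra|]. apply Rnot_lt_le. intros Hlt.
    (* The errors to absorb are [kappa * eps] from the partial sum, [eps] from [p n z] and
       [/ (INR n + 1) < eps] from near maximality. *)
    set (eps := (sum_f_R0 (fun k => dual_gauge_weight g y k * dual_gauge_term g y k l) J * kappa
                 - (l z - th)) / (kappa + 3)).
    assert (He : 0 < eps) by (apply Rdiv_lt_0_compat; lra).
    assert (Hek : eps * (kappa + 3) = sum_f_R0 (fun k => dual_gauge_weight g y k * dual_gauge_term g y k l) J * kappa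
                 - (l z - th)) by (unfold eps; field; lra).
    destruct (eventually_forall_le
      (fun k n => dual_gauge_term g y k l <= dual_gauge_term g y k (p n) + eps) J
      (fun k => dual_gauge_term_lsc g y k p l eps (Hg k) Hpb Hl He)) as [N1 HN1].
    destruct (Hl z eps He) as [N2 HN2]. destruct (archimed_inv eps He) as [N3 HN3].
    set (n := Nat.max N1 (Nat.max N2 N3)).
    specialize (HN1 n ltac:(lia)). specialize (HN2 n ltac:(lia)). specialize (HN3 n ltac:(lia)).
    unfold Rdist in HN2. apply Rabs_def2 in HN2.
    destruct (Hp n) as [_ H1]. unfold gauge_obj in H1.
    assert (H2 : sum_f_R0 (fun k => dual_gauge_weight g y k * dual_gauge_term g y k l) J
                 <= dual_gauge g y (p n) + eps).
    { apply Rle_trans with (sum_f_R0 (fun k => dual_gauge_weight g y k * dual_gauge_term g y k (p n)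
                                     + (/ 2) ^ S k * eps) J).
      - apply sum_Rle. intros k Hk'. specialize (HN1 k Hk').
        pose proof (dual_gauge_weight_bounds g y k (Hg k)) as [Hw1 Hw2].
        apply (Rmult_le_compat_l (dual_gauge_weight g y k)) in HN1; [|lra].
        pose proof (Rmult_le_compat_r eps _ _ (Rlt_le _ _ He) Hw2). lra.
      - rewrite sum_plus, <- scal_sum. apply Rplus_le_compat.
        + apply (sum_le_Series (fun k => dual_gauge_weight g y k * dual_gauge_term g y k (p n))).
          * intros k. apply dual_gauge_term_bounds; auto.
          * now apply ex_series_dual_gauge.
        + pose proof (sum_half_pow_le J). nra. }
    apply (Rmult_le_compat_l kappa) in H2; [|lra]. nra. }
  apply (Rmult_le_compat_l kappa) in H; [|lra].
  replace (kappa * ((l z - th) / kappa)) with (l z - th) in H by (field; lra). lra.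
Qed.

(** One index suffices: with [g k] within [eps / 3] of [p], a near maximiser [q] has almost the same
    distance to [g k] as [p], and the triangle inequality through [g k] bounds [q - p]. Norm density
    of [g] is essential here. *)
Lemma gauge_maximiser_strong {X : NormedSpace} (kappa : R) (g : nat -> X -> R) (y : nat -> X) (z : X)
    (p : X -> R) (eps : R) :
  0 < kappa -> (forall k, dual_elt (g k)) ->
  (forall h, dual_elt h -> forall eps, eps > 0 -> exists n, forall y, Rabs (h y - g n y) <= eps * vnorm y) ->
  dball p -> gauge_obj kappa g y z p = gauge_conj kappa g y z -> 0 < eps ->
  exists eta, 0 < eta /\ forall q, dball q ->
    gauge_conj kappa g y z - eta <= gauge_obj kappa g y z q -> dual_norm_le (fsub q p) eps.
Proof.
  intros Hk Hg Hd Hp Hmax He.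
  destruct (Hd p (proj1 Hp) (eps / 3) ltac:(lra)) as [k Hgk].
  pose proof (dual_gauge_weight_bounds g y k (Hg k)) as [Hw _].
  set (w := kappa * dual_gauge_weight g y k). assert (0 < w) by (unfold w; nra).
  set (eta := w * (eps / 3) ^ 2 / 4).
    assert (0 < (eps / 3) ^ 2) by (apply pow_lt; lra).
  assert (Heta : 0 < eta) by (unfold eta; nra).
  exists eta. split; [exact Heta|]. intros q Hq Hqm.
  pose proof (near_maximisers_close kappa eta g y z q p k Hk Hg Hq Hp Hqm ltac:(lra)) as H3.
  fold w in H3.
  destruct (square_small w _ _ eta (eps / 3) ltac:(lra) ltac:(lra) H3) as [H4 _]; [unfold eta; lra|].
  assert (Hpk : dnorm (fsub p (g k)) <= eps / 3).
  { apply dnorm_le; [lra|]. intros x. unfold fsub.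
    replace (1 * p x + -1 * g k x) with (p x - g k x) by ring. apply Hgk. }
  intros x.
  pose proof (dnorm_bound _ (dual_elt_fsub _ _ (proj1 Hq) (Hg k)) x) as H5.
  pose proof (dnorm_bound _ (dual_elt_fsub _ _ (proj1 Hp) (Hg k)) x) as H6.
  pose proof (Rabs_triang (fsub q (g k) x) (- fsub p (g k) x)) as H7.
  replace (fsub q (g k) x + - fsub p (g k) x) with (fsub q p x) in H7 by (unfold fsub; ring).
  rewrite Rabs_Ropp in H7. pose proof (Rle_abs (dnorm (fsub q (g k)) - dnorm (fsub p (g k)))).
  pose proof (vnorm_nonneg _ x). nra.
Qed.

(** The third clause says that [D z] is a subgradient of [th], which encodes convexity; with the
    fourth, [D z] is its Frechet derivative. *)
Definition smooth_near_norm {X : NormedSpace} (kappa : R) (th : X -> R) (D : X -> X -> R) : Prop :=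
  (forall z, vnorm z <= th z <= vnorm z + kappa) /\
  (forall z, dual_elt (D z) /\ dual_norm_le (D z) 1) /\
  (forall z h, th z + D z h <= th (vadd z h)) /\
  (forall z eps, 0 < eps -> exists delta, 0 < delta /\
     forall h, vnorm h < delta -> th (vadd z h) <= th z + D z h + eps * vnorm h).

(* The approximants are the conjugates of small multiples of [dual_gauge] restricted to
   the dual ball. *)
Lemma smooth_norm_approx {X : NormedSpace} (kappa : R) :
  separable_subspace (fun _ : X => True) -> separable_dual_of (fun _ : X => True) -> 0 < kappa ->
  exists (th : X -> R) (D : X -> X -> R), smooth_near_norm kappa th D.
Proof.
  intros (y & _ & Hy0) (g & Hg & Hd0) Hk.
  assert (Hy : forall x eps, eps > 0 -> exists n, vnorm (vsub x (y n)) < eps)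
    by (intros; now apply Hy0).
  assert (Hd : forall h, dual_elt h -> forall eps, eps > 0 ->
     exists n, forall y, Rabs (h y - g n y) <= eps * vnorm y).
  { intros h Hh eps He. destruct (Hd0 h Hh eps He) as [n Hn]. exists n. auto. }
  destruct (functional_choice (fun z p => dball p /\ gauge_obj kappa g y z p = gauge_conj kappa g y z)
    (fun z => gauge_maximiser_exists kappa g y z Hk Hg Hy)) as [D HD].
  (* The conjugate lies between the norm minus [kappa] and the norm; the shift puts the approximant
     above the norm. *)
  exists (fun z => gauge_conj kappa g y z + kappa), D. unfold smooth_near_norm. repeat split.
  - pose proof (gauge_conj_bounds kappa g y z Hk Hg). lra.
  - pose proof (gauge_conj_bounds kappa g y z Hk Hg). lra.
  - apply HD.
  - apply HD.
  - apply HD.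
  - apply HD.
  - intros z h. destruct (HD z) as [Hb Hm].
    pose proof (gauge_obj_le_conj kappa g y (vadd z h) _ Hk Hg Hb) as H.
    unfold gauge_obj in *. rewrite (vlinear_add (D z)) in H by apply dual_elt_linear, Hb. lra.
  - intros z eps He. destruct (HD z) as [Hb Hm].
    destruct (gauge_maximiser_strong kappa g y z (D z) eps Hk Hg Hd Hb Hm He) as (eta & Heta & Hs).
    (* The value [q h], the value [D z h] and the near maximality of [q] at [z + h] cost at most
       [eta / 3] each, so [q] is maximal up to [eta] at [z]. *)
    exists (eta / 3). split; [lra|]. intros h Hh.
    apply Rle_trans with (gauge_conj kappa g y z + D z h + eps * vnorm h + kappa); [|lra].
    apply Rplus_le_compat_r. apply Rnot_lt_le. intros Hlt.
    set (d := gauge_conj kappa g y (vadd z h) - (gauge_conj kappa g y z + D z h + eps * vnorm h)) in *.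
    assert (0 < d) by (unfold d; lra).
    destruct (gauge_conj_approx kappa g y (vadd z h) (Rmin d (eta / 3)) Hk Hg) as (q & Hq & Hqm).
    { apply Rmin_glb_lt; lra. }
    pose proof (Rmin_l d (eta / 3)). pose proof (Rmin_r d (eta / 3)).
    pose proof (gauge_obj_le_conj kappa g y z q Hk Hg Hq) as Hqz.
    pose proof (gauge_obj_le_conj kappa g y (vadd z h) (D z) Hk Hg Hb) as Hz.
    unfold gauge_obj in Hm, Hz, Hqm, Hqz.
    rewrite (vlinear_add q) in Hqm by apply dual_elt_linear, Hq.
    rewrite (vlinear_add (D z)) in Hz by apply dual_elt_linear, Hb.
    pose proof (proj2 Hq h) as Hqh. pose proof (proj2 Hb h) as Hbh.
    pose proof (Rle_abs (q h)). pose proof (Rle_abs (- D z h)) as Hnb. rewrite Rabs_Ropp in Hnb.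
    assert (Hclose : dual_norm_le (fsub q (D z)) eps)
      by (apply Hs; [exact Hq|unfold gauge_obj; lra]).
    specialize (Hclose h). unfold fsub in Hclose.
    pose proof (Rle_abs (1 * q h + -1 * D z h)). unfold d in *. lra.
Qed.

(** * A smooth variational principle *)

Lemma smooth_near_norm_lipschitz {X : NormedSpace} (kappa : R) (th : X -> R) (D : X -> X -> R) (z h : X) :
  smooth_near_norm kappa th D -> th (vadd z h) <= th z + vnorm h.
Proof.
  intros (_ & HD & Hc & _).
  pose proof (Hc (vadd z h) (vopp h)) as H.
  replace (vadd (vadd z h) (vopp h)) with z in H by vlin.
  pose proof (proj2 (HD (vadd z h)) (vopp h)) as H1.
  rewrite vnorm_opp in H1.
  pose proof (Rle_abs (- D (vadd z h) (vopp h))) as H2. rewrite Rabs_Ropp in H2. lra.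
Qed.

Lemma ex_series_scal_half_pow (c : R) : ex_series (fun k => c * (/ 2) ^ S k).
Proof. exact (ex_series_scal_l c _ ex_series_half_pow). Qed.

Lemma Series_le_split (a : nat -> R) (c : R) (n : nat) :
  (forall k, 0 <= a k <= c * (/ 2) ^ S k) ->
  ex_series a /\ Series a <= sum_f_R0 a n + c * (/ 2) ^ S n.
Proof.
  intros Ha.
  assert (He : ex_series a).
  { apply (ex_series_dom a (fun k => c * (/ 2) ^ S k)).
    - intros k. rewrite Rabs_pos_eq; apply Ha.
    - apply ex_series_scal_half_pow. }
  split; [exact He|].
  rewrite (Series_incr_n a (S n)) by (auto; lia). simpl pred. apply Rplus_le_compat_l.
  replace (c * (/ 2) ^ S n) with (Series (fun k => c * (/ 2) ^ S n * (/ 2) ^ S k)).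
  - apply Series_le.
    + intros k. specialize (Ha (S n + k)%nat). split; [apply Ha|].
      replace (c * (/ 2) ^ S n * (/ 2) ^ S k) with (c * (/ 2) ^ S (S n + k)); [apply Ha|].
      rewrite Rmult_assoc, <- pow_add. do 2 f_equal. lia.
    + apply ex_series_scal_half_pow.
  - rewrite Series_scal_l, (is_series_unique _ _ is_series_half_pow). ring.
Qed.

Lemma Series_half_pow_le (a : nat -> R) (c : R) :
  (forall k, Rabs (a k) <= c * (/ 2) ^ S k) -> ex_series a /\ Rabs (Series a) <= c.
Proof.
  intros Ha.
  assert (Hc : ex_series (fun k => c * (/ 2) ^ S k))
    by apply ex_series_scal_half_pow.
  assert (He : ex_series a) by exact (ex_series_dom _ _ Ha Hc).
  split; [exact He|].
  assert (Hab : ex_series (fun k => Rabs (a k))).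
  { apply (ex_series_dom _ _) with (2 := Hc). intros k. rewrite Rabs_Rabsolu. apply Ha. }
  eapply Rle_trans; [apply Series_Rabs, Hab|].
  rewrite <- (Rmult_1_r c), <- (is_series_unique _ _ is_series_half_pow), <- Series_scal_l.
  apply Series_le; [|exact Hc]. intros k. split; [apply Rabs_pos|apply Ha].
Qed.

Lemma eventually_small_half_pow (c eps : R) : 0 < eps ->
  exists N, forall n, (N <= n)%nat -> c * (/ 2) ^ n < eps.
Proof.
  intros He.
  destruct (pow_lt_1_zero (/ 2) ltac:(rewrite Rabs_pos_eq; lra) (eps / (Rabs c + 1))) as [N HN].
  - apply Rlt_gt, Rdiv_lt_0_compat; [exact He|]. pose proof (Rabs_pos c); lra.
  - exists N. intros n Hn. specialize (HN n Hn).
    pose proof (half_pow_pos n) as Hp. rewrite Rabs_pos_eq in HN by lra.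
    pose proof (Rabs_pos c). pose proof (Rle_abs c).
    apply (Rmult_lt_compat_r (Rabs c + 1)) in HN; [|lra].
    replace (eps / (Rabs c + 1) * (Rabs c + 1)) with eps in HN by (field; lra). nra.
Qed.

Lemma eventually_forall_le_radius (Q : nat -> R -> Prop) (J : nat) :
  (forall k d d', Q k d -> d' <= d -> Q k d') ->
  (forall k, exists d, 0 < d /\ Q k d) ->
  exists d, 0 < d /\ forall k, (k <= J)%nat -> Q k d.
Proof.
  intros Hmono H. induction J as [|J [d1 [Hd1 H1]]].
  - destruct (H O) as (d & Hd & HQ). exists d. split; [exact Hd|]. intros k Hk.
    now replace k with O by lia.
  - destruct (H (S J)) as (d2 & Hd2 & H2). exists (Rmin d1 d2).
    split; [now apply Rmin_glb_lt|]. intros k Hk.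
    destruct (Nat.eq_dec k (S J)) as [->|].
    + apply (Hmono _ d2); [exact H2|apply Rmin_r].
    + apply (Hmono _ d1); [apply H1; lia|apply Rmin_l].
Qed.

(** The remainders [r k] are nonnegative by convexity and at most [2 * w k * |h|] by the Lipschitz
    bound. The tail is therefore small relative to [|h|], uniformly in [h], and only finitely many
    derivatives have to be controlled. *)
Lemma smooth_series_superdifferential {X : NormedSpace} (c : R) (kappa : nat -> R)
    (th : nat -> X -> R) (D : nat -> X -> X -> R) (u : nat -> X) (x : X) :
  0 < c -> (forall k, smooth_near_norm (kappa k) (th k) (D k)) ->
  (forall y, ex_series (fun k => c * (/ 2) ^ S k * th k (vsub y (u k)))) ->
  exists L, dual_elt L /\ dual_norm_le L c /\
    forall eps, 0 < eps -> exists delta, 0 < delta /\ forall h, vnorm h < delta ->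
      Series (fun k => c * (/ 2) ^ S k * th k (vsub (vadd x h) (u k))) <=
      Series (fun k => c * (/ 2) ^ S k * th k (vsub x (u k))) + L h + eps * vnorm h.
Proof.
  intros Hc Hth Hex.
  set (w := fun k => c * (/ 2) ^ S k).
  assert (Hw : forall k, 0 < w k) by (intros k; unfold w; pose proof (half_pow_pos (S k)); nra).
  set (l := fun k h => w k * D k (vsub x (u k)) h).
  assert (HD : forall k, dual_elt (D k (vsub x (u k))) /\ dual_norm_le (D k (vsub x (u k))) 1)
    by (intros k; apply (Hth k)).
  assert (Hl : forall h k, Rabs (l k h) <= c * vnorm h * (/ 2) ^ S k).
  { intros h k. unfold l. rewrite Rabs_mult, Rabs_pos_eq by (specialize (Hw k); lra).
    pose proof (proj2 (HD k) h) as H. specialize (Hw k).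
    apply (Rmult_le_compat_l (w k)) in H; [|lra]. unfold w in *. lra. }
  assert (El : forall h, ex_series (fun k => l k h)) by (intros h; apply (Series_half_pow_le _ _ (Hl h))).
  set (L := fun h => Series (fun k => l k h)).
  assert (HL : vlinear L).
  { split.
    - intros a b. unfold L. rewrite <- Series_plus by apply El. apply Series_ext. intros k.
      unfold l. rewrite vlinear_add by apply dual_elt_linear, HD. ring.
    - intros t a. unfold L. rewrite <- Series_scal_l. apply Series_ext. intros k.
      unfold l. rewrite vlinear_scal by apply dual_elt_linear, HD. ring. }
  assert (HLn : dual_norm_le L c) by (intros h; apply (Series_half_pow_le _ _ (Hl h))).
  exists L. split; [now apply (dual_elt_intro L c)|]. split; [exact HLn|].
  intros eps He.
  destruct (eventually_small_half_pow (2 * c) (eps / 2) ltac:(lra)) as [N HN].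
  specialize (HN (S N) ltac:(lia)).
  (* The weights sum to [c], so slack [eps / (2 * c)] in each term adds up to at most [eps / 2]. *)
  destruct (eventually_forall_le_radius (fun k d => forall h, vnorm h < d ->
     th k (vadd (vsub x (u k)) h) <= th k (vsub x (u k)) + D k (vsub x (u k)) h
        + eps / (2 * c) * vnorm h) N) as (d & Hd & HdN).
  { intros k d d' H Hd' h Hh. apply H. lra. }
  { intros k. apply (Hth k). apply Rdiv_lt_0_compat; lra. }
  exists d. split; [exact Hd|]. intros h Hh.
  set (t := fun y k => w k * th k (vsub y (u k))).
  set (r := fun k => t (vadd x h) k - t x k - l k h).
  assert (Hsh : forall k, vsub (vadd x h) (u k) = vadd (vsub x (u k)) h) by (intros k; vlin).
  assert (Hr : forall k, 0 <= r k <= 2 * c * vnorm h * (/ 2) ^ S k).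
  { intros k. unfold r, t, l. rewrite Hsh. specialize (Hw k).
    pose proof (proj1 (proj2 (proj2 (Hth k))) (vsub x (u k)) h) as H1.
    pose proof (smooth_near_norm_lipschitz _ _ _ (vsub x (u k)) h (Hth k)) as H2.
    pose proof (proj2 (HD k) h) as H3.
    pose proof (Rle_abs (- D k (vsub x (u k)) h)) as H4. rewrite Rabs_Ropp in H4.
    split; [nra|].
    apply Rle_trans with (w k * (2 * vnorm h)); [nra|unfold w; lra]. }
  assert (Es : Series (t (vadd x h)) - Series (t x) - L h = Series r).
  { unfold r, L. rewrite (Series_minus (fun k => t (vadd x h) k - t x k) (fun k => l k h)).
    - now rewrite Series_minus by apply Hex.
    - apply (ex_series_minus (t (vadd x h)) (t x)); apply Hex.
    - apply El. }
  destruct (Series_le_split r _ N Hr) as [_ Hs].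
  assert (Hsum : sum_f_R0 r N <= eps / 2 * vnorm h).
  { apply Rle_trans with (sum_f_R0 (fun k => (/ 2) ^ S k * (eps / 2 * vnorm h)) N).
    - apply sum_Rle. intros k Hk. specialize (HdN k Hk h Hh). unfold r, t, l. rewrite Hsh.
      specialize (Hw k). apply Rle_trans with (w k * (eps / (2 * c) * vnorm h)); [nra|].
      right. unfold w. field. lra.
    - rewrite <- scal_sum. pose proof (sum_half_pow_le N). pose proof (vnorm_nonneg _ h).
      assert (0 <= eps / 2 * vnorm h) by nra. nra. }
  pose proof (vnorm_nonneg _ h).
  change (Series (t (vadd x h)) <= Series (t x) + L h + eps * vnorm h).
  assert (2 * c * vnorm h * (/ 2) ^ S N <= eps / 2 * vnorm h) by nra.
  lra.
Qed.

Lemma geometric_steps_cauchy {X : NormedSpace} (u : nat -> X) (c : R) :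
  0 <= c -> (forall n, vnorm (vsub (u (S n)) (u n)) <= c * (/ 2) ^ n) ->
  forall eps, eps > 0 -> exists N, forall n m, (n >= N)%nat -> (m >= N)%nat ->
    vnorm (vsub (u n) (u m)) < eps.
Proof.
  intros Hc Hu eps He.
  assert (H : forall k n, vnorm (vsub (u (n + k)%nat) (u n)) <= 2 * c * (/ 2) ^ n - 2 * c * (/ 2) ^ (n + k)).
  { intros k n. induction k as [|k IH].
    - rewrite Nat.add_0_r, vsub_self, vnorm_0. lra.
    - replace (n + S k)%nat with (S (n + k)) by lia.
      pose proof (vnorm_sub_triangle (u (S (n + k))) (u (n + k)%nat) (u n)).
      specialize (Hu (n + k)%nat). simpl. lra. }
  destruct (eventually_small_half_pow (4 * c) eps He) as [N HN].
  assert (HN' : forall n, (n >= N)%nat -> vnorm (vsub (u n) (u N)) < eps / 2).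
  { intros n Hn. specialize (H (n - N)%nat N). replace (N + (n - N))%nat with n in H by lia.
    specialize (HN N (le_n N)). pose proof (half_pow_pos n). nra. }
  exists N. intros n m Hn Hm.
  pose proof (vnorm_sub_triangle (u n) (u N) (u m)) as Ht. rewrite (vnorm_sub_sym (u N)) in Ht.
  pose proof (HN' n Hn). pose proof (HN' m Hm). lra.
Qed.

Definition seq_lim {X : NormedSpace} (u : nat -> X) (x : X) : Prop :=
  forall eps, eps > 0 -> exists N, forall n, (n >= N)%nat -> vnorm (vsub (u n) x) < eps.

(* The points [snd (perturbed_seq n)] and the partial sums [fst (perturbed_seq n)] of
   the perturbation in the Borwein-Preiss construction; [sel P eps] is meant to
   minimise [F + P] up to [eps]. *)
Fixpoint perturbed_seq {X : NormedSpace} (w e : nat -> R) (th : nat -> X -> R)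
    (sel : (X -> R) -> R -> X) (n : nat) : (X -> R) * X :=
  match n with
  | O => (fun _ => 0, sel (fun _ => 0) (e O))
  | S m =>
    let s := perturbed_seq w e th sel m in
    let P := fun y => fst s y + w m * th m (vsub y (snd s)) in
    (P, sel P (e (S m)))
  end.

(** Each perturbation is centred at the current approximate minimiser [u n] and keeps the next one
    close; the centres converge to an exact minimiser of [F + P] over [A]. As [F] is real-valued and
    meaningful only on [A], closedness of the domain and lower semicontinuity are combined into one
    condition on sublevel sets. *)
Lemma smooth_variational_principle {X : NormedSpace} (A : X -> Prop) (F : X -> R) (a : X) (m mu : R) :
  complete X -> separable_subspace (fun _ : X => True) -> separable_dual_of (fun _ : X => True) ->
  A a -> (forall x, A x -> vnorm (vsub x a) <= 1) -> (forall x, A x -> m <= F x) ->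
  (forall u x c, (forall n, A (u n)) -> seq_lim u x -> (forall n, F (u n) <= c) -> A x /\ F x <= c) ->
  0 < mu ->
  exists (x : X) (P L : X -> R),
    A x /\ (forall y, 0 <= P y) /\ P a <= mu /\
    (forall y, A y -> F x + P x <= F y + P y) /\
    dual_elt L /\ dual_norm_le L mu /\
    forall eps, 0 < eps -> exists delta, 0 < delta /\ forall h, vnorm h < delta ->
      P (vadd x h) <= P x + L h + eps * vnorm h.
Proof.
  intros Hcomp Hsep Hsd Aa HA1 HAm Hclosed Hmu.
  (* Points of [A] are within 1 of [a] and [kap k <= 1], so [th k (a - u k) <= 2] and
     [P a <= 2 * c]. *)
  set (c := mu / 3). assert (Hc : 0 < c) by (unfold c; lra).
  set (w := fun k => c * (/ 2) ^ S k).
  assert (Hw : forall k, 0 < w k) by (intros k; unfold w; pose proof (half_pow_pos (S k)); nra).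
  set (kap := fun k => (/ 2) ^ k).
  assert (Hkap : forall k, 0 < kap k <= 1).
  { intros k. unfold kap. split; [apply half_pow_pos|].
    induction k; simpl; [lra|]. pose proof (half_pow_pos k). lra. }
  assert (Hsm : forall k, exists tD : (X -> R) * (X -> X -> R), smooth_near_norm (kap k) (fst tD) (snd tD)).
  { intros k. destruct (smooth_norm_approx (kap k) Hsep Hsd (proj1 (Hkap k))) as (t & D & H).
    now exists (t, D). }
  destruct (functional_choice _ Hsm) as [tD HtD].
  set (th := fun k => fst (tD k)). set (D := fun k => snd (tD k)).
  assert (Hth : forall k, smooth_near_norm (kap k) (th k) (D k)) by exact HtD.
  clearbody th D. clear tD HtD Hsm.
  (* Tolerances relative to [w k] and the values of [th k] at zero are both at most [(/ 2) ^ k];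
     this gives the steps [3 * (/ 2) ^ n] of [Hstep]. *)
  set (e := fun k => w k * (/ 2) ^ k).
  assert (He : forall k, 0 < e k) by (intros k; unfold e; pose proof (half_pow_pos k); specialize (Hw k); nra).
  (* The premises sit under the existential so that choice yields a total selector, with default
     [a]. *)
  assert (Hsel : forall Pe : (X -> R) * R, exists x, (forall y, 0 <= fst Pe y) -> 0 < snd Pe ->
      A x /\ forall y, A y -> F x + fst Pe x <= F y + fst Pe y + snd Pe).
  { intros [P eps]. simpl.
    destruct (classic ((forall y, 0 <= P y) /\ 0 < eps)) as [[HP Heps]|Hn].
    - set (E := fun r => exists x, A x /\ r = F x + P x).
      assert (Hlow : forall r, E r -> m <= r).
      { intros r (x & Hx & ->). specialize (HP x). specialize (HAm x Hx). lra. }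
      destruct (rinf_approx E m eps) as (r & (x & Hx & ->) & Hr); [now exists (F a + P a), a|exact Hlow|lra|].
      exists x. intros _ _. split; [exact Hx|]. intros y Hy.
      assert (rinf E <= F y + P y) by (apply (rinf_lb _ _ _ Hlow); now exists y). lra.
    - exists a. intros H1 H2. tauto. }
  destruct (functional_choice _ Hsel) as [sel0 Hsel0]. clear Hsel.
  set (sel := fun P eps => sel0 (P, eps)).
  assert (Hsel : forall P eps, (forall y, 0 <= P y) -> 0 < eps -> A (sel P eps) /\
      forall y, A y -> F (sel P eps) + P (sel P eps) <= F y + P y + eps)
    by (intros P eps; exact (Hsel0 (P, eps))).
  clearbody sel. clear sel0 Hsel0.
  set (Pn := fun n => fst (perturbed_seq w e th sel n)).
  set (u := fun n => snd (perturbed_seq w e th sel n)).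
  assert (HPS : forall n y, Pn (S n) y = Pn n y + w n * th n (vsub y (u n))) by reflexivity.
  assert (Hth0 : forall k z, 0 <= th k z).
  { intros k z. pose proof (proj1 (Hth k) z). pose proof (vnorm_nonneg _ z). lra. }
  assert (HP0 : forall n y, 0 <= Pn n y).
  { intros n y. induction n; [simpl; unfold Pn; simpl; lra|].
    rewrite HPS. specialize (Hth0 n (vsub y (u n))). specialize (Hw n). nra. }
  assert (Hu : forall n, A (u n) /\ forall y, A y -> F (u n) + Pn n (u n) <= F y + Pn n y + e n).
  { intros [|n].
    - apply (Hsel (fun _ => 0) (e O)); [intros; lra|apply He].
    - apply (Hsel (Pn (S n)) (e (S n))); [apply HP0|apply He]. }
  assert (Hstep : forall n, vnorm (vsub (u (S n)) (u n)) <= 3 * (/ 2) ^ n).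
  { intros n. destruct (Hu n) as [An Hn]. destruct (Hu (S n)) as [An' Hn'].
    specialize (Hn _ An'). specialize (Hn' _ An). rewrite !HPS in Hn'.
    rewrite vsub_self in Hn'.
    pose proof (proj1 (Hth n) vzero) as [_ H0]. rewrite vnorm_0 in H0.
    pose proof (proj1 (Hth n) (vsub (u (S n)) (u n))) as [H1 _].
    assert (Hee : e (S n) <= e n).
    { unfold e, w. simpl. pose proof (half_pow_pos n).
      assert (0 < c * ((/ 2) ^ n * (/ 2) ^ n)) by (apply Rmult_lt_0_compat; nra). lra. }
    pose proof (Hw n) as Hwn.
    apply (Rmult_le_reg_l (w n)); [exact Hwn|].
    apply (Rmult_le_compat_l (w n)) in H1; [|lra].
    apply (Rmult_le_compat_l (w n)) in H0; [|lra]. unfold kap in H0. unfold e in *. lra. }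
  destruct (Hcomp u (geometric_steps_cauchy u 3 ltac:(lra) Hstep)) as [x Hx].
  set (t := fun y k => w k * th k (vsub y (u k))).
  assert (Ht : forall y k, 0 <= t y k <= c * (vnorm (vsub y a) + 2) * (/ 2) ^ S k).
  { intros y k. unfold t. specialize (Hw k). specialize (Hth0 k (vsub y (u k))).
    split; [nra|].
    pose proof (proj1 (Hth k) (vsub y (u k))) as [_ H].
    pose proof (vnorm_sub_triangle y a (u k)) as H1. rewrite (vnorm_sub_sym a) in H1.
    pose proof (HA1 _ (proj1 (Hu k))). specialize (Hkap k).
    apply Rle_trans with (w k * (vnorm (vsub y a) + 2)); [nra|unfold w; lra]. }
  assert (Et : forall y, ex_series (t y)) by (intros y; apply (Series_le_split _ _ O (Ht y))).
  set (P := fun y => Series (t y)).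
  assert (HPn : forall n y, Pn (S n) y = sum_f_R0 (t y) n).
  { intros n y. induction n as [|n IH].
    - rewrite HPS. unfold Pn, t, u. simpl. lra.
    - rewrite HPS, IH. reflexivity. }
  assert (HPle : forall n y, Pn (S n) y <= P y).
  { intros n y. rewrite HPn. apply sum_le_Series; [apply Ht|apply Et]. }
  assert (HPtail : forall n y, P y <= Pn (S n) y + c * (vnorm (vsub y a) + 2) * (/ 2) ^ S n).
  { intros n y. rewrite HPn. apply (Series_le_split _ _ n (Ht y)). }
  assert (HPlip : forall y z, P y <= P z + c * vnorm (vsub y z)).
  { intros y z. unfold P.
    replace (c * vnorm (vsub y z)) with (Series (fun k => w k * vnorm (vsub y z))).
    - rewrite <- Series_plus.
      + apply Series_le.
        * intros k. split; [apply Ht|]. unfold t.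
          pose proof (smooth_near_norm_lipschitz _ _ _ (vsub z (u k)) (vsub y z) (Hth k)) as H.
          replace (vadd (vsub z (u k)) (vsub y z)) with (vsub y (u k)) in H by vlin.
          specialize (Hw k). nra.
        * apply (ex_series_plus (t z)); [apply Et|].
          exact (ex_series_scal_r (vnorm (vsub y z)) w (ex_series_scal_half_pow c)).
      + apply Et.
      + exact (ex_series_scal_r (vnorm (vsub y z)) w (ex_series_scal_half_pow c)).
    - rewrite Series_scal_r. unfold w. rewrite Series_scal_l, (is_series_unique _ _ is_series_half_pow). ring. }
  (* Replacing partial sums by [P] costs a tail, moving from [u (S k)] to [x] costs a Lipschitz
     term, and the sublevel condition passes to the limit [x]. *)
  assert (Hmin : forall y, A y -> forall d, 0 < d -> A x /\ F x <= F y + P y - P x + d).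
  { intros y Hy d Hd.
    destruct (eventually_small_half_pow (c * 3) (d / 3) ltac:(lra)) as [N1 HN1].
    destruct (eventually_small_half_pow c (d / 3) ltac:(lra)) as [N2 HN2].
    destruct (Hx (d / (3 * c))) as [N3 HN3]; [apply Rlt_gt, Rdiv_lt_0_compat; lra|].
    set (N := Nat.max N1 (Nat.max N2 N3)).
    apply (Hclosed (fun n => u (S (N + n)))).
    - intros n. apply Hu.
    - intros eps Heps. destruct (Hx eps Heps) as [M HM]. exists M. intros n Hn. apply HM. lia.
    - intros n. set (k := (N + n)%nat).
      destruct (Hu (S k)) as [Ak Hk]. specialize (Hk y Hy).
      pose proof (HPle k y) as H1. pose proof (HPtail k (u (S k))) as H2.
      pose proof (HA1 _ Ak) as H3. pose proof (HPlip x (u (S k))) as H4.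
      rewrite vnorm_sub_sym in H4.
      specialize (HN1 (S k) ltac:(lia)). specialize (HN2 (S k) ltac:(lia)).
      specialize (HN3 (S k) ltac:(lia)).
      apply (Rmult_lt_compat_l c) in HN3; [|lra].
      replace (c * (d / (3 * c))) with (d / 3) in HN3 by (field; lra).
      assert (He2 : e (S k) <= c * (/ 2) ^ S k).
      { unfold e, w. pose proof (half_pow_pos (S k)). specialize (Hkap (S (S k))). unfold kap in Hkap.
        assert (0 <= c * (/ 2) ^ S k) by nra. nra. }
      assert (H5 : c * (vnorm (vsub (u (S k)) a) + 2) * (/ 2) ^ S k <= c * 3 * (/ 2) ^ S k).
      { apply Rmult_le_compat_r; [left; apply half_pow_pos|]. nra. }
      lra. }
  destruct (smooth_series_superdifferential c kap th D u x Hc Hth Et) as (L & HL & HLn & HLs).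
  exists x, P, L. split; [apply (Hmin a Aa 1); lra|].
  split; [intros y; apply Series_ge0; [apply Ht|apply Et]|].
  split.
  { destruct (Series_half_pow_le (t a) (c * 2)) as [_ H].
    - intros k. specialize (Ht a k). rewrite Rabs_pos_eq by apply Ht.
      rewrite vsub_self, vnorm_0 in Ht. lra.
    - pose proof (Rle_abs (Series (t a))). unfold P, c in *. lra. }
  split.
  { intros y Hy. apply Rnot_lt_le. intros H.
    destruct (Hmin y Hy ((F x + P x - (F y + P y)) / 2)); lra. }
  split; [exact HL|]. split; [|exact HLs].
  intros h. specialize (HLn h). pose proof (vnorm_nonneg _ h). unfold c in HLn. nra.
Qed.

(** * The mean value theorem when the dual is separable *)

Definition fin_part (r : ereal) : R := match r with Fin s => s | PInf => 0 end.

Lemma fin_partE (r : ereal) : r <> PInf -> r = Fin (fin_part r).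
Proof. destruct r; simpl; congruence. Qed.

(** The squared negative part has derivative [-2 * Rmax (- s) 0], with a quadratic upper
    remainder. *)
Lemma neg_part_sq_expand (s l : R) :
  Rmax (- (s + l)) 0 ^ 2 <= Rmax (- s) 0 ^ 2 - 2 * Rmax (- s) 0 * l + l ^ 2.
Proof.
  unfold Rmax. destruct (Rle_dec (- (s + l)) 0), (Rle_dec (- s) 0); nra.
Qed.

Lemma neg_part_sq_lipschitz (s s' b : R) :
  - b <= s -> - b <= s' -> 0 <= b -> Rmax (- s') 0 ^ 2 <= Rmax (- s) 0 ^ 2 + 2 * b * Rabs (s' - s).
Proof.
  intros H1 H2 Hb. pose proof (Rle_abs (s' - s)). pose proof (Rle_abs (- (s' - s))) as H3.
  rewrite Rabs_Ropp in H3. pose proof (Rabs_pos (s' - s)).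
  unfold Rmax. destruct (Rle_dec (- s') 0), (Rle_dec (- s) 0); try nra.
Qed.

(* The unwanted directions are penalised smoothly: motion off the line [a + R e] by
   the smoothed norm of the component along the kernel of a functional [l] with
   [l e = 1], and motion backwards along it by the square of the negative part, whose
   gradient only helps. *)
Lemma local_mean_value {X : NormedSpace} (f : X -> ereal) (a e : X) (fa sigma t1 T eps : R) :
  complete X -> separable_subspace (fun _ : X => True) -> separable_dual_of (fun _ : X => True) ->
  lsc f -> f a = Fin fa -> 0 < sigma -> 0 < t1 ->
  (forall t, 0 < t <= t1 -> elt (Fin (fa + sigma * t)) (f (vadd a (vscal t e)))) ->
  0 < T -> 0 < eps ->
  exists c p, vnorm (vsub c a) < eps /\ frechet_subdiff f c p /\
    0 < p (vsub (vadd a (vscal T e)) c).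
Proof.
  intros Hcomp Hsep Hsd Hlsc Hfa Hsigma Ht1 Hinc HT Heps.
  set (E := vnorm e).
  assert (HE : 0 < E).
  { destruct (vnorm_nonneg _ e) as [H|H]; [exact H|]. exfalso.
    symmetry in H. apply vnorm_eq0 in H. subst e.
    specialize (Hinc t1 ltac:(lra)).
    replace (vadd a (vscal t1 vzero)) with a in Hinc by vlin.
    rewrite Hfa in Hinc. simpl in Hinc. nra. }
  destruct (norming_functional e) as (n & Hn & Hn1 & Hne). fold E in Hne.
  pose proof (dual_elt_linear n Hn) as Hnl.
  set (l := fun x => / E * n x).
  assert (Hll : vlinear l) by (split; intros; unfold l; plin n Hnl; ring).
  assert (Hle : l e = 1) by (unfold l; rewrite Hne; field; lra).
  assert (Hlb : forall h, Rabs (l h) * E <= vnorm h).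
  { intros h. unfold l. rewrite Rabs_mult, Rabs_pos_eq by (left; now apply Rinv_0_lt_compat).
    replace (/ E * Rabs (n h) * E) with (Rabs (n h)) by (field; lra).
    specialize (Hn1 h). lra. }
  assert (Hld : dual_elt l).
  { apply (dual_elt_intro l (/ E)); [exact Hll|]. intros h. specialize (Hlb h).
    apply (Rmult_le_reg_r E); [exact HE|].
    replace (/ E * vnorm h * E) with (vnorm h) by (field; lra). exact Hlb. }
  assert (Hlb' : forall h, Rabs (l h) <= vnorm h / E).
  { intros h. apply Rle_div_r; [exact HE|apply Hlb]. }
  set (proj := fun h => vsub h (vscal (l h) e)).
  assert (Hproj : forall h, vnorm (proj h) <= 2 * vnorm h).
  { intros h. unfold proj.
    pose proof (vnorm_le_add (vsub h (vscal (l h) e)) h (vscal (- l h) e) ltac:(vlin)) as H.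
    rewrite vnorm_scal, Rabs_Ropp in H. specialize (Hlb h). fold E in H. lra. }
  (* Coordinates around the line: [x = a + s x e + w x] with [l (w x) = 0]. *)
  set (s := fun x => l (vsub x a)). set (w := fun x => proj (vsub x a)).
  assert (Hs : forall x y, s x = s y + l (vsub x y)) by (intros x y; unfold s; plin l Hll; ring).
  assert (Hw : forall x y, w x = vadd (w y) (proj (vsub x y))).
  { intros x y. unfold w, proj. plin l Hll. vlin. }
  (* On this ball [f > fa - 1]; the box [C] below fits inside it and inside the [eps]-ball around
     [a]. *)
  destruct (Hlsc a (fa - 1)) as (R0 & HR0 & HfR0); [rewrite Hfa; simpl; lra|].
  set (rho0 := Rmin R0 (Rmin eps 1) / 2).
  assert (Hrho0 : 0 < rho0 /\ rho0 < R0 /\ rho0 < eps /\ rho0 < 1).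
  { unfold rho0. pose proof (Rmin_l R0 (Rmin eps 1)). pose proof (Rmin_r R0 (Rmin eps 1)).
    pose proof (Rmin_l eps 1). pose proof (Rmin_r eps 1).
    assert (0 < Rmin R0 (Rmin eps 1)) by (repeat apply Rmin_glb_lt; lra). lra. }
  set (t0 := Rmin (Rmin t1 (T / 2)) (rho0 / (2 * E))).
  assert (Ht0 : 0 < t0 /\ t0 <= t1 /\ t0 <= T / 2 /\ t0 * E <= rho0 / 2).
  { unfold t0. pose proof (Rmin_l (Rmin t1 (T / 2)) (rho0 / (2 * E))).
    pose proof (Rmin_r (Rmin t1 (T / 2)) (rho0 / (2 * E))).
    pose proof (Rmin_l t1 (T / 2)). pose proof (Rmin_r t1 (T / 2)).
    assert (0 < rho0 / (2 * E)) by (apply Rdiv_lt_0_compat; lra).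
    repeat split; try lra; [repeat apply Rmin_glb_lt; lra|].
    apply Rle_trans with (rho0 / (2 * E) * E); [apply Rmult_le_compat_r; lra|].
    right. field. lra. }
  destruct Ht0 as (Ht0 & Ht01 & Ht0T & Ht0E).
  (* Near [a + t0 e] the function stays above [fa + sigma * t0]; [rho < rho1] will keep the
     minimiser off that face of the box. *)
  destruct (Hlsc _ _ (Hinc t0 (conj Ht0 Ht01))) as (rho1 & Hrho1 & Hfrho1).
  set (rho := Rmin rho0 rho1 / 2).
  assert (Hrho : 0 < rho /\ rho <= rho0 / 2 /\ rho < rho1).
  { unfold rho. pose proof (Rmin_l rho0 rho1). pose proof (Rmin_r rho0 rho1).
    assert (0 < Rmin rho0 rho1) by (apply Rmin_glb_lt; lra). lra. }
  (* The linear term of [g] uses half of the increase [sigma * t0]; [beta] is what remains on the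
     face [s = t0]. *)
  set (beta := sigma * t0 / 2). assert (Hbeta : 0 < beta) by (unfold beta; nra).
  (* Against the bound [f > fa - 1], these penalties lift the face [s = - t0] and the side
     [|w| = rho] to the level [fa + beta]. *)
  set (K := (1 + 2 * beta) / rho + (1 + beta) / t0 ^ 2).
  assert (Ht02 : 0 < t0 ^ 2) by (apply pow_lt; lra).
  assert (HK : 1 + 2 * beta <= K * rho /\ 1 + beta <= K * t0 ^ 2 /\ 0 < K).
  { assert (H1 : 0 < (1 + 2 * beta) / rho) by (apply Rdiv_lt_0_compat; lra).
    assert (H2 : 0 < (1 + beta) / t0 ^ 2) by (apply Rdiv_lt_0_compat; lra).
    assert (H3 : (1 + 2 * beta) / rho * rho = 1 + 2 * beta) by (field; lra).
    assert (H4 : (1 + beta) / t0 ^ 2 * t0 ^ 2 = 1 + beta) by (field; lra).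
    unfold K. repeat split; nra. }
  destruct HK as (HKrho & HKt0 & HK).
  set (kap := Rmin (beta / 4) (T * sigma / 16) / K).
  assert (HTs : 0 < T * sigma) by nra.
  assert (Hkap : 0 < kap /\ K * kap <= beta / 4 /\ K * kap <= T * sigma / 16).
  { assert (H : K * kap = Rmin (beta / 4) (T * sigma / 16)) by (unfold kap; field; lra).
    rewrite H. split; [|split; [apply Rmin_l|apply Rmin_r]].
    apply Rdiv_lt_0_compat; [apply Rmin_glb_lt; lra|exact HK]. }
  destruct Hkap as (Hkap & HKb & HKT).
  (* The three bounds serve [P a], the slope [L e], and the term [L (w x)] of the final estimate. *)
  set (mu := Rmin (beta / 4) (Rmin (sigma / (4 * E)) (T * sigma / 32))).
  assert (Hmu : 0 < mu /\ mu <= beta / 4 /\ mu * E <= sigma / 4 /\ mu <= T * sigma / 32).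
  { unfold mu. pose proof (Rmin_l (beta / 4) (Rmin (sigma / (4 * E)) (T * sigma / 32))).
    pose proof (Rmin_r (beta / 4) (Rmin (sigma / (4 * E)) (T * sigma / 32))).
    pose proof (Rmin_l (sigma / (4 * E)) (T * sigma / 32)).
    pose proof (Rmin_r (sigma / (4 * E)) (T * sigma / 32)).
    assert (0 < sigma / (4 * E)) by (apply Rdiv_lt_0_compat; lra).
    repeat split; try lra; [repeat apply Rmin_glb_lt; lra|].
    apply Rle_trans with (sigma / (4 * E) * E); [apply Rmult_le_compat_r; lra|].
    right. field. lra. }
  destruct Hmu as (Hmu & Hmub & HmuE & HmuT).
  destruct (smooth_norm_approx kap Hsep Hsd Hkap) as (th & D & Hth).
  pose proof (proj1 Hth) as Hthb.
  assert (Hth0 : forall z, 0 <= th z).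
  { intros z. pose proof (Hthb z). pose proof (vnorm_nonneg _ z). lra. }
  set (C := fun x => - t0 <= s x <= t0 /\ vnorm (w x) <= rho).
  set (g := fun x => - (sigma / 2) * s x + K * Rmax (- s x) 0 ^ 2 + K * th (w x)).
  set (A := fun x => f x <> PInf /\ C x).
  set (F := fun x => fin_part (f x) + g x).
  assert (HCa : forall x, C x -> vnorm (vsub x a) <= rho0).
  { intros x [Hsx Hwx].
    pose proof (vnorm_le_add (vsub x a) (vscal (s x) e) (w x) ltac:(unfold w, proj, s; vlin)) as H.
    rewrite vnorm_scal in H. fold E in H.
    assert (Rabs (s x) <= t0) by (apply Rabs_le; lra). nra. }
  assert (Hflow : forall x, A x -> fa - 1 < fin_part (f x)).
  { intros x [Hfx HCx]. pose proof (HCa x HCx) as H.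
    specialize (HfR0 x ltac:(lra)). rewrite (fin_partE _ Hfx) in HfR0. exact HfR0. }
  assert (Hpen : forall x, 0 <= K * Rmax (- s x) 0 ^ 2).
  { intros x. pose proof (pow2_ge_0 (Rmax (- s x) 0)). nra. }
  set (M := sigma / 2 / E + K * (2 * t0) / E + K * 2).
  assert (HgL : forall x y, C x -> C y -> g y <= g x + M * vnorm (vsub y x)).
  { intros x y [Hsx _] [Hsy _]. unfold g.
    pose proof (neg_part_sq_lipschitz (s x) (s y) t0 ltac:(lra) ltac:(lra) ltac:(lra)) as H1.
    pose proof (smooth_near_norm_lipschitz _ _ _ (w x) (proj (vsub y x)) Hth) as H2.
    rewrite <- Hw in H2. pose proof (Hproj (vsub y x)) as H3.
    pose proof (Hlb' (vsub y x)) as H4. pose proof (Hs y x) as H5.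
    replace (s y - s x) with (l (vsub y x)) in H1 by lra.
    pose proof (Rle_abs (- l (vsub y x))) as H6. rewrite Rabs_Ropp in H6.
    set (v := vnorm (vsub y x)) in *.
    apply (Rmult_le_compat_l K) in H1; [|lra]. apply (Rmult_le_compat_l K) in H2; [|lra].
    apply (Rmult_le_compat_l K) in H3; [|lra].
    assert (H7 : K * (2 * t0 * Rabs (l (vsub y x))) <= K * (2 * t0 * (v / E))).
    { apply Rmult_le_compat_l; [lra|]. apply Rmult_le_compat_l; [lra|exact H4]. }
    assert (H8 : M * v = sigma / 2 * (v / E) + K * (2 * t0 * (v / E)) + K * (2 * v))
      by (unfold M; field; lra).
    rewrite H8.
    assert (H9 : sigma / 2 * (s x - s y) <= sigma / 2 * (v / E)) by (apply Rmult_le_compat_l; lra).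
    lra. }
  assert (HM : 0 < M).
  { unfold M. assert (0 < sigma / 2 / E) by (apply Rdiv_lt_0_compat; lra).
    assert (0 < K * (2 * t0) / E) by (apply Rdiv_lt_0_compat; nra). lra. }
  assert (Hsa : s a = 0) by (unfold s; rewrite vsub_self; now apply vlinear_0).
  assert (Hwa : w a = vzero).
  { unfold w, proj. change (l (vsub a a)) with (s a). rewrite Hsa. vlin. }
  assert (Aa : A a).
  { split; [rewrite Hfa; discriminate|]. split; [rewrite Hsa; lra|]. rewrite Hwa, vnorm_0. lra. }
  assert (HFa : F a <= fa + beta / 4).
  { unfold F, g. rewrite Hfa, Hsa, Hwa. simpl fin_part.
    pose proof (Hthb vzero) as [_ H]. rewrite vnorm_0 in H.
    replace (Rmax (- 0) 0) with 0 by (rewrite Ropp_0; unfold Rmax; destruct (Rle_dec 0 0); lra).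
    apply (Rmult_le_compat_l K) in H; [|lra]. lra. }
  destruct (smooth_variational_principle A F a (fa - 1 - sigma / 2 * t0) mu Hcomp Hsep Hsd Aa)
    as (x & P & L & Ax & HP0 & HPa & Hmin & HL & HLn & HLs).
  { intros x [_ HCx]. pose proof (HCa x HCx). lra. }
  { intros x Ax. pose proof (Hflow x Ax). destruct Ax as [_ [Hsx _]].
    unfold F, g. specialize (Hpen x). specialize (Hth0 (w x)). nra. }
  (* [C] is closed, and since [g] is Lipschitz on it, bounds on [F (u n)] become bounds on [f (u n)]
     that lower semicontinuity carries to [x]. *)
  { intros u x c HA Hux HF.
    assert (HCx : C x).
    { assert (Hlim : forall d, 0 < d -> (- t0 <= s x + d /\ s x <= t0 + d) /\ vnorm (w x) <= rho + d).
      { intros d Hd. destruct (Hux (Rmin (d * E) (d / 2))) as [N HN].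
        { apply Rmin_glb_lt; [nra|lra]. }
        specialize (HN N (le_n N)).
        pose proof (Rmin_l (d * E) (d / 2)). pose proof (Rmin_r (d * E) (d / 2)).
        destruct (HA N) as [_ [Hsu Hwu]].
        pose proof (Hs (u N) x) as H1. pose proof (Hlb (vsub (u N) x)) as H2.
        assert (H3 : Rabs (l (vsub (u N) x)) <= d) by (apply (Rmult_le_reg_r E); lra).
        pose proof (Rle_abs (l (vsub (u N) x))). pose proof (Rle_abs (- l (vsub (u N) x))) as H6.
        rewrite Rabs_Ropp in H6.
        pose proof (Hproj (vsub x (u N))) as H5. rewrite (vnorm_sub_sym x) in H5.
        pose proof (vnorm_le_add _ _ _ (Hw x (u N))). lra. }
      split; [split|]; apply Rnot_lt_le; intros H.
      - destruct (Hlim ((- t0 - s x) / 2)); lra.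
      - destruct (Hlim ((s x - t0) / 2)); lra.
      - destruct (Hlim ((vnorm (w x) - rho) / 2)); lra. }
    assert (Hnot : forall t, c - g x < t -> ~ elt (Fin t) (f x)).
    { intros t Ht Hft. destruct (Hlsc x t Hft) as (d & Hd & Hfd).
      set (d' := (t - (c - g x)) / M). assert (Hd' : 0 < d') by (apply Rdiv_lt_0_compat; lra).
      destruct (Hux (Rmin d d')) as [N HN]; [apply Rmin_glb_lt; lra|].
      specialize (HN N (le_n N)). pose proof (Rmin_l d d'). pose proof (Rmin_r d d').
      specialize (Hfd (u N) ltac:(lra)). destruct (HA N) as [HfN HCN].
      rewrite (fin_partE _ HfN) in Hfd. simpl in Hfd.
      pose proof (HgL _ _ HCN HCx) as HgN. rewrite vnorm_sub_sym in HgN.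
      specialize (HF N). unfold F in HF.
      assert (M * vnorm (vsub (u N) x) <= M * d') by (apply Rmult_le_compat_l; lra).
      assert (M * d' = t - (c - g x)) by (unfold d'; field; lra). lra. }
    unfold F. destruct (f x) as [r|] eqn:Efx.
    - simpl fin_part. split; [split; [congruence|exact HCx]|].
      apply Rnot_lt_le. intros H. apply (Hnot ((r + (c - g x)) / 2)); simpl; lra.
    - exfalso. apply (Hnot (c - g x + 1)); simpl; [lra|exact I]. }
  { exact Hmu. }
  pose proof (Hmin a Aa) as Hxa. pose proof (HP0 x) as HPx.
  assert (HFx : F x < fa + beta) by lra.
  pose proof (Hflow x Ax) as Hfx1. destruct Ax as [Hfx [Hsx Hwx]].
  (* Each face forces a value of at least [fa + beta]. At an interior point, [Hmin] compares with a
     full neighbourhood. *)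
  assert (Hint : - t0 < s x /\ s x < t0 /\ vnorm (w x) < rho).
  { unfold F, g in HFx. pose proof (Hpen x) as H1. pose proof (Hth0 (w x)) as H2.
    assert (H3 : 0 <= K * th (w x)) by nra.
    repeat split; apply Rnot_le_lt; intros H.
    - replace (s x) with (- t0) in HFx by lra.
      replace (Rmax (- - t0) 0) with t0 in HFx by (rewrite Ropp_involutive, Rmax_left; lra).
      unfold beta in *. nra.
    - assert (Est : s x = t0) by lra. rewrite Est in HFx, H1.
      specialize (Hfrho1 x).
      assert (Hd : vsub x (vadd a (vscal t0 e)) = w x).
      { unfold w, proj. change (l (vsub x a)) with (s x). rewrite Est. vlin. }
      rewrite Hd, (fin_partE _ Hfx) in Hfrho1. specialize (Hfrho1 ltac:(lra)). simpl in Hfrho1.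
      unfold beta in *. lra.
    - pose proof (Hthb (w x)) as [Hthx _].
      assert (K * rho <= K * th (w x)) by (apply Rmult_le_compat_l; lra).
      unfold beta in *. nra. }
  destruct Hint as (Hs1 & Hs2 & Hw1).
  set (sm := Rmax (- s x) 0). assert (Hsm : 0 <= sm) by apply Rmax_r.
  set (q := fun h => D (w x) (proj h)).
  destruct (proj1 (proj2 Hth) (w x)) as [HDx HDx1].
  pose proof (dual_elt_linear _ HDx) as HDl.
  assert (Hq : dual_elt q).
  { apply (dual_elt_intro q 2).
    - split; intros; unfold q, proj; plin l Hll; plin (D (w x)) HDl; ring.
    - intros h. unfold q. eapply Rle_trans; [apply HDx1|]. rewrite Rmult_1_l. apply Hproj. }
  set (c1 := sigma / 2 + 2 * K * sm).
  (* The derivative of [- g] at [x] minus the upper derivative [L] of [P]; the exact minimum of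
     [f + g + P] makes it a subgradient of [f]. *)
  set (p := fun h => 1 * (c1 * l h + - K * q h) + -1 * L h).
  assert (Hp : dual_elt p) by (apply (dual_elt_comb _ L); [apply (dual_elt_comb l q); assumption|exact HL]).
  exists x, p. split; [pose proof (HCa x (conj Hsx Hwx)); lra|]. split.
  - split; [exact Hp|]. exists (fin_part (f x)). split; [now apply fin_partE|].
    intros d Hd.
    destruct (proj2 (proj2 (proj2 Hth)) (w x) (d / (8 * K))) as (d1 & Hd1 & Hth1);
      [apply Rdiv_lt_0_compat; lra|].
    destruct (HLs (d / 4) ltac:(lra)) as (d2 & Hd2 & HL2).
    set (m := Rmin (t0 - s x) (t0 + s x) * E).
    assert (Hm : 0 < m) by (apply Rmult_lt_0_compat; [apply Rmin_glb_lt; lra|exact HE]).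
    set (d3 := d * E ^ 2 / (4 * K)).
    assert (HE2 : 0 < E ^ 2) by (apply pow_lt; lra).
    assert (Hd3 : 0 < d3) by (apply Rdiv_lt_0_compat; [apply Rmult_lt_0_compat|]; lra).
    set (delta := Rmin (d1 / 2) (Rmin d2 (Rmin m (Rmin ((rho - vnorm (w x)) / 2) d3)))).
    exists delta. split; [repeat apply Rmin_glb_lt; lra|].
    intros y [_ Hy].
    assert (Hyd : vnorm (vsub y x) < d1 / 2 /\ vnorm (vsub y x) < d2 /\ vnorm (vsub y x) < m /\
        vnorm (vsub y x) < (rho - vnorm (w x)) / 2 /\ vnorm (vsub y x) < d3).
    { unfold delta in Hy. repeat split; eapply Rlt_le_trans; try exact Hy.
      - apply Rmin_l.
      - eapply Rle_trans; [apply Rmin_r|apply Rmin_l].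
      - do 2 (eapply Rle_trans; [apply Rmin_r|]). apply Rmin_l.
      - do 3 (eapply Rle_trans; [apply Rmin_r|]). apply Rmin_l.
      - do 4 (eapply Rle_trans; [apply Rmin_r|]). apply Rle_refl. }
    destruct Hyd as (Hy1 & Hy2 & Hy3 & Hy4 & Hy5).
    set (h := vsub y x) in *. pose proof (vnorm_nonneg _ h) as Hh0.
    pose proof (Hproj h) as Hph. pose proof (Hlb h) as Hlh.
    assert (Hsy : s y = s x + l h) by apply Hs.
    assert (Hwy : w y = vadd (w x) (proj h)) by apply Hw.
    destruct (f y) as [fy|] eqn:Efy; [|exact I]. simpl.
    assert (Ay : A y).
    { split; [congruence|]. split.
      - assert (Hlm : Rabs (l h) < Rmin (t0 - s x) (t0 + s x)) by (apply (Rmult_lt_reg_r E); unfold m in Hy3; lra).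
        pose proof (Rmin_l (t0 - s x) (t0 + s x)). pose proof (Rmin_r (t0 - s x) (t0 + s x)).
        apply Rabs_def2 in Hlm. lra.
      - pose proof (vnorm_le_add _ _ _ Hwy). lra. }
    pose proof (Hmin y Ay) as H. unfold F, g in H. rewrite Efy in H. simpl fin_part in H.
    rewrite Hsy, Hwy in H.
    pose proof (neg_part_sq_expand (s x) (l h)) as H1. fold sm in H1.
    specialize (Hth1 (proj h) ltac:(lra)). specialize (HL2 h Hy2).
    replace (vadd x h) with y in HL2 by (unfold h; vlin).
    fold (q h) in Hth1.
    assert (H2 : l h ^ 2 * E ^ 2 <= d3 * vnorm h).
    { rewrite <- (pow2_abs (l h)), <- Rpow_mult_distr.
      apply Rle_trans with (vnorm h ^ 2);
        [|simpl; rewrite Rmult_1_r; apply Rmult_le_compat_r; lra].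
      apply pow_incr. split; [|exact Hlh]. apply Rmult_le_pos; [apply Rabs_pos|lra]. }
    assert (H3 : K * l h ^ 2 <= d / 4 * vnorm h).
    { apply (Rmult_le_reg_r (E ^ 2)); [exact HE2|].
      apply Rle_trans with (K * (d3 * vnorm h));
        [rewrite Rmult_assoc; apply Rmult_le_compat_l; lra|]. right. unfold d3. field. lra. }
    assert (H4 : K * (d / (8 * K) * vnorm (proj h)) <= d / 4 * vnorm h).
    { replace (K * (d / (8 * K) * vnorm (proj h))) with (d / 8 * vnorm (proj h)) by (field; lra).
      pose proof (Rmult_le_compat_l (d / 8) _ _ ltac:(lra) Hph). lra. }
    apply (Rmult_le_compat_l K) in H1; [|lra]. apply (Rmult_le_compat_l K) in Hth1; [|lra].
    unfold p, c1. fold sm in H.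
    assert (0 <= d / 4 * vnorm h) by (apply Rmult_le_pos; lra). lra.
  - assert (Hz : vsub (vadd a (vscal T e)) x = vsub (vscal (T - s x) e) (w x)).
    { unfold w, proj. change (l (vsub x a)) with (s x). vlin. }
    pose proof (dual_elt_linear p Hp) as Hpl. pose proof (dual_elt_linear L HL) as HLl.
    rewrite Hz. rewrite (vlinear_sub p), (vlinear_scal p) by exact Hpl.
    assert (Hqe : q e = 0).
    { unfold q, proj. rewrite Hle. replace (vsub e (vscal 1 e)) with (vzero : X) by vlin.
      now apply vlinear_0. }
    assert (Hlw : l (w x) = 0).
    { unfold w, proj. rewrite (vlinear_sub l), (vlinear_scal l) by exact Hll. rewrite Hle. ring. }
    assert (Hqw : q (w x) = D (w x) (w x)).
    { unfold q, proj. rewrite Hlw. f_equal. vlin. }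
    (* Convexity of [th] between [w x] and zero: the sideways penalty can hurt only by the smoothing
       error. *)
    assert (HDw : - kap <= D (w x) (w x)).
    { pose proof (proj1 (proj2 (proj2 Hth)) (w x) (vopp (w x))) as H.
      rewrite vadd_opp, (vlinear_opp _ _ HDl) in H.
      pose proof (Hthb vzero) as [_ H1]. rewrite vnorm_0 in H1. specialize (Hth0 (w x)). lra. }
    unfold p. rewrite Hqe, Hlw, Hqw, Hle.
    pose proof (HLn e) as HLe. pose proof (HLn (w x)) as HLw. fold E in HLe.
    pose proof (Rle_abs (L e)). pose proof (Rle_abs (- L (w x))) as HLw'. rewrite Rabs_Ropp in HLw'.
    assert (Hc1 : sigma / 2 <= c1) by (unfold c1; nra).
    assert (H1 : sigma / 4 <= c1 - L e) by lra.
    (* The gain [T * sigma / 8] outweighs the losses [T * sigma / 16] and [T * sigma / 32]. *)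
    assert (H2 : T / 2 * (sigma / 4) <= (T - s x) * (c1 - L e)) by (apply Rmult_le_compat; lra).
    pose proof (Rmult_le_compat_l K _ _ ltac:(lra) HDw) as H3.
    assert (H4 : mu * vnorm (w x) <= mu) by (rewrite <- (Rmult_1_r mu) at 2; apply Rmult_le_compat_l; lra).
    lra.
Qed.

(** * Separable reduction *)

Definition ratR (n : nat) : R :=
  match unpickle n : option (nat * nat * nat) with
  | Some (a, b, c) => (INR a - INR b) / (INR c + 1)
  | None => 0
  end.

Lemma ratR_dense (x eps : R) : 0 < eps -> exists n, Rabs (ratR n - x) < eps.
Proof.
  intros He. destruct (archimed_inv eps He) as [c Hc]. specialize (Hc c (le_n c)).
  set (d := INR c + 1) in *. assert (Hd : 0 < d) by (unfold d; pose proof (pos_INR c); lra).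
  assert (Hz : exists a b : nat, INR a - INR b = IZR (up (x * d))).
  { exists (Z.to_nat (up (x * d))), (Z.to_nat (- up (x * d))).
    rewrite !INR_IZR_INZ, <- minus_IZR. f_equal. lia. }
  destruct Hz as (a & b & Hab). exists (pickle (a, b, c)).
  unfold ratR. rewrite pickleK, Hab. fold d.
  destruct (archimed (x * d)) as [H1 H2].
  replace (IZR (up (x * d)) / d - x) with ((IZR (up (x * d)) - x * d) * / d) by (field; lra).
  pose proof (Rinv_0_lt_compat d Hd). rewrite Rabs_pos_eq by nra. nra.
Qed.

Lemma ratR_between (a b : R) : a < b -> exists n, a < ratR n < b.
Proof.
  intros H. destruct (ratR_dense ((a + b) / 2) ((b - a) / 2)) as [n Hn]; [lra|].
  exists n. apply Rabs_def2 in Hn. lra.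
Qed.

Definition seq_closure {X : NormedSpace} (D : nat -> X) (x : X) : Prop :=
  forall eps, eps > 0 -> exists n, vnorm (vsub x (D n)) < eps.

Lemma seq_closure_self {X : NormedSpace} (D : nat -> X) (n : nat) : seq_closure D (D n).
Proof. intros eps He. exists n. rewrite vsub_self, vnorm_0. lra. Qed.

Lemma seq_closure_closed {X : NormedSpace} (D : nat -> X) (u : nat -> X) (x : X) :
  (forall n, seq_closure D (u n)) -> seq_lim u x -> seq_closure D x.
Proof.
  intros Hu Hx eps He. destruct (Hx (eps / 2) ltac:(lra)) as [N HN].
  specialize (HN N (le_n N)). destruct (Hu N (eps / 2) ltac:(lra)) as [n Hn].
  exists n. pose proof (vnorm_sub_triangle x (u N) (D n)) as H.
  rewrite (vnorm_sub_sym x (u N)) in H. lra.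
Qed.

Lemma seq_closure_linear {X : NormedSpace} (D : nat -> X) :
  (forall m n, exists k, D k = vadd (D m) (D n)) ->
  (forall q n, exists k, D k = vscal (ratR q) (D n)) ->
  linear_subspace (seq_closure D).
Proof.
  intros Hadd Hscal.
  assert (Hs : forall a x, seq_closure D x -> seq_closure D (vscal a x)).
  { intros a x Hx eps He.
    destruct (Hx (eps / (2 * (Rabs a + 1)))) as [n Hn].
    { apply Rlt_gt, Rdiv_lt_0_compat; pose proof (Rabs_pos a); lra. }
    destruct (ratR_dense a (eps / (2 * (vnorm (D n) + 1)))) as [q Hq].
    { apply Rdiv_lt_0_compat; pose proof (vnorm_nonneg _ (D n)); lra. }
    destruct (Hscal q n) as [k Hk]. exists k. rewrite Hk.
    pose proof (vnorm_le_add (vsub (vscal a x) (vscal (ratR q) (D n)))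
      (vscal a (vsub x (D n))) (vscal (a - ratR q) (D n)) ltac:(vlin)) as H.
    rewrite !vnorm_scal, (Rabs_minus_sym a) in H.
    pose proof (Rabs_pos a) as Ha. pose proof (vnorm_nonneg _ (D n)) as HDn.
    assert (H1 : Rabs a * vnorm (vsub x (D n)) <= (Rabs a + 1) * vnorm (vsub x (D n)))
      by (apply Rmult_le_compat_r; [apply vnorm_nonneg|lra]).
    assert (H2 : Rabs (ratR q - a) * vnorm (D n) <= Rabs (ratR q - a) * (vnorm (D n) + 1))
      by (apply Rmult_le_compat_l; [apply Rabs_pos|lra]).
    apply (Rmult_lt_compat_l (Rabs a + 1)) in Hn; [|lra].
    apply (Rmult_lt_compat_r (vnorm (D n) + 1)) in Hq; [|lra].
    replace ((Rabs a + 1) * (eps / (2 * (Rabs a + 1)))) with (eps / 2) in Hn by (field; lra).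
    replace (eps / (2 * (vnorm (D n) + 1)) * (vnorm (D n) + 1)) with (eps / 2) in Hq by (field; lra).
    lra. }
  split; [|split; [|exact Hs]].
  - replace (vzero : X) with (vscal 0 (D O)) by vlin. apply Hs, seq_closure_self.
  - intros x y Hx Hy eps He.
    destruct (Hx (eps / 2) ltac:(lra)) as [m Hm]. destruct (Hy (eps / 2) ltac:(lra)) as [n Hn].
    destruct (Hadd m n) as [k Hk]. exists k. rewrite Hk.
    pose proof (vnorm_le_add (vsub (vadd x y) (vadd (D m) (D n))) (vsub x (D m)) (vsub y (D n)) ltac:(vlin)).
    lra.
Qed.

(* A triple [(w, n, u)] stands for the point [u] with weight [w] and slack [1 / (n + 1)]. *)
Fixpoint wsum {X : NormedSpace} (x : X) (L : list (R * nat * X)) : X :=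
  match L with
  | [] => vzero
  | (w, _, u) :: L' => vadd (vscal w (vsub u x)) (wsum x L')
  end.

Fixpoint wincr {X : NormedSpace} (f : X -> ereal) (x : X) (t : R) (L : list (R * nat * X)) : R :=
  match L with
  | [] => 0
  | (w, n, u) :: L' =>
    w * (fin_part (f u) - t + vnorm (vsub u x) * / (INR n + 1)) + wincr f x t L'
  end.

Fixpoint wtot {X : NormedSpace} (L : list (R * nat * X)) : R :=
  match L with
  | [] => 0
  | (w, _, _) :: L' => w + wtot L'
  end.

(** An upper bound for [p y] when [p] has norm at most [K] and respects the slackened increments of
    [f] at the points of [L]: write [y] as [wsum x L] plus an error. *)
Definition wcost {X : NormedSpace} (f : X -> ereal) (K : R) (x : X) (t : R) (y : X) (L : list (R * nat * X)) : R :=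
  wincr f x t L + K * vnorm (vsub (wsum x L) y).

Definition nonneg_weights {X : NormedSpace} (L : list (R * nat * X)) : Prop :=
  Forall (fun it => 0 <= fst (fst it)) L.

Lemma wtot_nonneg {X : NormedSpace} (L : list (R * nat * X)) : nonneg_weights L -> 0 <= wtot L.
Proof. induction 1 as [|[[w n] u] L Hw _ IH]; simpl in *; lra. Qed.

Lemma inv_INR1_bounds (n : nat) : 0 < / (INR n + 1) <= 1.
Proof.
  pose proof (pos_INR n). split; [apply Rinv_0_lt_compat; lra|].
  rewrite <- Rinv_1 at 2. apply Rinv_le_contravar; lra.
Qed.

Lemma wincr_lipschitz {X : NormedSpace} (f : X -> ereal) (x x' : X) (t t' : R) (L : list (R * nat * X)) :
  nonneg_weights L ->
  wincr f x' t' L <= wincr f x t L + wtot L * (Rabs (t' - t) + vnorm (vsub x' x)).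
Proof.
  induction 1 as [|[[w n] u] L Hw _ IH]; simpl in *; [lra|].
  pose proof (Rle_abs (- (t' - t))) as H1. rewrite Rabs_Ropp in H1.
  pose proof (vnorm_sub_triangle u x x') as H2. rewrite (vnorm_sub_sym x x') in H2.
  pose proof (inv_INR1_bounds n) as H3. pose proof (vnorm_nonneg _ (vsub x' x)) as H4.
  assert (H5 : vnorm (vsub u x') * / (INR n + 1) <= vnorm (vsub u x) * / (INR n + 1) + vnorm (vsub x' x)).
  { apply (Rmult_le_compat_r (/ (INR n + 1))) in H2; [|lra].
    pose proof (Rmult_le_compat_l _ _ _ H4 (proj2 H3)). lra. }
  assert (H6 : w * (fin_part (f u) - t' + vnorm (vsub u x') * / (INR n + 1)) <=
     w * ((fin_part (f u) - t + vnorm (vsub u x) * / (INR n + 1)) + (Rabs (t' - t) + vnorm (vsub x' x))))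
    by (apply Rmult_le_compat_l; lra).
  lra.
Qed.

Lemma wsum_lipschitz {X : NormedSpace} (x x' : X) (L : list (R * nat * X)) :
  nonneg_weights L -> vnorm (vsub (wsum x' L) (wsum x L)) <= wtot L * vnorm (vsub x' x).
Proof.
  induction 1 as [|[[w n] u] L Hw _ IH]; simpl in *; [rewrite vsub_self, vnorm_0; lra|].
  pose proof (vnorm_le_add
    (vsub (vadd (vscal w (vsub u x')) (wsum x' L)) (vadd (vscal w (vsub u x)) (wsum x L)))
    (vscal w (vsub x x')) (vsub (wsum x' L) (wsum x L)) ltac:(vlin)) as H.
  rewrite vnorm_scal, Rabs_pos_eq, (vnorm_sub_sym x) in H by exact Hw. lra.
Qed.

Lemma wcost_lipschitz {X : NormedSpace} (f : X -> ereal) (K : R) (x x' y y' : X) (t t' : R) (L : list (R * nat * X)) :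
  0 <= K -> nonneg_weights L ->
  wcost f K x' t' y' L <= wcost f K x t y L + wtot L * (Rabs (t' - t) + vnorm (vsub x' x))
    + K * (wtot L * vnorm (vsub x' x) + vnorm (vsub y' y)).
Proof.
  intros HK HL. unfold wcost.
  pose proof (wincr_lipschitz f x x' t t' L HL) as H1.
  pose proof (wsum_lipschitz x x' L HL) as H2.
  pose proof (vnorm_le_add (vsub (wsum x' L) y') (vsub (wsum x' L) (wsum x L))
    (vsub (wsum x L) y') ltac:(vlin)) as H3.
  pose proof (vnorm_sub_triangle (wsum x L) y y') as H4. rewrite (vnorm_sub_sym y) in H4.
  assert (H5 : vnorm (vsub (wsum x' L) y') <= vnorm (vsub (wsum x L) y)
     + (wtot L * vnorm (vsub x' x) + vnorm (vsub y' y))) by lra.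
  apply (Rmult_le_compat_l K) in H5; lra.
Qed.

Lemma wsum_app {X : NormedSpace} (x : X) (L L' : list (R * nat * X)) :
  wsum x (L ++ L') = vadd (wsum x L) (wsum x L').
Proof. induction L as [|[[w n] u] L IH]; simpl; [vlin|]. rewrite IH. vlin. Qed.

Lemma wincr_app {X : NormedSpace} (f : X -> ereal) (x : X) (t : R) (L L' : list (R * nat * X)) :
  wincr f x t (L ++ L') = wincr f x t L + wincr f x t L'.
Proof. induction L as [|[[w n] u] L IH]; simpl; [ring|]. rewrite IH. ring. Qed.

Definition wscale {X : NormedSpace} (c : R) (L : list (R * nat * X)) : list (R * nat * X) :=
  map (fun it => (c * fst (fst it), snd (fst it), snd it)) L.

Lemma wsum_scale {X : NormedSpace} (x : X) (c : R) (L : list (R * nat * X)) :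
  wsum x (wscale c L) = vscal c (wsum x L).
Proof. induction L as [|[[w n] u] L IH]; simpl; [vlin|]. rewrite IH. vlin. Qed.

Lemma wincr_scale {X : NormedSpace} (f : X -> ereal) (x : X) (t c : R) (L : list (R * nat * X)) :
  wincr f x t (wscale c L) = c * wincr f x t L.
Proof. induction L as [|[[w n] u] L IH]; simpl; [ring|]. rewrite IH. ring. Qed.

(* A code [(q, n, k)] prescribes the weight [ratR q], the slack [1 / (n + 1)] and the
   radius [1 / (k + 1)] of a point to be chosen. *)
Fixpoint decode_points {X : NormedSpace} (cs : list (nat * nat * nat)) (us : list X) : list (R * nat * X) :=
  match cs, us with
  | (q, n, _) :: cs', u :: us' => (ratR q, n, u) :: decode_points cs' us'
  | _, _ => []
  end.

Definition admissible_points {X : NormedSpace} (f : X -> ereal) (x : X) (cs : list (nat * nat * nat)) (us : list X) : Prop :=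
  Forall2 (fun c u => f u <> PInf /\ vnorm (vsub u x) < / (INR (snd c) + 1)) cs us.

Definition cheap_points {X : NormedSpace} (f : X -> ereal) (cs : list (nat * nat * nat))
    (par : nat * nat * nat) (x y : X) (us : list X) : Prop :=
  admissible_points f x cs us /\
  wcost f (INR (snd (fst par))) x (ratR (fst (fst par))) y (decode_points cs us) < ratR (snd par).

(* By [bounded_functional_below_cone], the lists that are cheap for all small radii are
   the obstructions to extending a subgradient from [seq_closure D] to the whole space;
   a code and its parameters range over a countable set. *)
Definition cheap_points_reflected {X : NormedSpace} (f : X -> ereal) (D : nat -> X) : Prop :=
  forall cs par i j, (exists us, cheap_points f cs par (D i) (D j) us) ->
    exists us, cheap_points f cs par (D i) (D j) us /\ Forall (fun u => exists k, u = D k) us.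

Lemma decode_points_wtot {X : NormedSpace} (cs : list (nat * nat * nat)) (us vs : list X) :
  length us = length cs -> length vs = length cs ->
  wtot (decode_points cs us) = wtot (decode_points cs vs).
Proof.
  revert us vs; induction cs as [|[[q n] k] cs IH]; intros [|u us] [|v vs] Hu Hv; simpl in *;
    try discriminate; auto.
  f_equal. apply IH; lia.
Qed.

Lemma decode_points_nonneg {X : NormedSpace} (cs : list (nat * nat * nat)) (us : list X) :
  Forall (fun c => 0 <= ratR (fst (fst c))) cs -> nonneg_weights (decode_points cs us).
Proof.
  intros H. revert us; induction H as [|[[q n] k] cs Hq _ IH]; intros [|u us]; simpl; constructor; auto.
  apply IH.
Qed.

(** Weights are rounded upwards, hence stay nonnegative; the rounding precision is scaled by [m],
    which dominates both the increment and the distance at the point. *)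
Lemma rational_weights {X : NormedSpace} (f : X -> ereal) (kf : nat -> nat) (x : X) (t : R)
    (L : list (R * nat * X)) (eta : R) :
  nonneg_weights L -> 0 < eta ->
  exists cs, let L' := decode_points cs (map snd L) in
    length cs = length L /\
    Forall (fun c => 0 <= ratR (fst (fst c)) /\ snd c = kf (snd (fst c))) cs /\
    Forall2 (fun c it => snd (fst c) = snd (fst it)) cs L /\
    wincr f x t L' <= wincr f x t L + eta /\ vnorm (vsub (wsum x L') (wsum x L)) <= eta.
Proof.
  intros HL. revert eta. induction HL as [|[[w n] u] L Hw _ IH]; intros eta He.
  - exists []. simpl. rewrite vsub_self, vnorm_0. repeat split; auto; lra.
  - destruct (IH (eta / 2) ltac:(lra)) as (cs & Hlen & Hcs & Hcs2 & H1 & H2).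
    set (b := fin_part (f u) - t + vnorm (vsub u x) * / (INR n + 1)).
    set (m := Rabs b + vnorm (vsub u x) + 1).
    pose proof (Rabs_pos b) as Hb. pose proof (vnorm_nonneg _ (vsub u x)) as Hu.
    destruct (ratR_between w (w + eta / (2 * m))) as [q Hq].
    { assert (0 < eta / (2 * m)) by (apply Rdiv_lt_0_compat; unfold m; lra). lra. }
    assert (Hqm : (ratR q - w) * m <= eta / 2).
    { apply Rle_trans with (eta / (2 * m) * m); [apply Rmult_le_compat_r; unfold m in *; lra|].
      right. field. unfold m. lra. }
    exists ((q, n, kf n) :: cs). simpl in *. split; [lia|].
    split; [constructor; [simpl; split; [lra|reflexivity]|exact Hcs]|].
    split; [constructor; [reflexivity|exact Hcs2]|].
    split.
    + fold b. assert ((ratR q - w) * b <= (ratR q - w) * m).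
      { apply Rmult_le_compat_l; [lra|]. pose proof (Rle_abs b). unfold m. lra. }
      lra.
    + pose proof (vnorm_le_add
        (vsub (vadd (vscal (ratR q) (vsub u x)) (wsum x (decode_points cs (map snd L))))
              (vadd (vscal w (vsub u x)) (wsum x L)))
        (vscal (ratR q - w) (vsub u x))
        (vsub (wsum x (decode_points cs (map snd L))) (wsum x L)) ltac:(vlin)) as H.
      rewrite vnorm_scal, Rabs_pos_eq in H by lra.
      assert ((ratR q - w) * vnorm (vsub u x) <= (ratR q - w) * m)
        by (apply Rmult_le_compat_l; unfold m; lra).
      lra.
Qed.

Lemma radii_lower_bound (cs : list (nat * nat * nat)) :
  exists r, 0 < r /\ Forall (fun c => r <= / (INR (snd c) + 1) / 2) cs.
Proof.
  induction cs as [|c cs (r & Hr & IH)].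
  - exists 1. split; [lra|constructor].
  - pose proof (inv_INR1_bounds (snd c)) as H.
    exists (Rmin r (/ (INR (snd c) + 1) / 2)). split; [apply Rmin_glb_lt; lra|].
    constructor; [apply Rmin_r|]. eapply Forall_impl; [|exact IH].
    intros d Hd. simpl in Hd. pose proof (Rmin_l r (/ (INR (snd c) + 1) / 2)). lra.
Qed.

Lemma wincr_ge_functional {X : NormedSpace} (f : X -> ereal) (x : X) (t : R) (p : X -> R) (L : list (R * nat * X)) :
  vlinear p -> nonneg_weights L ->
  Forall (fun it => p (vsub (snd it) x) <=
    fin_part (f (snd it)) - t + vnorm (vsub (snd it) x) * / (INR (snd (fst it)) + 1)) L ->
  p (wsum x L) <= wincr f x t L.
Proof.
  intros Hp HL H. induction HL as [|[[w n] u] L Hw _ IH]; simpl in *.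
  - rewrite (vlinear_0 p Hp). lra.
  - inversion H as [|? ? H1 H2]; subst. simpl in H1.
    rewrite (vlinear_add p), (vlinear_scal p) by exact Hp.
    specialize (IH H2). apply (Rmult_le_compat_l w) in H1; lra.
Qed.

(** Half the radius around [x] leaves room to recentre at [x']; conversely, [decode_points_near]
    returns to [x] with twice the radius. *)
Lemma admissible_points_near {X : NormedSpace} (f : X -> ereal) (kf : nat -> nat) (x x' : X) (r : R)
    (cs : list (nat * nat * nat)) (L : list (R * nat * X)) :
  vnorm (vsub x' x) < r -> Forall (fun c => r <= / (INR (snd c) + 1) / 2) cs ->
  Forall (fun c => 0 <= ratR (fst (fst c)) /\ snd c = kf (snd (fst c))) cs ->
  Forall2 (fun c it => snd (fst c) = snd (fst it)) cs L ->
  Forall (fun it => f (snd it) <> PInf /\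
     vnorm (vsub (snd it) x) < / (INR (kf (snd (fst it))) + 1) / 2) L ->
  admissible_points f x' cs (map snd L).
Proof.
  intros Hx Hrad Hcs H2 HL. unfold admissible_points.
  induction H2 as [|[[q n'] k] [[w n] u] cs L Hn H2 IH]; simpl; constructor.
  - inversion Hcs as [|? ? [_ Hk] _]; inversion Hrad as [|? ? Hr _];
      inversion HL as [|? ? [Hfu Hu] _]; subst. simpl in *. subst. split; [exact Hfu|].
    pose proof (vnorm_sub_triangle u x x') as H. rewrite (vnorm_sub_sym x x') in H. lra.
  - inversion Hcs; inversion Hrad; inversion HL; subst. apply IH; auto.
Qed.

Lemma decode_points_near {X : NormedSpace} (f : X -> ereal) (kf : nat -> nat) (x x' : X) (r : R)
    (cs : list (nat * nat * nat)) (us : list X) (it : R * nat * X) :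
  vnorm (vsub x' x) < r -> Forall (fun c => r <= / (INR (snd c) + 1) / 2) cs ->
  Forall (fun c => snd c = kf (snd (fst c))) cs ->
  admissible_points f x' cs us -> In it (decode_points cs us) ->
  In (snd it) us /\ f (snd it) <> PInf /\
    vnorm (vsub (snd it) x) < 2 * / (INR (kf (snd (fst it))) + 1).
Proof.
  intros Hx Hrad Hcs Hadm. unfold admissible_points in Hadm.
  induction Hadm as [|[[q n] k] u cs us [Hfu Hu] _ IH]; simpl; [contradiction|].
  inversion Hcs as [|? ? Hk Hcs']; inversion Hrad as [|? ? Hr Hrad']; subst. simpl in *. subst k.
  intros [<-|Hit].
  - simpl. split; [now left|]. split; [exact Hfu|].
    pose proof (vnorm_sub_triangle u x' x). pose proof (inv_INR1_bounds (kf n)). lra.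
  - destruct (IH Hrad' Hcs' Hit) as (H1 & H2). split; [now right|exact H2].
Qed.

(** A violating list stays cheap after its data are rounded to countable ones, so reflection
    provides an equally cheap list inside [D]. There [p] respects the increments, which contradicts
    cheapness. *)
Lemma reflected_wcost_bound {X : NormedSpace} (f : X -> ereal) (D : nat -> X) (x y : X) (px : R)
    (p : X -> R) (K : nat) (kf : nat -> nat) (L : list (R * nat * X)) :
  cheap_points_reflected f D -> seq_closure D x -> seq_closure D y ->
  dual_elt p -> dual_norm_le p (INR K) ->
  (forall n u, seq_closure D u -> f u <> PInf -> vnorm (vsub u x) < 2 * / (INR (kf n) + 1) ->
     p (vsub u x) <= fin_part (f u) - px + vnorm (vsub u x) * / (INR n + 1)) ->
  nonneg_weights L ->
  Forall (fun it => f (snd it) <> PInf /\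
     vnorm (vsub (snd it) x) < / (INR (kf (snd (fst it))) + 1) / 2) L ->
  p y <= wcost f (INR K) x px y L.
Proof.
  intros Hrefl Hx Hy Hp HpK Hsub HL Hadm. apply Rnot_lt_le. intros Hlt.
  pose proof (dual_elt_linear p Hp) as Hpl. pose proof (pos_INR K) as HK.
  (* With a gap of [8 * eta], rounding and recentring cost [eta] each, the threshold lies at least
     [3 * eta] below [p y], and returning to [x], [y], [px] costs one more [eta]. *)
  set (eta := (p y - wcost f (INR K) x px y L) / 8). assert (Heta : 0 < eta) by (unfold eta; lra).
  set (etaw := eta / (INR K + 1)).
  assert (Hetaw : 0 < etaw) by (apply Rdiv_lt_0_compat; lra).
  assert (HetaK : INR K * etaw + etaw = eta) by (unfold etaw; field; lra).
  destruct (rational_weights f kf x px L etaw HL Hetaw) as (cs & Hlen & Hcs & Hcs2 & Hi & Hs).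
  set (us := map snd L) in *. set (L1 := decode_points cs us) in *.
  assert (Hnn : forall vs : list X, nonneg_weights (decode_points cs vs)).
  { intros vs. apply decode_points_nonneg. eapply Forall_impl; [|exact Hcs]. intros c H; apply H. }
  set (W := wtot L1). assert (HW : 0 <= W) by (apply wtot_nonneg, Hnn).
  destruct (radii_lower_bound cs) as (r & Hr & Hrad).
  set (M := 2 * W + INR K * W + INR K + 1). assert (HM : 0 < M) by (unfold M; nra).
  set (xi := Rmin r (eta / M)).
  assert (Hxi : 0 < xi /\ xi <= r /\ xi * M <= eta).
  { assert (0 < eta / M) by (apply Rdiv_lt_0_compat; lra). unfold xi.
    split; [now apply Rmin_glb_lt|]. split; [apply Rmin_l|].
    apply Rle_trans with (eta / M * M); [apply Rmult_le_compat_r; [lra|apply Rmin_r]|].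
    right. field. lra. }
  destruct Hxi as (Hxi & Hxir & HxiM).
  destruct (Hx xi Hxi) as [i Hxi']. destruct (Hy xi Hxi) as [j Hyj].
  destruct (ratR_dense px xi Hxi) as [kt Hkt].
  destruct (ratR_between (p y - 5 * eta) (p y - 3 * eta) ltac:(lra)) as [ks Hks].
  rewrite vnorm_sub_sym in Hxi', Hyj.
  assert (Herr : forall u v w, u <= xi -> v <= xi -> w <= xi -> 
      W * (u + v) + INR K * (W * v + w) <= eta).
  { intros u v w Hu Hv Hw.
    assert (W * (u + v) <= W * (xi + xi)) by (apply Rmult_le_compat_l; lra).
    assert (W * v <= W * xi) by (apply Rmult_le_compat_l; lra).
    assert (INR K * (W * v + w) <= INR K * (W * xi + xi)) by (apply Rmult_le_compat_l; lra).
    assert (M * xi = W * (xi + xi) + INR K * (W * xi + xi) + xi) by (unfold M; ring). lra. }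
  assert (Hcost1 : wcost f (INR K) x px y L1 <= wcost f (INR K) x px y L + eta).
  { unfold wcost.
    pose proof (vnorm_le_add (vsub (wsum x L1) y) (vsub (wsum x L1) (wsum x L))
      (vsub (wsum x L) y) ltac:(vlin)) as H.
    apply (Rmult_le_compat_l (INR K)) in H; [|exact HK].
    apply (Rmult_le_compat_l (INR K)) in Hs; [|exact HK]. lra. }
  destruct (Hrefl cs (kt, K, ks) i j) as (vs & [Hvadm Hvcost] & HvD).
  { exists us. split.
    - apply (admissible_points_near f kf x (D i) r); auto. lra.
    - simpl. fold L1.
      pose proof (wcost_lipschitz f (INR K) x (D i) y (D j) px (ratR kt) L1 HK (Hnn us)) as H.
      pose proof (Herr (Rabs (ratR kt - px)) (vnorm (vsub (D i) x)) (vnorm (vsub (D j) y))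
        ltac:(lra) ltac:(lra) ltac:(lra)) as H1.
      fold W in H. unfold eta in *. lra. }
  simpl in Hvcost. set (L2 := decode_points cs vs) in *.
  (* The weights come from the codes alone, so the error bound prepared for [L1] also covers the
     reflected list. *)
  assert (HW2 : wtot L2 = W).
  { apply decode_points_wtot.
    - symmetry. apply (Forall2_length Hvadm).
    - unfold us. rewrite length_map. lia. }
  pose proof (wcost_lipschitz f (INR K) (D i) x (D j) y (ratR kt) px L2 HK (Hnn vs)) as H.
  rewrite HW2, (Rabs_minus_sym px), (vnorm_sub_sym x (D i)), (vnorm_sub_sym y (D j)) in H.
  pose proof (Herr (Rabs (ratR kt - px)) (vnorm (vsub (D i) x)) (vnorm (vsub (D j) y))
        ltac:(lra) ltac:(lra) ltac:(lra)) as H1.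
  assert (Hlow : p (wsum x L2) <= wincr f x px L2).
  { apply wincr_ge_functional; [exact Hpl|apply Hnn|].
    apply Forall_forall. intros it Hit.
    destruct (decode_points_near f kf x (D i) r cs vs it ltac:(lra) Hrad
      ltac:(eapply Forall_impl; [|exact Hcs]; intros c0 H0; apply H0) Hvadm Hit)
      as (Hin & Hfin & Hnear).
    rewrite Forall_forall in HvD. destruct (HvD _ Hin) as [m Hm].
    apply Hsub; auto. rewrite Hm. apply seq_closure_self. }
  pose proof (HpK (vsub y (wsum x L2))) as Hb. rewrite vnorm_sub_sym in Hb.
  rewrite (vlinear_sub p) in Hb by exact Hpl.
  pose proof (Rle_abs (p y - p (wsum x L2))). unfold wcost in *. lra.
Qed.

Definition frechet_subdiff_on {X : NormedSpace} (Y : X -> Prop) (f : X -> ereal) (x : X) (p : X -> R) : Prop :=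
  exists px, f x = Fin px /\
    forall eps, eps > 0 -> exists delta, delta > 0 /\
      forall y, Y y -> 0 < vnorm (vsub y x) < delta ->
        ele (Fin (px + p (vsub y x) - eps * vnorm (vsub y x))) (f y).

Lemma nat_ge (c : R) : exists K, c <= INR K.
Proof.
  exists (Z.to_nat (up c)). destruct (archimed c) as [H _].
  rewrite INR_IZR_INZ. apply Rle_trans with (IZR (up c)); [lra|]. apply IZR_le. lia.
Qed.

(** The cone [Cn] encodes both demands on [p']: staying below the slackened increments of [f] near
    [x], and agreeing with [p] on the closure. Its lower bound is [reflected_wcost_bound]. *)
Lemma frechet_subdiff_extend {X : NormedSpace} (f : X -> ereal) (D : nat -> X) (x : X) (p : X -> R) :
  cheap_points_reflected f D -> linear_subspace (seq_closure D) -> seq_closure D x ->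
  dual_elt p -> frechet_subdiff_on (seq_closure D) f x p ->
  exists p', frechet_subdiff f x p' /\ forall y, seq_closure D y -> p' y = p y.
Proof.
  intros Hrefl (HY0 & HYadd & HYscal) Hx Hp (px & Hpx & Hsub).
  pose proof (dual_elt_linear p Hp) as Hpl.
  destruct (dual_elt_bound p Hp) as (c & Hc & Hpc). destruct (nat_ge c) as [K HK].
  assert (HpK : dual_norm_le p (INR K)).
  { intros h. specialize (Hpc h). pose proof (vnorm_nonneg _ h). nra. }
  assert (Hk : forall n, exists k, forall u, seq_closure D u -> f u <> PInf ->
     vnorm (vsub u x) < 2 * / (INR k + 1) ->
     p (vsub u x) <= fin_part (f u) - px + vnorm (vsub u x) * / (INR n + 1)).
  { intros n. pose proof (inv_INR1_bounds n) as Hn.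
    destruct (Hsub (/ (INR n + 1)) ltac:(lra)) as (d & Hd & Hdu).
    destruct (archimed_inv (d / 2) ltac:(lra)) as [k Hk]. exists k. intros u Hu Hfu Hux.
    specialize (Hk k (le_n k)).
    destruct (vnorm_nonneg _ (vsub u x)) as [H0|H0].
    - specialize (Hdu u Hu ltac:(lra)). rewrite (fin_partE _ Hfu) in Hdu. simpl in Hdu. lra.
    - symmetry in H0. pose proof (vsub_eq0 _ _ H0) as E. subst u.
      rewrite vsub_self, vnorm_0, (vlinear_0 p Hpl), Hpx. simpl. lra. }
  destruct (functional_choice _ Hk) as [kf Hkf]. clear Hk.
  set (adm := fun L : list (R * nat * X) => nonneg_weights L /\
    Forall (fun it => f (snd it) <> PInf /\
      vnorm (vsub (snd it) x) < / (INR (kf (snd (fst it))) + 1) / 2) L).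
  set (Cn := fun h t => exists L y, adm L /\ seq_closure D y /\
    h = vsub (wsum x L) y /\ t = wincr f x px L - p y).
  destruct (bounded_functional_below_cone Cn (INR K) (pos_INR K)) as (p' & Hp' & _ & Hcone).
  - split; [|split].
    + exists [], vzero. split; [split; constructor|]. split; [exact HY0|].
      split; [simpl; vlin|]. simpl. rewrite (vlinear_0 p Hpl). ring.
    + intros h h' s t (L & y & [HL1 HL2] & Hy & -> & ->) (L' & y' & [HL1' HL2'] & Hy' & -> & ->).
      exists (L ++ L'), (vadd y y'). split; [split; apply Forall_app; auto|].
      split; [now apply HYadd|].
      rewrite wsum_app, wincr_app, (vlinear_add p) by exact Hpl. split; [vlin|ring].
    + intros h s t Ht (L & y & [HL1 HL2] & Hy & -> & ->).
      exists (wscale t L), (vscal t y). split; [split|].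
      * apply Forall_map. eapply Forall_impl; [|exact HL1]. intros [[w n] u] H. simpl in *. nra.
      * apply Forall_map. eapply Forall_impl; [|exact HL2]. intros [[w n] u] H. exact H.
      * split; [now apply HYscal|].
        rewrite wsum_scale, wincr_scale, (vlinear_scal p) by exact Hpl. split; [vlin|ring].
  - intros h t (L & y & [HL1 HL2] & Hy & -> & ->).
    pose proof (reflected_wcost_bound f D x y px p K kf L Hrefl Hx Hy Hp HpK Hkf HL1 HL2) as H.
    unfold wcost in H. lra.
  - pose proof (dual_elt_linear p' Hp') as Hp'l.
    (* Empty lists give [p <= p'] on the subspace, and applying this to [- y] gives equality. *)
    assert (Hle : forall y, seq_closure D y -> p y <= p' y).
    { intros y Hy. pose proof (Hcone (vsub (wsum x []) y) (wincr f x px [] - p y)) as H.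
      simpl in H. rewrite (vlinear_sub p'), (vlinear_0 p' Hp'l) in H by exact Hp'l.
      enough (0 - p' y <= 0 - p y) by lra. apply H.
      exists [], y. split; [split; constructor|]. repeat split; auto. }
    exists p'. split.
    + split; [exact Hp'|]. exists px. split; [exact Hpx|]. intros eps He.
      destruct (archimed_inv eps He) as [n Hn]. specialize (Hn n (le_n n)).
      pose proof (inv_INR1_bounds (kf n)) as Hkn.
      exists (/ (INR (kf n) + 1) / 2). split; [lra|]. intros y [_ Hy].
      destruct (f y) as [fy|] eqn:Efy; [|exact I]. simpl.
      pose proof (Hcone (vsub (wsum x [(1, n, y)]) vzero) (wincr f x px [(1, n, y)] - p vzero)) as H.
      simpl in H. rewrite Efy, (vlinear_0 p Hpl) in H. simpl in H.
      replace (vsub (vadd (vscal 1 (vsub y x)) vzero) vzero) with (vsub y x) in H by vlin.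
      assert (H' : p' (vsub y x) <=
         1 * (fy - px + vnorm (vsub y x) * / (INR n + 1)) + 0 - 0).
      { apply H. exists [(1, n, y)], vzero. split; [split|].
        - constructor; [simpl; lra|constructor].
        - constructor; [|constructor]. simpl. split; [congruence|lra].
        - split; [exact HY0|]. split; [simpl; vlin|]. simpl. rewrite Efy, (vlinear_0 p Hpl). simpl. ring. }
      assert (vnorm (vsub y x) * / (INR n + 1) <= vnorm (vsub y x) * eps)
        by (apply Rmult_le_compat_l; [apply vnorm_nonneg|lra]).
      lra.
    + intros y Hy. apply Rle_antisym; [|now apply Hle].
      pose proof (Hle (vscal (-1) y) (HYscal (-1) y Hy)) as H.
      rewrite (vlinear_scal p _ _ Hpl), (vlinear_scal p' _ _ Hp'l) in H. lra.
Qed.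

(** * A countable hull closed under the choice of witnesses *)

Definition skolem_op : Type := (unit + nat + list (nat * nat * nat) * (nat * nat * nat) * nat)%type.

(** The whole list is chosen at once, independently of the index extracted by [exec_op], so its
    entries belong to the same witness. *)
Definition cheap_choice {X : NormedSpace} (f : X -> ereal) (cs : list (nat * nat * nat))
    (par : nat * nat * nat) (x y : X) : list X :=
  epsilon (inhabits []) (cheap_points f cs par x y).

Definition exec_op {X : NormedSpace} (f : X -> ereal) (op : skolem_op) (x y : X) : X :=
  match op with
  | inl (inl _) => vadd x y
  | inl (inr q) => vscal (ratR q) x
  | inr (cs, par, i) => nth i (cheap_choice f cs par x y) vzero
  end.

Definition apply_op {X : NormedSpace} (f : X -> ereal) (c : nat) (args : list X) : X :=
  match unpickle c : option skolem_op with
  | Some op => exec_op f op (nth 0 args vzero) (nth 1 args vzero)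
  | None => vzero
  end.

Fixpoint eval_tree {X : NormedSpace} (f : X -> ereal) (b : nat -> X) (t : GenTree.tree nat) : X :=
  match t with
  | GenTree.Leaf n => b n
  | GenTree.Node c ts => apply_op f c (map (eval_tree f b) ts)
  end.

(** The hull consists of the values of all terms over [b]. Terms are trees labelled by codes of
    operations, a countable type, so [unpickle] enumerates them directly. *)
Definition skolem_hull {X : NormedSpace} (f : X -> ereal) (b : nat -> X) (n : nat) : X :=
  match unpickle n : option (GenTree.tree nat) with
  | Some t => eval_tree f b t
  | None => b O
  end.

Lemma skolem_hull_base {X : NormedSpace} (f : X -> ereal) (b : nat -> X) (n : nat) :
  exists k, skolem_hull f b k = b n.
Proof. exists (pickle (GenTree.Leaf n)). unfold skolem_hull. now rewrite pickleK. Qed.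

Lemma skolem_hull_op {X : NormedSpace} (f : X -> ereal) (b : nat -> X) (op : skolem_op) (i j : nat) :
  exists k, skolem_hull f b k = exec_op f op (skolem_hull f b i) (skolem_hull f b j).
Proof.
  assert (H : forall n, exists t, eval_tree f b t = skolem_hull f b n).
  { intros n. unfold skolem_hull. destruct (unpickle n) as [t|]; [now exists t|].
    now exists (GenTree.Leaf 0%nat). }
  destruct (H i) as [ti Hi]. destruct (H j) as [tj Hj].
  exists (pickle (GenTree.Node (pickle op) [ti; tj])). unfold skolem_hull at 1. rewrite pickleK.
  cbn [eval_tree map]. unfold apply_op. rewrite pickleK, Hi, Hj. reflexivity.
Qed.

Lemma skolem_hull_linear {X : NormedSpace} (f : X -> ereal) (b : nat -> X) :
  linear_subspace (seq_closure (skolem_hull f b)).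
Proof.
  apply seq_closure_linear.
  - intros m n. destruct (skolem_hull_op f b (inl (inl tt)) m n) as [k Hk]. now exists k.
  - intros q n. destruct (skolem_hull_op f b (inl (inr q)) n n) as [k Hk]. now exists k.
Qed.

Lemma skolem_hull_reflected {X : NormedSpace} (f : X -> ereal) (b : nat -> X) :
  cheap_points_reflected f (skolem_hull f b).
Proof.
  intros cs par i j Hex.
  set (us := cheap_choice f cs par (skolem_hull f b i) (skolem_hull f b j)).
  exists us. split; [exact (epsilon_spec (inhabits []) _ Hex)|].
  apply Forall_forall. intros u Hu. destruct (In_nth us u vzero Hu) as (m & _ & Hm).
  destruct (skolem_hull_op f b (inr (cs, par, m)) i j) as [k Hk]. exists k.
  rewrite Hk. simpl. fold us. now rewrite Hm.
Qed.

(** * Asplund spaces *)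

Lemma sig_ext {A : Type} (P : A -> Prop) (u v : {x | P x}) : proj1_sig u = proj1_sig v -> u = v.
Proof. destruct u, v. simpl. intros ->. f_equal. apply proof_irrelevance. Qed.

Lemma subspace_opp {X : NormedSpace} (Y : X -> Prop) (x : X) :
  linear_subspace Y -> Y x -> Y (vopp x).
Proof. intros (_ & _ & Hs) Hx. rewrite vopp_scal. now apply Hs. Qed.

Definition subspace {X : NormedSpace} (Y : X -> Prop) (HY : linear_subspace Y) : NormedSpace.
Proof.
  refine (Build_NormedSpace {x | Y x}
    (exist _ vzero (proj1 HY))
    (fun u v => exist _ (vadd (proj1_sig u) (proj1_sig v))
       (proj1 (proj2 HY) _ _ (proj2_sig u) (proj2_sig v)))
    (fun u => exist _ (vopp (proj1_sig u)) (subspace_opp Y _ HY (proj2_sig u)))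
    (fun a u => exist _ (vscal a (proj1_sig u)) (proj2 (proj2 HY) a _ (proj2_sig u)))
    (fun u => vnorm (proj1_sig u)) _ _ _ _ _ _ _ _ _ _ _ _);
    intros; try solve [apply sig_ext; simpl; vlin].
  - apply vnorm_nonneg.
  - apply sig_ext. simpl. now apply vnorm_eq0.
  - apply vnorm_triangle.
  - apply vnorm_scal.
Defined.

Lemma subspace_complete {X : NormedSpace} (Y : X -> Prop) (HY : linear_subspace Y) :
  complete X -> (forall u x, (forall n, Y (u n)) -> seq_lim u x -> Y x) ->
  complete (subspace Y HY).
Proof.
  intros HX Hcl u Hu. destruct (HX (fun n => proj1_sig (u n)) Hu) as [l Hl].
  assert (HYl : Y l) by (apply (Hcl _ _ (fun n => proj2_sig (u n)) Hl)).
  exists (exist _ l HYl). exact Hl.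
Qed.

Lemma subspace_separable {X : NormedSpace} (D : nat -> X) (HY : linear_subspace (seq_closure D)) :
  separable_subspace (fun _ : subspace (seq_closure D) HY => True).
Proof.
  exists (fun n => exist _ (D n) (seq_closure_self D n)). split; [auto|].
  intros [y Hy] _ eps He. exact (Hy eps He).
Qed.

Lemma subspace_separable_dual {X : NormedSpace} (Y : X -> Prop) (HY : linear_subspace Y) :
  separable_dual_of Y -> separable_dual_of (fun _ : subspace Y HY => True).
Proof.
  intros (g & Hg & Hd).
  exists (fun n (u : subspace Y HY) => g n (proj1_sig u)). split.
  - intros n. destruct (Hg n) as (H1 & H2 & c & H3). split; [|split].
    + intros [x Hx] [y Hy] _ _. now apply H1.
    + intros a [x Hx] _. now apply H2.
    + exists c. intros [x Hx] _. now apply H3.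
  - intros h Hh eps He. pose proof (dual_elt_linear h Hh) as Hl.
    (* Values outside [Y] are irrelevant to [bounded_linear_on], so extension by zero will do. *)
    set (h' := fun x => match excluded_middle_informative (Y x) with
       | left H => h (exist _ x H) | right _ => 0 end).
    assert (Hh' : forall u : subspace Y HY, h' (proj1_sig u) = h u).
    { intros [x Hx]. unfold h'. simpl. destruct (excluded_middle_informative (Y x)); [|contradiction].
      f_equal. now apply sig_ext. }
    destruct (Hd h') with (eps := eps) as [n Hn]; [|exact He|].
    + destruct (dual_elt_bound h Hh) as (c & _ & Hc). split; [|split].
      * intros x y Hx Hy. pose proof (Hh' (vadd (exist _ x Hx : subspace Y HY) (exist _ y Hy))) as H.
        rewrite (vlinear_add h), <- !Hh' in H by exact Hl. exact H.
      * intros a x Hx. pose proof (Hh' (vscal a (exist _ x Hx : subspace Y HY))) as H.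
        rewrite (vlinear_scal h), <- Hh' in H by exact Hl. exact H.
      * exists c. intros x Hx. pose proof (Hc (exist Y x Hx)) as H. rewrite <- Hh' in H. exact H.
    + exists n. intros u _. rewrite <- Hh'. apply Hn. apply (proj2_sig u).
Qed.

(** The cone is the graph of [p] itself; being below it at [u] and at [- u] means equality. *)
Lemma subspace_dual_extend {X : NormedSpace} (Y : X -> Prop) (HY : linear_subspace Y)
    (p : subspace Y HY -> R) :
  dual_elt p -> exists p0, dual_elt p0 /\ forall u : subspace Y HY, p0 (proj1_sig u) = p u.
Proof.
  intros Hp. pose proof (dual_elt_linear p Hp) as Hl.
  destruct (dual_elt_bound p Hp) as (c & Hc & Hpc).
  destruct (bounded_functional_below_cone
    (fun h a => exists u : subspace Y HY, h = proj1_sig u /\ a = p u) c) as (p0 & Hp0 & _ & Hle).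
  - exact Hc.
  - split; [|split].
    + exists vzero. split; [reflexivity|]. symmetry. now apply vlinear_0.
    + intros x y a b (u & -> & ->) (v & -> & ->). exists (vadd u v).
      split; [reflexivity|]. symmetry. now apply vlinear_add.
    + intros x a t _ (u & -> & ->). exists (vscal t u).
      split; [reflexivity|]. symmetry. now apply vlinear_scal.
  - intros x a (u & -> & ->). specialize (Hpc u). pose proof (Rle_abs (- p u)) as H.
    rewrite Rabs_Ropp in H. change (vnorm (proj1_sig u)) with (vnorm u). lra.
  - pose proof (dual_elt_linear p0 Hp0) as Hl0.
    assert (H : forall u : subspace Y HY, p0 (proj1_sig u) <= p u) by (intros u; apply Hle; now exists u).
    exists p0. split; [exact Hp0|]. intros u. apply Rle_antisym; [apply H|].
    pose proof (H (vopp u)) as H'. change (proj1_sig (vopp u)) with (vopp (proj1_sig u)) in H'.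
    rewrite (vlinear_opp p0), (vlinear_opp p) in H' by assumption. lra.
Qed.

(** The hull generated by [a] and [e] contains the whole line, and the vector from [c] to the target
    lies in its closure, where the extended subgradient agrees with the one found there. *)
Lemma asplund_local_mean_value {X : NormedSpace} (f : X -> ereal) (a e : X) (fa sigma t1 T eps : R) :
  Asplund X -> lsc f -> f a = Fin fa -> 0 < sigma -> 0 < t1 ->
  (forall t, 0 < t <= t1 -> elt (Fin (fa + sigma * t)) (f (vadd a (vscal t e)))) ->
  0 < T -> 0 < eps ->
  exists c p, vnorm (vsub c a) < eps /\ frechet_subdiff f c p /\
    0 < p (vsub (vadd a (vscal T e)) c).
Proof.
  intros [Hcomp HAs] Hlsc Hfa Hsigma Ht1 Hinc HT Heps.
  set (b := fun n : nat => match n with O => a | _ => e end).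
  set (D := skolem_hull f b). set (Y := seq_closure D).
  assert (HY : linear_subspace Y) by apply skolem_hull_linear.
  assert (Hb : forall n, Y (b n)).
  { intros n. destruct (skolem_hull_base f b n) as [k Hk]. rewrite <- Hk. apply seq_closure_self. }
  assert (HYsep : separable_subspace Y).
  { exists D. split; [apply seq_closure_self|]. intros y Hy. exact Hy. }
  set (Z := subspace Y HY).
  set (a' := exist Y a (Hb O) : Z). set (e' := exist Y e (Hb 1%nat) : Z).
  destruct (local_mean_value (fun z : Z => f (proj1_sig z)) a' e' fa sigma t1 T eps)
    as (c & p & Hca & [Hp (pc & Hpc & Hsub)] & Hpos); auto.
  - apply subspace_complete; [exact Hcomp|]. intros u x Hu Hx. now apply (seq_closure_closed D u).
  - apply subspace_separable.
  - apply subspace_separable_dual. now apply HAs.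
  - intros z t Ht. destruct (Hlsc (proj1_sig z) t Ht) as (d & Hd & Hfd).
    exists d. split; [exact Hd|]. intros y Hy. now apply Hfd.
  - destruct (subspace_dual_extend Y HY p Hp) as (p0 & Hp0 & Hpp0).
    destruct (frechet_subdiff_extend f D (proj1_sig c) p0) as (p' & Hp' & Hpp').
    + apply skolem_hull_reflected.
    + exact HY.
    + apply (proj2_sig c).
    + exact Hp0.
    + exists pc. split; [exact Hpc|]. intros d Hd. destruct (Hsub d Hd) as (r & Hr & H).
      exists r. split; [exact Hr|]. intros y Hy Hyc.
      specialize (H (exist _ y Hy) Hyc). simpl in H.
      rewrite <- Hpp0 in H. exact H.
    + exists (proj1_sig c), p'. split; [exact Hca|]. split; [exact Hp'|].
      rewrite <- Hpp0 in Hpos. rewrite Hpp'; [exact Hpos|].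
      apply (proj2_sig (vsub (vadd a' (vscal T e')) c)).
Qed.

(** * The mean value theorem along a segment *)

Lemma not_ele (a b : ereal) : ~ ele a b -> elt b a.
Proof. destruct a, b; simpl; try tauto. lra. Qed.

(** [t] is the last time at which [f] lies below the affine function rising from [fa] to a level [r]
    under [f b]. Lower semicontinuity makes it attained, and after it [f] grows at least with slope
    [sigma]. *)
Lemma mean_value {X : NormedSpace} (f : X -> ereal) (a b : X) (fa : R) :
  Asplund X -> lsc f -> f a = Fin fa -> elt (Fin fa) (f b) ->
  exists t, 0 <= t < 1 /\ forall T eps, t < T -> 0 < eps ->
    exists c p, vnorm (vsub c (vadd a (vscal t (vsub b a)))) < eps /\ frechet_subdiff f c p /\
      0 < p (vsub (vadd a (vscal T (vsub b a))) c).
Proof.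
  intros HX Hlsc Hfa Hfb. set (e := vsub b a).
  assert (Hr : exists r, fa < r /\ elt (Fin r) (f b)).
  { destruct (f b) as [fb|]; simpl in *; [exists ((fa + fb) / 2)|exists (fa + 1)]; lra. }
  destruct Hr as (r & Hr & Hrb). set (sigma := r - fa).
  set (S := fun t => 0 <= t <= 1 /\ ele (f (vadd a (vscal t e))) (Fin (fa + sigma * t))).
  assert (S0 : S 0).
  { split; [lra|]. replace (vadd a (vscal 0 e)) with a by vlin. rewrite Hfa. simpl. lra. }
  destruct (completeness S) as (t & Hub & Hlub).
  { exists 1. intros s [Hs _]. lra. }
  { now exists 0. }
  assert (Ht : 0 <= t <= 1) by (split; [now apply Hub|apply Hlub; intros s [Hs _]; lra]).
  assert (St : S t).
  { split; [exact Ht|]. apply NNPP. intros H. apply not_ele in H.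
    destruct (Hlsc _ _ H) as (d & Hd & Hfd).
    assert (Hex : exists s, S s /\ t - d / (vnorm e + 1) < s).
    { apply NNPP. intros Hno.
      assert (0 < d / (vnorm e + 1)) by (apply Rdiv_lt_0_compat; pose proof (vnorm_nonneg _ e); lra).
      assert (t <= t - d / (vnorm e + 1)); [|lra]. apply Hlub. intros s Hs.
      apply Rnot_lt_le. intros Hlt. apply Hno. now exists s. }
    destruct Hex as (s & Hs & Hst). pose proof (Hub s Hs) as Hs'.
    assert (Hn : vnorm (vsub (vadd a (vscal s e)) (vadd a (vscal t e))) < d).
    { rewrite (vnorm_eq_scal _ (s - t) e) by vlin. rewrite Rabs_left1 by lra.
      pose proof (vnorm_nonneg _ e).
      apply Rle_lt_trans with ((t - s) * (vnorm e + 1)); [nra|].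
      apply Rlt_le_trans with (d / (vnorm e + 1) * (vnorm e + 1)); [apply Rmult_lt_compat_r; lra|].
      right. field. lra. }
    specialize (Hfd _ Hn). destruct Hs as [_ Hs].
    destruct (f (vadd a (vscal s e))); simpl in *; [|contradiction]. unfold sigma in *. nra. }
  assert (Ht1 : t < 1).
  { destruct (Req_dec t 1) as [->|]; [|lra]. destruct St as [_ St].
    replace (vadd a (vscal 1 e)) with b in St by (unfold e; vlin).
    destruct (f b); simpl in *; [unfold sigma in *; lra|contradiction]. }
  exists t. split; [lra|]. intros T eps HT He.
  destruct St as [_ St]. set (a1 := vadd a (vscal t e)) in *.
  destruct (f a1) as [fa1|] eqn:Efa1; [|contradiction]. simpl in St.
  destruct (asplund_local_mean_value f a1 e fa1 sigma (1 - t) (T - t) eps HX Hlsc Efa1)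
    as (c & p & Hc & Hp & Hpos); try (unfold sigma; lra).
  - intros s Hs. replace (vadd a1 (vscal s e)) with (vadd a (vscal (t + s) e)) by (unfold a1; vlin).
    assert (Hns : ~ S (t + s)) by (intros H; apply Hub in H; lra).
    destruct (classic (ele (f (vadd a (vscal (t + s) e))) (Fin (fa + sigma * (t + s))))) as [H|H].
    + exfalso. apply Hns. split; [lra|exact H].
    + apply not_ele in H. destruct (f (vadd a (vscal (t + s) e))); simpl in *; lra.
  - exists c, p. split; [exact Hc|]. split; [exact Hp|].
    replace (vadd a (vscal T e)) with (vadd a1 (vscal (T - t) e)) by (unfold a1; vlin). exact Hpos.
Qed.

(** * From quasimonotone to quasiconvex functions *)

Definition quasimonotone {X : NormedSpace} (f : X -> ereal) : Prop :=
  forall a b p q, frechet_subdiff f a p -> frechet_subdiff f b q ->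
    0 < p (vsub b a) -> q (vsub a b) <= 0.

(** If [f] were larger at [w] than at [y], the mean value theorem from [y] to [w], aimed at [a]
    beyond [w], would give a subgradient at some [c] pointing to [a]. Since [c] is close to the
    segment, [p (c - a) > 0], the forbidden configuration. *)
Lemma quasimonotone_segment {X : NormedSpace} (f : X -> ereal) (a y : X) (p : X -> R) (s : R) :
  Asplund X -> lsc f -> quasimonotone f -> frechet_subdiff f a p -> 0 < p (vsub y a) ->
  0 < s < 1 -> ele (f (vadd a (vscal s (vsub y a)))) (f y).
Proof.
  intros HX Hlsc Hqm Hp Hpy Hs. set (w := vadd a (vscal s (vsub y a))).
  apply NNPP. intros H. apply not_ele in H.
  destruct (f y) as [fy|] eqn:Efy; [|destruct (f w); contradiction].
  pose proof (dual_elt_linear p (proj1 Hp)) as Hl.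
  destruct (dual_elt_bound p (proj1 Hp)) as (K & HK & HpK).
  destruct (mean_value f y w fy HX Hlsc Efy H) as (t & Ht & Hmv).
  set (m := (1 - t * (1 - s)) * p (vsub y a)).
  assert (Hm : 0 < m) by (apply Rmult_lt_0_compat; [nra|exact Hpy]).
  assert (Hs1 : 1 < / (1 - s)) by (rewrite <- Rinv_1; apply Rinv_lt_contravar; lra).
  destruct (Hmv (/ (1 - s)) (m / (K + 1))) as (c & q & Hc & Hq & Hpos).
  - lra.
  - apply Rdiv_lt_0_compat; lra.
  - replace (vadd y (vscal (/ (1 - s)) (vsub w y))) with a in Hpos by (unfold w; vlin).
    assert (Hpc : 0 < p (vsub c a)).
    { set (c0 := vadd y (vscal t (vsub w y))) in *.
      assert (Hc0 : p (vsub c a) = m + p (vsub c c0)).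
      { unfold m. plin p Hl. unfold c0, w. plin p Hl. ring. }
      pose proof (HpK (vsub c c0)) as H1. pose proof (Rle_abs (- p (vsub c c0))) as H2.
      rewrite Rabs_Ropp in H2.
      assert (K * vnorm (vsub c c0) < m).
      { pose proof (vnorm_nonneg _ (vsub c c0)).
        apply Rle_lt_trans with ((K + 1) * vnorm (vsub c c0)); [nra|].
        apply Rlt_le_trans with ((K + 1) * (m / (K + 1))); [apply Rmult_lt_compat_l; lra|].
        right. field. lra. }
      lra. }
    pose proof (Hqm a c p q Hp Hq Hpc). lra.
Qed.

(** The mean value theorem from [x] to [z], aimed at [y], gives a subgradient at some [c] pointing
    to [y]. By [quasimonotone_segment], [f] is at most [f y] between [c] and [y], but this segment
    passes close to [z], where [f] exceeds [f y]. *)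
Lemma quasimonotone_quasiconvex {X : NormedSpace} (f : X -> ereal) :
  Asplund X -> lsc f -> quasimonotone f -> quasiconvex f.
Proof.
  intros HX Hlsc Hqm x y lam Hlam. set (z := vadd (vscal lam x) (vscal (1 - lam) y)).
  apply NNPP. intros H. apply not_ele in H.
  destruct (f x) as [fx|] eqn:Efx; [|destruct (f y), (f z); contradiction].
  destruct (f y) as [fy|] eqn:Efy; [|destruct (f z); contradiction].
  simpl emax in H.
  assert (Hzx : elt (Fin fx) (f z)).
  { destruct (f z); simpl in *; [|exact I]. pose proof (Rmax_l fx fy). lra. }
  assert (Hzy : elt (Fin fy) (f z)).
  { destruct (f z); simpl in *; [|exact I]. pose proof (Rmax_r fx fy). lra. }
  destruct (mean_value f x z fx HX Hlsc Efx Hzx) as (t & Ht & Hmv).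
  destruct (Hlsc z fy Hzy) as (d & Hd & Hfd).
  set (T := / (1 - lam)).
  assert (HT : 1 < T) by (unfold T; rewrite <- Rinv_1; apply Rinv_lt_contravar; lra).
  assert (HTl : T * (1 - lam) = 1) by (unfold T; field; lra).
  destruct (Hmv T d ltac:(lra) Hd) as (c & p & Hc & Hp & Hpos).
  assert (Ey : vadd x (vscal T (vsub z x)) = y) by (unfold z, T; vlin).
  rewrite Ey in Hpos.
  (* With this parameter, [w] would be [z] exactly if [c] lay on the line at time [t]. *)
  set (s := (1 - t) / (T - t)).
  assert (Hs : 0 < s < 1).
  { unfold s. split; [apply Rdiv_lt_0_compat; lra|]. apply Rlt_div_l; lra. }
  pose proof (quasimonotone_segment f c y p s HX Hlsc Hqm Hp Hpos Hs) as Hseg.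
  set (w := vadd c (vscal s (vsub y c))) in *.
  assert (Hw : vsub w z = vscal (1 - s) (vsub c (vadd x (vscal t (vsub z x))))).
  { unfold w. rewrite <- Ey at 1. unfold s. vlin. }
  assert (Hwd : vnorm (vsub w z) < d).
  { rewrite Hw, vnorm_scal, Rabs_pos_eq by lra.
    pose proof (vnorm_nonneg _ (vsub c (vadd x (vscal t (vsub z x))))). nra. }
  specialize (Hfd w Hwd). rewrite Efy in Hseg. destruct (f w); simpl in *; [lra|contradiction].
Qed.

(** * Tilts, and quasimonotonicity of quasiconvex functions *)

Lemma lsc_tilt {X : NormedSpace} (phi : X -> ereal) (v : X -> R) :
  lsc phi -> dual_elt v -> lsc (tilt phi v).
Proof.
  intros Hlsc Hv x t Ht. pose proof (dual_elt_linear v Hv) as Hl.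
  destruct (dual_elt_bound v Hv) as (K & HK & HvK).
  assert (He : exists e, 0 < e /\ elt (Fin (t - v x + e)) (phi x)).
  { unfold tilt in Ht. destruct (phi x) as [r|]; simpl in *.
    - exists ((r + v x - t) / 2). lra.
    - exists 1. split; [lra|exact I]. }
  destruct He as (e & He & Hte). destruct (Hlsc x _ Hte) as (d & Hd & Hfd).
  exists (Rmin d (e / (K + 1))). split.
  - apply Rlt_gt, Rmin_glb_lt; [lra|]. apply Rdiv_lt_0_compat; lra.
  - intros y Hy. pose proof (Rmin_l d (e / (K + 1))). pose proof (Rmin_r d (e / (K + 1))).
    specialize (Hfd y ltac:(lra)). unfold tilt. destruct (phi y) as [r|]; simpl in *; [|exact I].
    pose proof (HvK (vsub y x)) as H1. rewrite (vlinear_sub v) in H1 by exact Hl.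
    pose proof (Rle_abs (- (v y - v x))) as H2. rewrite Rabs_Ropp in H2.
    assert (K * vnorm (vsub y x) <= e); [|lra].
    pose proof (vnorm_nonneg _ (vsub y x)).
    apply Rle_trans with ((K + 1) * vnorm (vsub y x)); [nra|].
    apply Rle_trans with ((K + 1) * (e / (K + 1))); [apply Rmult_le_compat_l; lra|].
    right. field. lra.
Qed.

Lemma frechet_subdiff_tilt {X : NormedSpace} (phi : X -> ereal) (v p : X -> R) (x : X) (c : R) :
  dual_elt v -> frechet_subdiff phi x p ->
  frechet_subdiff (tilt phi (fun y => c * v y)) x (fun h => 1 * p h + c * v h).
Proof.
  intros Hv [Hp (px & Hpx & Hsub)]. pose proof (dual_elt_linear v Hv) as Hl.
  split; [now apply dual_elt_comb|].
  exists (px + c * v x). unfold tilt. split; [rewrite Hpx; reflexivity|].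
  intros eps He. destruct (Hsub eps He) as (d & Hd & H). exists d. split; [exact Hd|].
  intros y Hy. specialize (H y Hy). destruct (phi y); simpl in *; [|exact I].
  rewrite (vlinear_sub v) by exact Hl. lra.
Qed.

Lemma frechet_subdiff_untilt {X : NormedSpace} (phi : X -> ereal) (v p : X -> R) (x : X) :
  dual_elt v -> frechet_subdiff (tilt phi v) x p ->
  frechet_subdiff phi x (fun h => 1 * p h + -1 * v h).
Proof.
  intros Hv [Hp (px & Hpx & Hsub)]. pose proof (dual_elt_linear v Hv) as Hl.
  split; [now apply dual_elt_comb|]. unfold tilt in *.
  destruct (phi x) as [r|] eqn:Ex; [|discriminate]. injection Hpx as <-.
  exists r. split; [reflexivity|].
  intros eps He. destruct (Hsub eps He) as (d & Hd & H). exists d. split; [exact Hd|].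
  intros y Hy. specialize (H y Hy). destruct (phi y); simpl in *; [|exact I].
  rewrite (vlinear_sub v) by exact Hl. lra.
Qed.

Lemma frechet_subdiff_increase {X : NormedSpace} (f : X -> ereal) (x h : X) (p : X -> R) :
  frechet_subdiff f x p -> 0 < p h ->
  exists d, 0 < d /\ forall t, 0 < t < d -> elt (f x) (f (vadd x (vscal t h))).
Proof.
  intros [Hp (px & Hpx & Hsub)] Hph. pose proof (dual_elt_linear p Hp) as Hl.
  assert (Hh : 0 < vnorm h).
  { destruct (vnorm_nonneg _ h) as [H|H]; [exact H|]. symmetry in H. apply vnorm_eq0 in H.
    subst h. rewrite (vlinear_0 p Hl) in Hph. lra. }
  destruct (Hsub (p h / (2 * vnorm h))) as (d & Hd & H).
  { apply Rdiv_lt_0_compat; lra. }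
  exists (d / vnorm h). split; [apply Rdiv_lt_0_compat; lra|]. intros t Ht.
  assert (Hth : t * vnorm h < d).
  { apply Rlt_le_trans with (d / vnorm h * vnorm h); [apply Rmult_lt_compat_r; lra|].
    right. field. lra. }
  specialize (H (vadd x (vscal t h))).
  replace (vsub (vadd x (vscal t h)) x) with (vscal t h) in H by vlin.
  rewrite vnorm_scal, (Rabs_pos_eq t), (vlinear_scal p) in H by (auto; lra).
  rewrite Hpx. specialize (H ltac:(split; [apply Rmult_lt_0_compat; lra|exact Hth])).
  replace (px + t * p h - p h / (2 * vnorm h) * (t * vnorm h)) with (px + t * p h / 2) in H
    by (field; lra).
  destruct (f (vadd x (vscal t h))); simpl in *; [|exact I]. nra.
Qed.

(** Just after leaving [y] towards [x], the function exceeds [f y], the larger of the two endpoint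
    values. *)
Lemma quasiconvex_no_opposite_increase {X : NormedSpace} (f : X -> ereal) (x y : X) (p q : X -> R) :
  quasiconvex f -> frechet_subdiff f x p -> frechet_subdiff f y q ->
  0 < p (vsub y x) -> 0 < q (vsub x y) -> ele (f x) (f y) -> False.
Proof.
  intros Hqc Hp Hq Hpy Hqx Hxy.
  destruct (frechet_subdiff_increase f y (vsub x y) q Hq Hqx) as (d & Hd & H).
  set (t := Rmin d 1 / 2).
  assert (Ht : 0 < t < d /\ t < 1).
  { unfold t. pose proof (Rmin_l d 1). pose proof (Rmin_r d 1).
    assert (0 < Rmin d 1) by (apply Rmin_glb_lt; lra). lra. }
  specialize (H t (proj1 Ht)). specialize (Hqc x y t ltac:(lra)).
  replace (vadd (vscal t x) (vscal (1 - t) y)) with (vadd y (vscal t (vsub x y))) in Hqc by vlin.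
  destruct (f x) as [fx|], (f y) as [fy|], (f (vadd y (vscal t (vsub x y)))); simpl in *; try contradiction.
  rewrite Rmax_right in Hqc; lra.
Qed.

Lemma ele_total (a b : ereal) : ele a b \/ ele b a.
Proof. destruct a, b; simpl; try tauto. lra. Qed.

Lemma quasiconvex_quasimonotone {X : NormedSpace} (f : X -> ereal) : quasiconvex f -> quasimonotone f.
Proof.
  intros Hqc x y p q Hp Hq Hpy. apply Rnot_lt_le. intros Hqx.
  destruct (ele_total (f x) (f y)) as [H|H].
  - exact (quasiconvex_no_opposite_increase f x y p q Hqc Hp Hq Hpy Hqx H).
  - exact (quasiconvex_no_opposite_increase f y x q p Hqc Hq Hp Hqx Hpy H).
Qed.

Theorem theorem3p2 (X : NormedSpace) (phi : X -> ereal) (alpha : R) :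
  Asplund X -> proper phi -> lsc phi -> alpha > 0 ->
  (robustly_quasiconvex alpha phi <->
   forall (x y : X) (xs ys : X -> R),
     frechet_subdiff phi x xs -> frechet_subdiff phi y ys ->
     Rmin (xs (vsub y x)) (ys (vsub x y)) > - alpha * vnorm (vsub y x) ->
     xs (vsub x y) - ys (vsub x y) >= 0).
Proof.
  intros HX _ Hlsc Halpha. split.
  - intros Hrob x y xs ys Hxs Hys Hmin.
    pose proof (dual_elt_linear xs (proj1 Hxs)) as Hlx.
    pose proof (dual_elt_linear ys (proj1 Hys)) as Hly.
    apply Rnot_lt_ge. intros Hlt.
    set (h := vsub y x) in *. assert (Ehx : vsub x y = vopp h) by (unfold h; vlin).
    rewrite Ehx in *.
    rewrite (vlinear_opp xs), (vlinear_opp ys) in Hlt by assumption.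
    rewrite (vlinear_opp ys) in Hmin by assumption.
    pose proof (Rmin_l (xs h) (- ys h)) as Hm1. pose proof (Rmin_r (xs h) (- ys h)) as Hm2.
    assert (Hh : 0 < vnorm h).
    { destruct (vnorm_nonneg _ h) as [H|H]; [exact H|]. symmetry in H. apply vnorm_eq0 in H.
      rewrite H, (vlinear_0 xs Hlx), (vlinear_0 ys Hly) in Hlt. lra. }
    (* A functional of norm at most [alpha] whose value at [- h] separates [ys h] from
       [xs h]: such a value exists as [ys h < alpha |h|] and [xs h > - alpha |h|]. *)
    set (A := alpha * vnorm h). assert (HA : 0 < A) by (apply Rmult_lt_0_compat; lra).
    assert (Hc : exists c, ys h < c < xs h /\ - A <= c <= A).
    { set (u := Rmin (xs h) A). set (l := Rmax (ys h) (- A)).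
      assert (l < u).
      { unfold l, u. apply Rmax_lub_lt; apply Rmin_glb_lt; unfold A in *; lra. }
      exists ((l + u) / 2). unfold l, u in *.
      pose proof (Rmin_l (xs h) A). pose proof (Rmin_r (xs h) A).
      pose proof (Rmax_l (ys h) (- A)). pose proof (Rmax_r (ys h) (- A)). lra. }
    destruct Hc as (c & Hc & HcA).
    destruct (norming_functional h) as (n & Hn & Hn1 & Hnh).
    set (k := - c / vnorm h).
    assert (Hkh : k * n h = - c) by (rewrite Hnh; unfold k; field; lra).
    assert (Hk : Rabs k <= alpha).
    { unfold k, Rdiv. rewrite Rabs_mult, Rabs_Ropp, (Rabs_pos_eq (/ vnorm h))
        by (left; now apply Rinv_0_lt_compat).
      apply (Rmult_le_reg_r (vnorm h)); [exact Hh|].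
      replace (Rabs c * / vnorm h * vnorm h) with (Rabs c) by (field; lra).
      apply Rabs_le. exact HcA. }
    assert (Hv : dual_norm_le (fun z => k * n z) alpha).
    { intros z. rewrite Rabs_mult. specialize (Hn1 z).
      pose proof (Rabs_pos k). pose proof (Rabs_pos (n z)). pose proof (vnorm_nonneg _ z). nra. }
    assert (Hvd : dual_elt (fun z => k * n z)).
    { apply (dual_elt_intro _ alpha); [|exact Hv]. pose proof (dual_elt_linear n Hn) as Hnl.
      split; intros; plin n Hnl; ring. }
    pose proof (quasiconvex_quasimonotone _ (Hrob _ Hvd Hv) x y _ _
      (frechet_subdiff_tilt phi n xs x k Hn Hxs) (frechet_subdiff_tilt phi n ys y k Hn Hys)) as Hqm.
    fold h in Hqm. rewrite Ehx in Hqm.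
    rewrite (vlinear_opp ys), (vlinear_opp n) in Hqm by (auto; now apply dual_elt_linear).
    specialize (Hqm ltac:(lra)). lra.
  - intros Hmono v Hv Hva.
    apply quasimonotone_quasiconvex; [exact HX|now apply lsc_tilt|].
    intros x y p q Hp Hq Hpy. apply Rnot_lt_le. intros Hqx.
    pose proof (Hmono x y _ _ (frechet_subdiff_untilt phi v p x Hv Hp)
      (frechet_subdiff_untilt phi v q y Hv Hq)) as H. simpl in H.
    pose proof (dual_elt_linear v Hv) as Hl.
    pose proof (dual_elt_linear p (proj1 Hp)) as Hlp.
    (* The norm bound on [v] turns positivity of [p] and [q] into the lower bound
       [- alpha * |y - x|] for the untilted subgradients. *)
    pose proof (Rle_abs (v (vsub y x))) as H1. pose proof (Rle_abs (v (vsub x y))) as H2.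
    pose proof (Hva (vsub y x)) as H3. pose proof (Hva (vsub x y)) as H4.
    rewrite (vnorm_sub_sym x y) in H4.
    assert (H5 : p (vsub x y) = - p (vsub y x)) by (plin p Hlp; ring).
    (* The contributions of [v] cancel, leaving [p (x - y) >= q (x - y)] although the former is
       negative and the latter positive. *)
    enough (1 * p (vsub x y) + -1 * v (vsub x y) - (1 * q (vsub x y) + -1 * v (vsub x y)) >= 0) by lra.
    apply H. apply Rlt_gt, Rmin_glb_lt; lra.
Qed.
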